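(* Let $\widehat f\in\widehat{\mathcal L}$ be parabolic, let $\widehat g=\mathrm{id}-\widehat f$, let $\widehat g^{-1}$ be its formal inverse and let $\widehat\Psi$ be a formal Fatou coordinate of $\widehat f$. Then the formal continuous time length $$\widehat A^c_{\widehat f}(\varepsilon)=\widehat g^{-1}(2\varepsilon)+2\varepsilon\,\widehat\Psi\big(\widehat g^{-1}(2\varepsilon)\big)$$ is a well-defined element of $\widehat{\mathcal L}_2$ (in the variable $\varepsilon$).
   Context: Iterated logarithms: $\boldsymbol\ell(x)=\boldsymbol\ell_1(x)=-1/\log x$, $\boldsymbol\ell_{j+1}=\boldsymbol\ell\circ\boldsymbol\ell_j$ (so $\boldsymbol\ell_2(x)=1/\log(-\log x)$), used both as germs at $0^+$ and as formal symbols. For $j\ge0$, $\widehat{\mathcal L}_j^\infty$ is the set of formal sums $\sum_{i_0}\sum_{i_1}\cdots\sum_{i_j}a_{i_0\dots i_j}x^{\alpha_{i_0}}\boldsymbol\ell^{\alpha_{i_0i_1}}\cdots\boldsymbol\ell_j^{\alpha_{i_0\cdots i_j}}$ with real coefficients, where for each $k$ the sequence $(\alpha_{i_0\cdots i_k})_{i_k}$ is a finite or strictly increasing sequence of reals tending to $+\infty$; $\widehat{\mathcal L}_j$ is the subset where all exponents of $x$ are positive; $\widehat{\mathcal L}$ is the subset of $\widehat{\mathcal L}_1$ with only integer powers of $\boldsymbol\ell$; $\widehat{\mathfrak L}=\bigcup_{j}\widehat{\mathcal L}_j^\infty$. Monomials are compared via the lexicographic order on exponent tuples $(\gamma_0,\dots,\gamma_j)$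 (larger tuple = higher order); the leading term is the term with lexicographically smallest exponent tuple. $\widehat f\in\widehat{\mathcal L}$ is parabolic if its leading term is $x$. Formal composition and inversion are the standard ones in these transseries classes. A formal Fatou coordinate of parabolic $\widehat f$ is $\widehat\Psi\in\widehat{\mathfrak L}$ with $\widehat\Psi\circ\widehat f-\widehat\Psi=1$; it is known that such $\widehat\Psi$ exists in $\widehat{\mathcal L}_2^\infty$ and is unique in $\widehat{\mathfrak L}$ up to an additive constant, so $\widehat A^c_{\widehat f}$ is defined up to an additive term $K\varepsilon$, $K\in\mathbb R$.
   Formalization: The formal theorem additionally assumes that g = id − f is nonzero with positive leading coefficient; without this the formal inverse g^{-1} does not exist among real transseries (e.g. f = x + x², where g = −x², or f = id). *)

(* Defs.v *)
From Stdlib Require Import Reals List Arith ClassicalEpsilon.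
Open Scope R_scope.

(* ---------- monomials x^{g0} l^{g1} l_2^{g2} ... (l_0 = x) ---------- *)
Definition mon := nat -> R.
(* a formal sum: coefficient of each monomial *)
Definition ser := mon -> R.

Definition mon0 : mon := fun _ => 0.
Definition monD (a b : mon) : mon := fun k => a k + b k.
Definition monS (c : R) (a : mon) : mon := fun k => c * a k.
Definition monE (k : nat) (r : R) : mon := fun i => if Nat.eqb i k then r else 0.
Definition depth_le (j : nat) (m : mon) : Prop := forall k, (j < k)%nat -> m k = 0.

(* lexicographic order: a < b  (b is of higher order) *)
Definition mon_lt (a b : mon) : Prop :=
  exists k, (forall i, (i < k)%nat -> a i = b i) /\ a k < b k.

Definition finR (P : R -> Prop) : Prop := exists l : list R, forall r, P r -> In r l.

(* \hat L_j^\infty : support in depth j, and for every k <= j and every fixed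
   prefix of exponents (g0..g_{k-1}), the exponents g_k occurring form a finite
   or strictly increasing sequence tending to +oo, i.e. only finitely many of
   them lie below any bound M. *)
Definition in_Linf (j : nat) (F : ser) : Prop :=
  (forall m, F m <> 0 -> depth_le j m) /\
  (forall (k : nat) (p : mon) (M : R), (k <= j)%nat ->
     finR (fun r => r <= M /\ exists m, F m <> 0 /\
              (forall i, (i < k)%nat -> m i = p i) /\ m k = r)).

Definition in_L (j : nat) (F : ser) : Prop :=
  in_Linf j F /\ forall m, F m <> 0 -> 0 < m 0%nat.

Definition in_Lhat (F : ser) : Prop :=
  in_L 1 F /\ forall m, F m <> 0 -> exists z : Z, m 1%nat = IZR z.

Definition in_frakL (F : ser) : Prop := exists j, in_Linf j F.

Definition lead (F : ser) (c : R) (M : mon) : Prop :=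
  F M = c /\ c <> 0 /\ forall m, F m <> 0 -> m <> M -> mon_lt M m.

Definition mono (c : R) (m : mon) : ser :=
  fun m' => if excluded_middle_informative (m' = m) then c else 0.
Definition szero : ser := fun _ => 0.
Definition one : ser := mono 1 mon0.
Definition X : ser := mono 1 (monE 0 1).
Definition sadd (F G : ser) : ser := fun m => F m + G m.
Definition sscale (c : R) (F : ser) : ser := fun m => c * F m.
Definition sopp (F : ser) : ser := sscale (-1) F.
Definition ssub (F G : ser) : ser := sadd F (sopp G).

Definition fin_supp {I : Type} (P : I -> Prop) (l : list I) : Prop :=
  NoDup l /\ forall i, In i l <-> P i.

Definition fsumR {I : Type} (a : I -> R) : R :=
  match excluded_middle_informative (exists l, fin_supp (fun i => a i <> 0) l) with
  | left H => fold_right Rplus 0 (map a (proj1_sig (constructive_indefinite_description _ H)))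
  | right _ => 0
  end.

Definition ssum {I : Type} (Fam : I -> ser) : ser := fun m => fsumR (fun i => Fam i m).

Definition summable {I : Type} (Fam : I -> ser) : Prop :=
  (forall m, exists l, fin_supp (fun i => Fam i m <> 0) l) /\
  exists j, in_Linf j (fun m =>
     if excluded_middle_informative (exists i, Fam i m <> 0) then 1 else 0).

Definition smul (F G : ser) : ser :=
  ssum (fun p : mon * mon => mono (F (fst p) * G (snd p)) (monD (fst p) (snd p))).
Definition spow (F : ser) (n : nat) : ser := Nat.iter n (smul F) one.

Fixpoint gprod (a : R) (n : nat) : R :=
  match n with 0%nat => 1 | S k => gprod a k * (a - INR k) end.
Definition gbinom (a : R) (n : nat) : R := gprod a n / INR (fact n).

Definition leadcm (G : ser) : R * mon :=
  match excluded_middle_informative (exists cM : R * mon, lead G (fst cM) (snd cM)) with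
  | left H => proj1_sig (constructive_indefinite_description _ H)
  | right _ => (0, mon0)
  end.

(* G = c M (1 + delta G) *)
Definition sdelta (G : ser) : ser :=
  let c := fst (leadcm G) in let M := snd (leadcm G) in
  ssub (smul (mono (/ c) (monS (-1) M)) G) one.

(* G^a = c^a M^a sum_n (a choose n) delta^n   (for c > 0) *)
Definition rpow (G : ser) (a : R) : ser :=
  let c := fst (leadcm G) in let M := snd (leadcm G) in
  smul (mono (Rpower c a) (monS a M))
       (ssum (fun n : nat => sscale (gbinom a n) (spow (sdelta G) n))).

Definition sinv (G : ser) : ser :=
  let c := fst (leadcm G) in let M := snd (leadcm G) in
  smul (mono (/ c) (monS (-1) M))
       (ssum (fun n : nat => sscale ((-1) ^ n) (spow (sdelta G) n))).

(* log of a monomial:  log l_k = -1/l_{k+1}  (with l_0 = x) *)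
Definition logmon (M : mon) : ser :=
  ssum (fun k : nat => mono (- M k) (monE (S k) (-1))).

Definition slog (G : ser) : ser :=
  let c := fst (leadcm G) in let M := snd (leadcm G) in
  sadd (sadd (mono (ln c) mon0) (logmon M))
       (ssum (fun n : nat => match n with
                             | 0%nat => szero
                             | S n' => sscale ((-1) ^ n' / INR (S n')) (spow (sdelta G) (S n'))
                             end)).

Definition ell_comp (G : ser) : ser := sopp (sinv (slog G)).
Definition Lk (H : ser) (k : nat) : ser := Nat.iter k ell_comp H.

Definition mdepth (m : mon) : nat :=
  match excluded_middle_informative (exists j, depth_le j m) with
  | left H => proj1_sig (constructive_indefinite_description _ H)
  | right _ => 0%nat
  end.

Definition comp_mon (H : ser) (m : mon) : ser :=
  fold_right (fun k acc => smul (rpow (Lk H k) (m k)) acc) one (seq 0 (S (mdepth m))).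

Definition comp_family (F H : ser) : mon -> ser := fun m => sscale (F m) (comp_mon H m).
Definition scomp (F H : ser) : ser := ssum (comp_family F H).

Definition comp_ok (F H : ser) : Prop :=
  in_frakL H /\ (exists c M, lead H c M /\ 0 < c /\ mon_lt mon0 M) /\
  summable (comp_family F H).

Definition parabolic (f : ser) : Prop := in_Lhat f /\ lead f 1 (monE 0 1).

Definition is_finv (g h : ser) : Prop :=
  in_frakL h /\ comp_ok g h /\ comp_ok h g /\ scomp g h = X /\ scomp h g = X.

Definition fatou_coord (f Psi : ser) : Prop :=
  in_frakL Psi /\ comp_ok Psi f /\ scomp Psi f = sadd Psi one.

(* Main.v *)
Require Import Defs.
From Stdlib Require Import Reals List Arith Lra Lia ClassicalEpsilon FunctionalExtensionality Permutation ProofIrrelevance.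
Open Scope R_scope.

(** Composition with a series H of leading term c x^alpha l_1^b1 ... (c, alpha > 0) is a strongly
    linear ring morphism C_H, compatible with real powers and logarithms; hence composition is
    associative.  The identities for powers hold for integer exponents and extend to real ones
    because every coefficient is polynomial in the exponent; those for logarithms follow by
    differentiating at exponent 0.  Sending a monomial to the leading term of its image is an
    invertible operator U with C_H = (1 + E) U, where E multiplies by infinitesimals, so a Neumann
    series gives a left inverse of every such H, and associativity makes it two-sided and unique.

    For g = id - f with leading monomial M, this puts g^{-1} in depth 2 with leading exponent
    1/alpha in x.  If Psi o f - Psi = 1, apply the derivation with respect to 1/l_2 (x and l_1
    being constants): it commutes with composition with f because log l_1(f) + 1/l_2 only involves
    x and l_1.  So the derivative of Psi is invariant under f, hence constant because F o f - F has
    leading monomial m (M/x) l_1 ... l_k when F has leading nonconstant monomial m with first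
    nonzero exponent at l_k.  Therefore Psi is a series in x and l_1 plus a multiple of 1/l_2, and
    the leading monomial of Psi o f - Psi being 1, the exponents of x in Psi are at least 1 - alpha. *)

(** * Finitely supported sums *)

(** Every infinite sum is an [fsumR], which returns 0 on an infinite support, so an exchange of sums
    is never free. [tame] packages the finiteness needed for an operator given on monomials, and
    [op_op] is the only place where sums are exchanged; associativity of products and of
    composition, multiplicativity and the Leibniz rule are then checked on monomials only. The
    supports are trees of exponents with a finiteness condition at every node, so the combinatorial
    lemmas go level by level. A Fatou coordinate is only assumed to have some depth, so depth 2 has
    to be proved. The derivation is chosen to make [f] itself a constant: the chain rule then
    produces no factor from [f], and invariance under [f] passes to the derivative. The coefficient
    [c] of the leading term of [id - f] is taken positive because real powers and the logarithm of
    [g] involve those of [c]. *)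

Definition finite {I : Type} (P : I -> Prop) : Prop := exists l : list I, forall i, P i -> In i l.

Definition eq_dec_cl {I : Type} (x y : I) : {x = y} + {x <> y} := excluded_middle_informative (x = y).

Definition sumR (l : list R) : R := fold_right Rplus 0 l.

Lemma finite_sub {I : Type} (P Q : I -> Prop) : finite Q -> (forall i, P i -> Q i) -> finite P.
Proof. intros [l H] S; exists l; auto. Qed.

Lemma finite_nodup {I : Type} (P : I -> Prop) :
  finite P -> exists l, NoDup l /\ forall i, In i l <-> P i.
Proof.
  intros [l H].
  exists (nodup eq_dec_cl (filter (fun i => if excluded_middle_informative (P i) then true else false) l)).
  split; [apply NoDup_nodup|]. intro i. rewrite nodup_In, filter_In.
  destruct (excluded_middle_informative (P i)); split; intuition auto; try easy.
Qed.

Lemma finite_or {I : Type} (P Q : I -> Prop) : finite P -> finite Q -> finite (fun i => P i \/ Q i).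
Proof.
  intros [l H] [l' H']; exists (l ++ l'); intros i [h|h]; apply in_or_app; auto.
Qed.

Lemma finite_ex {I K : Type} (P : I -> Prop) (Q : I -> K -> Prop) :
  finite P -> (forall i, P i -> finite (Q i)) -> finite (fun k => exists i, P i /\ Q i k).
Proof.
  intros [l H] HQ.
  assert (G : forall l', exists lk, forall i k, In i l' -> P i -> Q i k -> In k lk).
  { induction l' as [|a l' [lk IH]]; [exists nil; intros ? ? []|].
    destruct (excluded_middle_informative (P a)) as [pa|pa].
    - destruct (HQ a pa) as [la Ha]. exists (la ++ lk). intros i k [<-|h] p q; apply in_or_app; eauto.
    - exists lk. intros i k [<-|h] p q; [easy|eauto]. }
  destruct (G l) as [lk Hk]. exists lk. intros k (i & p & q). eauto.
Qed.

Lemma finite_image {I K : Type} (g : I -> K) (P : I -> Prop) :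
  finite P -> finite (fun k => exists i, P i /\ k = g i).
Proof.
  intros H; apply finite_ex; [easy|]. intros i _. exists (g i :: nil). intros k ->; now left.
Qed.

Lemma finite_preimage {I K : Type} (g : I -> K) (P : I -> Prop) (Q : K -> Prop) :
  finite Q -> (forall i j, P i -> P j -> g i = g j -> i = j) -> (forall i, P i -> Q (g i)) -> finite P.
Proof.
  intros HQ inj sub.
  apply finite_sub with (Q := fun i => exists k, Q k /\ (P i /\ g i = k)).
  - apply finite_ex; [easy|]. intros k _.
    destruct (excluded_middle_informative (exists i, P i /\ g i = k)) as [[i [p e]]|n].
    + exists (i :: nil). intros i' [p' e']. left. apply inj; congruence.
    + exists nil. intros i' p'. apply n. eauto.
  - intros i p. eauto.
Qed.

Lemma finite_pair {I K : Type} (P : I -> Prop) (Q : I -> K -> Prop) :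
  finite P -> (forall i, P i -> finite (Q i)) -> finite (fun p : I * K => P (fst p) /\ Q (fst p) (snd p)).
Proof.
  intros HP HQ.
  apply finite_sub with (Q := fun p => exists i, P i /\ exists k, Q i k /\ p = (i, k)).
  - apply finite_ex; [easy|]. intros i p. apply (finite_image (fun k => (i, k))). auto.
  - intros [i k] [p q]; simpl in *; eauto.
Qed.

Lemma finite_lt (n : nat) : finite (fun k => (k < n)%nat).
Proof. exists (seq 0 n). intros k h. apply in_seq. lia. Qed.

Lemma sumR_perm l l' : Permutation l l' -> sumR l = sumR l'.
Proof. induction 1; simpl; lra. Qed.

Lemma sumR_filter {I : Type} (a : I -> R) (b : I -> bool) l :
  (forall i, In i l -> b i = false -> a i = 0) -> sumR (map a (filter b l)) = sumR (map a l).
Proof.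
  induction l as [|x l IH]; intros H; simpl; [easy|].
  destruct (b x) eqn:e; simpl; rewrite IH; try (intros; apply H; simpl; auto); try easy.
  rewrite (H x); simpl; auto; lra.
Qed.

(** [fsumR] sums over a list obtained by choice. Any duplicate-free list covering the support is a
    permutation of that one once its zero terms are dropped, so the choice is immaterial. *)
Lemma fsumR_list {I : Type} (a : I -> R) (l : list I) :
  NoDup l -> (forall i, a i <> 0 -> In i l) -> fsumR a = sumR (map a l).
Proof.
  intros nd sub. unfold fsumR.
  destruct (excluded_middle_informative _) as [H|H].
  - destruct (constructive_indefinite_description _ H) as [l' [nd' H']]; simpl. fold (sumR (map a l')).
    rewrite <- (sumR_filter a (fun i => if Req_dec_T (a i) 0 then false else true) l).
    + apply sumR_perm, Permutation_map, NoDup_Permutation; [easy|now apply NoDup_filter|].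
      intro i. rewrite H', filter_In. destruct (Req_dec_T (a i) 0); intuition auto; discriminate.
    + intros i _. destruct (Req_dec_T (a i) 0); easy.
  - exfalso; apply H. destruct (finite_nodup (fun i => a i <> 0)) as [l' [? ?]]; [now exists l|].
    exists l'; split; auto.
Qed.

(** With this default value, [fsumR_scal] and [fsumR_reindex] also cover infinite supports. *)
Lemma fsumR_inf {I : Type} (a : I -> R) : ~ finite (fun i => a i <> 0) -> fsumR a = 0.
Proof.
  intros H. unfold fsumR. destruct (excluded_middle_informative _) as [E|]; [|easy].
  exfalso. destruct E as [l [_ h]]. apply H. exists l. intro. apply h.
Qed.

Lemma fsumR_ext {I : Type} (a b : I -> R) : (forall i, a i = b i) -> fsumR a = fsumR b.
Proof. intros H. f_equal. now apply functional_extensionality. Qed.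

Lemma fsumR_scal {I : Type} (c : R) (a : I -> R) : fsumR (fun i => c * a i) = c * fsumR a.
Proof.
  destruct (Req_dec_T c 0) as [->|hc].
  - rewrite (fsumR_list _ nil); simpl; [lra|constructor|]. intros i h. lra.
  - destruct (excluded_middle_informative (finite (fun i => a i <> 0))) as [f|f].
    + destruct (finite_nodup _ f) as [l [nd h]].
      rewrite (fsumR_list _ l nd), (fsumR_list a l nd).
      * clear. induction l as [|x l IH]; simpl in *; [lra|rewrite IH; lra].
      * intro; apply h.
      * intros i hi. apply h. intro e; rewrite e in hi; lra.
    + rewrite (fsumR_inf a) by easy. rewrite fsumR_inf; [lra|].
      intro g. apply f. apply (finite_sub _ _ g). intros i h e. apply h.
      apply Rmult_integral in e. tauto.
Qed.

Lemma fsumR_scal_r {I : Type} (c : R) (a : I -> R) : fsumR (fun i => a i * c) = fsumR a * c.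
Proof. rewrite Rmult_comm, <- fsumR_scal. apply fsumR_ext. intro; ring. Qed.

Lemma fsumR_single {I : Type} (j : I) (a : I -> R) :
  (forall i, i <> j -> a i = 0) -> fsumR a = a j.
Proof.
  intros H. rewrite (fsumR_list a (j :: nil)); simpl; [ring| |].
  - constructor; [easy|constructor].
  - intros i h. left. apply NNPP. intro n. apply h, H. congruence.
Qed.

Lemma fsumR_zero {I : Type} (a : I -> R) : (forall i, a i = 0) -> fsumR a = 0.
Proof.
  intros H. rewrite (fsumR_list a nil); simpl; [easy|constructor|]. intros i h. now rewrite H in h.
Qed.

Lemma fsumR_neq0 {I : Type} (a : I -> R) : fsumR a <> 0 -> exists i, a i <> 0.
Proof.
  intros H. apply NNPP. intro n. apply H, fsumR_zero. intro i. apply NNPP. intro h. eauto.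
Qed.

Lemma fsumR_add {I : Type} (a b : I -> R) :
  finite (fun i => a i <> 0) -> finite (fun i => b i <> 0) ->
  fsumR (fun i => a i + b i) = fsumR a + fsumR b.
Proof.
  intros fa fb. destruct (finite_nodup _ (finite_or _ _ fa fb)) as [l [nd h]].
  rewrite !(fsumR_list _ l nd).
  - clear. induction l as [|x l IH]; simpl; [lra|rewrite IH; lra].
  - intros i hi; apply h; auto.
  - intros i hi; apply h; auto.
  - intros i hi; apply h. destruct (Req_dec_T (a i) 0); auto. right. lra.
Qed.

Lemma fsumR_reindex {I K : Type} (phi : K -> I) (a : I -> R) :
  (forall k k', phi k = phi k' -> k = k') -> (forall i, a i <> 0 -> exists k, i = phi k) ->
  fsumR (fun k => a (phi k)) = fsumR a.
Proof.
  intros inj sur.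
  destruct (excluded_middle_informative (finite (fun k => a (phi k) <> 0))) as [f|f].
  - destruct (finite_nodup _ f) as [l [nd h]].
    rewrite (fsumR_list _ l nd), (fsumR_list a (map phi l)), map_map; [easy| | |].
    + apply FinFun.Injective_map_NoDup; easy.
    + intros i hi. destruct (sur i hi) as [k ->]. apply in_map. now apply h.
    + intro; apply h.
  - rewrite fsumR_inf by easy. symmetry. apply fsumR_inf. intro g. apply f.
    apply (finite_preimage phi _ _ g); auto.
Qed.

Lemma sumR_swap {I K : Type} (a : I -> K -> R) l l' :
  sumR (map (fun i => sumR (map (a i) l')) l) = sumR (map (fun k => sumR (map (fun i => a i k) l)) l').
Proof.
  induction l as [|x l IH]; simpl.
  - induction l'; simpl; lra.
  - rewrite IH. clear IH. induction l' as [|y l' IH']; simpl in *; lra.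
Qed.

(** Joint finiteness lets both iterated sums run over the two projections of one finite set.
    Finiteness of each inner sum alone would not exclude a default value of the outer one. *)
Lemma fsumR_swap {I K : Type} (a : I -> K -> R) :
  finite (fun p : I * K => a (fst p) (snd p) <> 0) ->
  fsumR (fun i => fsumR (a i)) = fsumR (fun k => fsumR (fun i => a i k)).
Proof.
  intros f.
  destruct (finite_nodup _ (finite_image fst _ f)) as [l [nd h]].
  destruct (finite_nodup _ (finite_image snd _ f)) as [l' [nd' h']].
  assert (hl : forall i k, a i k <> 0 -> In i l) by (intros i k n; apply h; exists (i, k); auto).
  assert (hl' : forall i k, a i k <> 0 -> In k l') by (intros i k n; apply h'; exists (i, k); auto).
  rewrite (fsumR_list _ l nd), (fsumR_list (fun k => fsumR _) l' nd').
  - rewrite (map_ext _ (fun i => sumR (map (a i) l'))) by (intro; apply fsumR_list; eauto).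
    rewrite (map_ext (fun k => fsumR _) (fun k => sumR (map (fun i => a i k) l))) by (intro; apply fsumR_list; eauto).
    apply sumR_swap.
  - intros k hk. destruct (fsumR_neq0 _ hk) as [i hi]. eauto.
  - intros k hk. destruct (fsumR_neq0 _ hk) as [i hi]. eauto.
Qed.

(** * Monomials and supports *)

Ltac mon_ext := let i := fresh "i" in apply functional_extensionality; intro i; unfold monD, monS, mon0; try ring.

Definition mon_le (a b : mon) : Prop := a = b \/ mon_lt a b.

Lemma mon_lt_irrefl a : ~ mon_lt a a.
Proof. intros (k & _ & h). lra. Qed.

Lemma mon_lt_trans a b c : mon_lt a b -> mon_lt b c -> mon_lt a c.
Proof.
  intros (k & h & l) (k' & h' & l'). destruct (lt_eq_lt_dec k k') as [[lt| <-]|lt].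
  - exists k. split; [intros i hi; rewrite h, h' by lia; easy|]. rewrite <- h' by lia. easy.
  - exists k. split; [intros i hi; rewrite h, h' by lia; easy|]. lra.
  - exists k'. split; [intros i hi; rewrite h, h' by lia; easy|]. rewrite h by lia. easy.
Qed.

Lemma mon_lt_le_trans a b c : mon_lt a b -> mon_le b c -> mon_lt a c.
Proof. intros h [<-|h']; [easy|]. eapply mon_lt_trans; eauto. Qed.

Lemma mon_lt_add a b c : mon_lt a b -> mon_lt (monD a c) (monD b c).
Proof.
  intros (k & h & l). exists k. unfold monD. split; [intros i hi; now rewrite h|lra].
Qed.

Lemma monDC a b : monD a b = monD b a.
Proof. mon_ext. Qed.

Lemma mon_lt_addl a b c : mon_lt a b -> mon_lt (monD c a) (monD c b).
Proof. rewrite !(monDC c). apply mon_lt_add. Qed.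

Lemma mon_le_add2 a b c d : mon_le a b -> mon_le c d -> mon_le (monD a c) (monD b d).
Proof.
  intros [->|h] [->|h']; [now left|right|right|right].
  - now apply mon_lt_addl.
  - now apply mon_lt_add.
  - eapply mon_lt_trans; [apply mon_lt_add, h|now apply mon_lt_addl].
Qed.

Lemma monD0 a : monD a mon0 = a.
Proof. mon_ext. Qed.
Lemma mon0D a : monD mon0 a = a.
Proof. mon_ext. Qed.
Lemma monD_inj a b c : monD a b = monD a c -> b = c.
Proof.
  intros h. mon_ext. apply (f_equal (fun m => m i)) in h. unfold monD in h. lra.
Qed.
Lemma monDB a b : monD a (monD b (monS (-1) a)) = b.
Proof. mon_ext. Qed.

Lemma first_index (P : nat -> Prop) : (exists n, P n) -> exists n, P n /\ forall i, (i < n)%nat -> ~ P i.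
Proof.
  intros [n h]. induction n as [n IH] using (well_founded_induction lt_wf).
  destruct (classic (exists i, (i < n)%nat /\ P i)) as [[i [l p]]|no]; [eauto|].
  exists n; split; [easy|]. intros i l p. apply no; eauto.
Qed.

Lemma mon_neq_index (a b : mon) : a <> b -> exists k, a k <> b k /\ forall i, (i < k)%nat -> a i = b i.
Proof.
  intros n. destruct (first_index (fun i => a i <> b i)) as [k [h l]].
  - apply NNPP. intro no. apply n, functional_extensionality. intro i. apply NNPP. eauto.
  - exists k; split; [easy|]. intros i hi. apply NNPP. now apply l.
Qed.

Lemma depth_le_add J a b : depth_le J a -> depth_le J b -> depth_le J (monD a b).
Proof. intros h h' k l. unfold monD. rewrite h, h' by easy. ring. Qed.
Lemma depth_le_scale J c a : depth_le J a -> depth_le J (monS c a).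
Proof. intros h k l. unfold monS. rewrite h by easy. ring. Qed.
Lemma depth_le0 J : depth_le J mon0.
Proof. easy. Qed.
Lemma depth_leE J k r : (k <= J)%nat -> depth_le J (monE k r).
Proof. intros h i l. unfold monE. destruct (Nat.eqb_spec i k); [lia|easy]. Qed.
Lemma depth_le_mono J J' a : (J <= J')%nat -> depth_le J a -> depth_le J' a.
Proof. intros l h k hk. apply h. lia. Qed.
#[global] Hint Resolve depth_le_add depth_le_scale depth_le0 depth_leE : dep.

(** * Discrete sets of exponents and admissible supports *)

Definition disc (P : R -> Prop) : Prop := forall M, finite (fun r => r <= M /\ P r).

Lemma list_min (l : list R) (P : R -> Prop) b :
  exists e, (e = b \/ P e) /\ e <= b /\ forall r, In r l -> P r -> e <= r.
Proof.
  induction l as [|x l (e & h & hb & hl)].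
  - exists b. repeat split; [auto|lra|easy].
  - destruct (classic (P x)) as [p|p]; [destruct (Rlt_le_dec x e)|].
    + exists x. repeat split; [auto|lra|]. intros s [<-|h'] pr; [lra|]. specialize (hl s h' pr). lra.
    + exists e. repeat split; auto. intros s [<-|h'] pr; [lra|auto].
    + exists e. repeat split; auto. intros r [<-|h'] pr; [easy|auto].
Qed.

(** The bound [b] covers the empty set: the lower bound [e] is attained or equals [b]. *)
Lemma disc_min P b : disc P -> exists e, (e = b \/ P e) /\ e <= b /\ forall r, P r -> e <= r.
Proof.
  intros d. destruct (d b) as [l hl]. destruct (list_min l P b) as (e & h1 & h2 & h3).
  exists e. repeat split; auto. intros r pr. destruct (Rle_lt_dec r b); [auto|lra].
Qed.

(** Each set is bounded below, so a bound on the sum bounds each component above. *)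
Lemma disc_pairs P Q M : disc P -> disc Q ->
  finite (fun p : R * R => P (fst p) /\ Q (snd p) /\ fst p + snd p <= M).
Proof.
  intros dP dQ. destruct (disc_min P 0 dP) as (b & _ & _ & hb). destruct (disc_min Q 0 dQ) as (c & _ & _ & hc).
  eapply finite_sub; [apply (finite_pair (fun r => r <= M - c /\ P r) (fun _ s => s <= M - b /\ Q s)); auto|].
  intros [r s] (p & q & l); simpl in *. specialize (hb r p). specialize (hc s q). repeat split; auto; lra.
Qed.

(** A support is seen as a tree of exponents; these are the labels of the children of the node given
    by the first [k] entries of [p]. *)
Definition exps (A : mon -> Prop) (k : nat) (p : mon) : R -> Prop :=
  fun r => exists m, A m /\ (forall i, (i < k)%nat -> m i = p i) /\ m k = r.

(** For [A = supp F] this is convertible with [in_Linf J F], so closure properties of supports apply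
    directly to series. *)
Definition good (J : nat) (A : mon -> Prop) : Prop :=
  (forall m, A m -> depth_le J m) /\ forall k p M, (k <= J)%nat -> finite (fun r => r <= M /\ exps A k p r).

Definition supp (F : ser) : mon -> Prop := fun m => F m <> 0.

Lemma good_disc J A k p : good J A -> (k <= J)%nat -> disc (exps A k p).
Proof. intros [_ h] l M. now apply h. Qed.

Lemma good_sub J (A B : mon -> Prop) : good J B -> (forall m, A m -> B m) -> good J A.
Proof.
  intros [h1 h2] s. split; [auto|]. intros k p M l. apply (finite_sub _ _ (h2 k p M l)).
  intros r [hr (m & a & b)]. split; [easy|exists m; auto].
Qed.

Lemma good_ex {I : Type} J (P : I -> Prop) (A : I -> mon -> Prop) :
  finite P -> (forall i, P i -> good J (A i)) -> good J (fun m => exists i, P i /\ A i m).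
Proof.
  intros f h. split.
  - intros m (i & p & a). now apply (h i p).
  - intros k p M l.
    apply finite_sub with (Q := fun r => exists i, P i /\ (r <= M /\ exps (A i) k p r)).
    + apply finite_ex; [easy|]. intros i pi. now apply (h i pi).
    + intros r [hr (m & (i & pi & a) & b)]. exists i. split; [easy|]. split; [easy|]. exists m; auto.
Qed.

Lemma good_or J A B : good J A -> good J B -> good J (fun m => A m \/ B m).
Proof.
  intros a b. apply good_sub with (B := fun m => exists i : bool, True /\ (if i then A else B) m).
  - apply good_ex; [exists (true :: false :: nil)|]; intros [] _; simpl; auto.
  - intros m [h|h]; [exists true|exists false]; auto.
Qed.

Lemma good_finite J A : finite A -> (forall m, A m -> depth_le J m) -> good J A.
Proof.
  intros f h. split; [easy|]. intros k p M _.
  apply (finite_sub _ _ (finite_image (fun m => m k) _ f)). intros r [_ (m & a & _ & e)]. eauto.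
Qed.

Lemma good_single J m : depth_le J m -> good J (fun m' => m' = m).
Proof.
  intros h. apply good_finite; [exists (m :: nil); intros i ->; now left|]. now intros m' ->.
Qed.

Lemma good_weaken J J' A : (J <= J')%nat -> good J A -> good J' A.
Proof.
  intros l [h1 h2]. split.
  - intros m a. apply (depth_le_mono J); auto.
  - intros k p M hk. destruct (le_lt_dec k J) as [|n]; [auto|].
    exists (0 :: nil). intros r [_ (m & a & _ & <-)]. left. symmetry. now apply h1.
Qed.

Lemma good_strengthen J J' A : (J' <= J)%nat -> good J A -> (forall m, A m -> depth_le J' m) -> good J' A.
Proof. intros l [h1 h2] h. split; [easy|]. intros k p M hk. apply h2. lia. Qed.

Definition sumset (A B : mon -> Prop) : mon -> Prop := fun m => exists a b, A a /\ B b /\ m = monD a b.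

Definition trunc (k : nat) (a : mon) : mon := fun i => if (i <? k)%nat then a i else 0.

Lemma trunc_S k a : trunc (S k) a = fun i => if Nat.eqb i k then a k else trunc k a i.
Proof.
  apply functional_extensionality. intro i. unfold trunc.
  destruct (Nat.eqb_spec i k), (Nat.ltb_spec i (S k)), (Nat.ltb_spec i k); try lia; congruence.
Qed.

(** Induction on the prefix length: once there are finitely many pairs of prefixes, the next two
    exponents come from two discrete sets and have a prescribed sum, which [disc_pairs] allows in
    finitely many ways. *)
Lemma sum_prefix_finite J A B m k : good J A -> good J B -> (k <= S J)%nat ->
  finite (fun p : mon * mon => exists a b, A a /\ B b /\ (forall i, (i < k)%nat -> a i + b i = m i)
           /\ p = (trunc k a, trunc k b)).
Proof.
  intros gA gB. induction k as [|k IH]; intros l.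
  - exists ((mon0, mon0) :: nil). intros p (a & b & _ & _ & _ & ->). now left.
  - specialize (IH ltac:(lia)). eapply finite_sub; [eapply (finite_ex _ (fun (p q : mon * mon) => exists rs : R * R,
       (exps A k (fst p) (fst rs) /\ exps B k (snd p) (snd rs) /\ fst rs + snd rs <= m k) /\
       q = ((fun i => if Nat.eqb i k then fst rs else fst p i), (fun i => if Nat.eqb i k then snd rs else snd p i))));
       [exact IH|]|].
    + intros p _. apply finite_image, disc_pairs; eapply good_disc; eauto; lia.
    + intros q (a & b & ha & hb & e & ->). exists (trunc k a, trunc k b). split.
      * exists a, b. repeat split; auto.
      * exists (a k, b k). simpl. rewrite <- !trunc_S. repeat split.
        -- exists a. repeat split; auto. intros i hi. unfold trunc. destruct (Nat.ltb_spec i k); [easy|lia].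
        -- exists b. repeat split; auto. intros i hi. unfold trunc. destruct (Nat.ltb_spec i k); [easy|lia].
        -- rewrite e by lia. lra.
Qed.

Lemma good_sumset J A B : good J A -> good J B -> good J (sumset A B).
Proof.
  intros gA gB. split.
  - intros m (a & b & ha & hb & ->). apply depth_le_add; [now apply gA|now apply gB].
  - intros k p M l.
    eapply finite_sub; [apply (finite_ex _ (fun (q : mon * mon) (r : R) => exists rs : R * R,
       (exps A k (fst q) (fst rs) /\ exps B k (snd q) (snd rs) /\ fst rs + snd rs <= M) /\ r = fst rs + snd rs)
       (sum_prefix_finite J A B p k gA gB ltac:(lia)))|].
    + intros q _. apply finite_image, disc_pairs; eapply good_disc; eauto; lia.
    + intros r [hr (m & (a & b & ha & hb & ->) & e & <-)].
      exists (trunc k a, trunc k b). split; [exists a, b; auto|].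
      exists (a k, b k). simpl. repeat split; auto.
      * exists a. repeat split; auto. intros i hi. unfold trunc. destruct (Nat.ltb_spec i k); [easy|lia].
      * exists b. repeat split; auto. intros i hi. unfold trunc. destruct (Nat.ltb_spec i k); [easy|lia].
Qed.

Lemma trunc_depth J a : depth_le J a -> trunc (S J) a = a.
Proof.
  intros h. apply functional_extensionality. intro i. unfold trunc.
  destruct (Nat.ltb_spec i (S J)); [easy|]. symmetry. apply h. lia.
Qed.

(** At prefix length [S J] truncation is the identity on both supports. This is the finiteness
    behind every coefficient of a product. *)
Lemma sumset_finite J A B m : good J A -> good J B ->
  finite (fun p : mon * mon => A (fst p) /\ B (snd p) /\ monD (fst p) (snd p) = m).
Proof.
  intros gA gB. apply (finite_sub _ _ (sum_prefix_finite J A B m (S J) gA gB ltac:(lia))).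
  intros [a b] (ha & hb & <-); simpl in *. exists a, b. split; [easy|split; [easy|split; [easy|]]].
  rewrite (trunc_depth J a (proj1 gA a ha)), (trunc_depth J b (proj1 gB b hb)). reflexivity.
Qed.

(** * Monoids generated by positive monomials *)

Fixpoint npow (A : mon -> Prop) (n : nat) : mon -> Prop :=
  match n with 0%nat => fun m => m = mon0 | S n => sumset A (npow A n) end.

(** The additive monoid generated by [A]; it contains the support of every power series in a series
    supported on [A]. *)
Definition star (A : mon -> Prop) : mon -> Prop := fun m => exists n, npow A n m.

Lemma good_npow J A n : good J A -> good J (npow A n).
Proof.
  intros g. induction n; simpl; [apply good_single; auto with dep|now apply good_sumset].
Qed.

Lemma npow_split A B C n m : (forall a, A a -> B a \/ C a) -> npow A n m ->
  exists n1 n2 b c, npow B n1 b /\ npow C n2 c /\ m = monD b c /\ n = (n1 + n2)%nat.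
Proof.
  intros s. revert m. induction n as [|n IH]; simpl; intros m.
  - intros ->. exists 0%nat, 0%nat, mon0, mon0. repeat split. mon_ext.
  - intros (a & r & ha & hr & ->). destruct (IH r hr) as (n1 & n2 & b & c & hb & hc & -> & ->).
    destruct (s a ha) as [h|h].
    + exists (S n1), n2, (monD a b), c. repeat split; [exists a, b; auto|auto|mon_ext].
    + exists n1, (S n2), b, (monD a c). repeat split; [auto|exists a, c; auto|mon_ext|lia].
Qed.

Lemma npow_bound A n m i e : (forall a, A a -> (forall t, (t < i)%nat -> a t = 0) /\ e <= a i) -> npow A n m ->
  (forall t, (t < i)%nat -> m t = 0) /\ INR n * e <= m i.
Proof.
  intros h. revert m. induction n as [|n IH]; intros m.
  - simpl. intros ->. split; [easy|unfold mon0; lra].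
  - intros (a & b & ha & hb & ->). destruct (h a ha) as [h1 h2]. destruct (IH b hb) as [h3 h4].
    unfold monD. split; [intros t ht; rewrite h1, h3 by easy; lra|]. rewrite S_INR. lra.
Qed.

(* Induction on the number [i] of leading zero exponents: the elements with positive [i]-th exponent
   can only be used boundedly often, the others are handled by the next level. *)
Lemma star_good_aux J d : forall i A, (i + d = S J)%nat -> good J A ->
  (forall a, A a -> mon_lt mon0 a /\ forall t, (t < i)%nat -> a t = 0) ->
  good J (star A) /\ forall m, finite (fun n => npow A n m).
Proof.
  induction d as [|d IH]; intros i A hi gA hA.
  (* Here [i = S J]: all exponents up to the depth bound vanish, so positivity leaves [A] empty. *)
  - assert (E : forall a, ~ A a).
    { intros a ha. destruct (hA a ha) as [(k & h & l) z].
      destruct (le_lt_dec k J); [rewrite z in l by lia|rewrite (proj1 gA a ha k) in l by easy]; unfold mon0 in l; lra. }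
    assert (N : forall n m, npow A n m -> n = 0%nat /\ m = mon0).
    { intros [|n] m; simpl; [auto|]. intros (a & _ & ha & _). now apply E in ha. }
    split.
    + apply (good_sub J _ (fun m => m = mon0)); [apply good_single; auto with dep|].
      intros m [n h]. now apply N in h.
    + intro m. exists (0%nat :: nil). intros n h. apply N in h as [-> _]. now left.
  - set (B := fun a => A a /\ 0 < a i). set (C := fun a => A a /\ a i = 0).
    assert (AB : forall a, A a -> B a \/ C a).
    { intros a ha. destruct (hA a ha) as [(k & h & l) z]. unfold B, C.
      destruct (lt_eq_lt_dec k i) as [[lt| ->]|lt].
      - rewrite z in l by easy. unfold mon0 in l; lra.
      - unfold mon0 in l. left; split; [easy|lra].
      - right; split; [easy|]. now rewrite <- h. }
    assert (gB : good J B) by (apply (good_sub J _ A); [easy|now intros m [? _]]).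
    assert (gC : good J C) by (apply (good_sub J _ A); [easy|now intros m [? _]]).
    destruct (IH (S i) C ltac:(lia) gC) as [gS fS].
    { intros a [ha e]. destruct (hA a ha) as [p z]. split; [easy|]. intros t ht.
      destruct (Nat.eq_dec t i) as [->|]; [easy|]. apply z. lia. }
    assert (hC : forall n c, npow C n c -> (forall t, (t < S i)%nat -> c t = 0)).
    { intros n.
      induction n as [|n IHn]; intros c; simpl; [now intros ->|].
      intros (a & b & [ha e] & hb & ->) t ht. unfold monD. rewrite (IHn b hb t ht).
      destruct (Nat.eq_dec t i) as [->|]; [lra|]. rewrite (proj2 (hA a ha)) by lia. lra. }
    assert (iJ : (i <= J)%nat) by lia.
    (* Using [n] elements of [B] pushes the [i]-th exponent to at least [n e]. The value 1 serves
       when [B] is empty. *)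
    destruct (disc_min (exps B i mon0) 1 (good_disc J _ _ _ gB iJ)) as (e & he & _ & hm).
    assert (epos : 0 < e) by (destruct he as [->|(m & [_ p] & _ & <-)]; lra).
    assert (hB : forall n b, npow B n b -> (forall t, (t < i)%nat -> b t = 0) /\ INR n * e <= b i).
    { intros n b. apply npow_bound. intros a [ha p]. destruct (hA a ha) as [_ z]. split; [easy|].
      apply hm. exists a. repeat split; auto. }
    assert (S1 : forall m, star A m -> exists n, sumset (npow B n) (star C) m).
    { intros m [n h]. destruct (npow_split _ _ _ _ _ AB h) as (n1 & n2 & b & c & hb & hc & -> & _).
      exists n1, b, c. repeat split; auto. now exists n2. }
    assert (S2 : forall n m, sumset (npow B n) (star C) m -> (forall t, (t < i)%nat -> m t = 0) /\ INR n * e <= m i).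
    { intros n m (b & c & hb & [n2 hc] & ->). destruct (hB n b hb) as [h1 h2]. pose proof (hC n2 c hc) as h3.
      unfold monD. split; [intros t ht; rewrite h1, h3 by lia; lra|]. rewrite h3 by lia. lra. }
    assert (gn : forall n, good J (sumset (npow B n) (star C))) by (intro; apply good_sumset; auto; now apply good_npow).
    assert (bnd : forall V n r, INR n * e <= r -> r <= V -> exists N, V < INR N * e /\ (n < N)%nat).
    { intros V n r h h'. destruct (INR_archimed e V epos) as [N hN]. exists N. split; [lra|].
      apply INR_lt. apply Rmult_lt_reg_r with e; [easy|lra]. }
    split; [split|].
    + intros m h. destruct (S1 m h) as [n hn]. now apply (gn n).
    + intros k p M l.
      destruct (lt_dec k i) as [lt|nlt].
      { exists (0 :: nil). intros r [_ (m & hs & _ & <-)]. destruct (S1 m hs) as [n hn]. left.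
        symmetry. now apply (S2 n m hn). }
      (* At level [i] the exponent is at most [M]; at a deeper level the prefix [p] fixes it. Either
         way the [i]-th exponent is at most [V], which bounds the number of elements taken from
         [B]. *)
      set (V := if Nat.eqb k i then M else p i).
      destruct (INR_archimed e V epos) as [N hN].
      eapply finite_sub; [apply (finite_ex (fun n => (n < N)%nat)
         (fun n r => r <= M /\ exps (sumset (npow B n) (star C)) k p r) (finite_lt N))|].
      * intros n _. now apply (gn n).
      * intros r [hr (m & hs & hp & hk)]. destruct (S1 m hs) as [n hn]. exists n.
        split; [|split; [easy|exists m; auto]].
        destruct (S2 n m hn) as [_ h]. apply INR_lt. apply Rmult_lt_reg_r with e; [easy|].
        apply Rle_lt_trans with (m i); [easy|]. apply Rle_lt_trans with V; [|lra].
        unfold V. destruct (Nat.eqb_spec k i); [subst; lra|]. rewrite hp by lia. lra.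
    + intro m. destruct (INR_archimed e (m i) epos) as [N hN].
      eapply finite_sub; [apply (finite_ex (fun n => (n < N)%nat)
         (fun n1 n => exists bc : mon * mon, (npow B n1 (fst bc) /\ star C (snd bc) /\ monD (fst bc) (snd bc) = m)
            /\ exists n2, npow C n2 (snd bc) /\ n = (n1 + n2)%nat) (finite_lt N))|].
      * intros n1 _. apply finite_ex; [apply (sumset_finite J); auto; now apply good_npow|].
        intros bc _. apply finite_image. apply fS.
      * intros n h. destruct (npow_split _ _ _ _ _ AB h) as (n1 & n2 & b & c & hb & hc & -> & ->).
        exists n1. split.
        -- destruct (S2 n1 (monD b c)) as [_ h'].
           { exists b, c. repeat split; auto. now exists n2. }
           apply INR_lt. apply Rmult_lt_reg_r with e; [easy|lra].
        -- exists (b, c). simpl. repeat split; auto; [now exists n2|exists n2; auto].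
Qed.

Lemma star_good J A : good J A -> (forall a, A a -> mon_lt mon0 a) ->
  good J (star A) /\ forall m, finite (fun n => npow A n m).
Proof.
  intros g h. apply (star_good_aux J (S J) 0); [lia|easy|]. intros a ha. split; [auto|]. intros; lia.
Qed.

Lemma npow_nonneg A n m : (forall a, A a -> mon_le mon0 a) -> npow A n m -> mon_le mon0 m.
Proof.
  intros h. revert m. induction n as [|n IH]; intros m; simpl; [intros ->; now left|].
  intros (a & b & ha & hb & ->). rewrite <- (monD0 mon0). apply mon_le_add2; auto.
Qed.

(** Exponents are minimised one level at a time; after [S J] levels the depth bound determines the
    whole monomial. *)
Lemma good_min J A : good J A -> (exists m, A m) -> exists m, A m /\ forall m', A m' -> mon_le m m'.
Proof.
  intros g ex.
  assert (H : forall k, (k <= S J)%nat -> exists m, A m /\ forall m', A m' ->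
             (forall i, (i < k)%nat -> m i = m' i) \/
             exists j, (j < k)%nat /\ (forall i, (i < j)%nat -> m i = m' i) /\ m j < m' j).
  { induction k as [|k IH]; intros l.
    - destruct ex as [m h]. exists m. split; [easy|]. intros m' _. left. intros; lia.
    - destruct (IH ltac:(lia)) as (m & hm & h).
      (* The fallback [m k] itself belongs to the set, so the minimum is attained in both cases. *)
      destruct (disc_min (exps A k m) (m k) (good_disc J A k m g ltac:(lia))) as (e & he & _ & hl).
      assert (exps A k m e) as (n & hn & hp & hk) by (destruct he as [->|]; [exists m; auto|easy]).
      exists n. split; [easy|]. intros m' hm'. destruct (h m' hm') as [eq|(j & jk & hj & lj)].
      + assert (e <= m' k) by (apply hl; exists m'; repeat split; auto; intros; symmetry; auto).
        assert (nm : forall i, (i < k)%nat -> n i = m' i) by (intros i hi; rewrite hp, eq; auto).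
        destruct (Req_dec_T e (m' k)) as [e'|ne].
        * left. intros i hi. destruct (Nat.eq_dec i k) as [->|]; [lra|]. apply nm. lia.
        * right. exists k. repeat split; [lia|easy|lra].
      + right. exists j. repeat split; [lia| |rewrite hp by lia; easy].
        intros i hi; rewrite hp by lia; auto. }
  destruct (H (S J) ltac:(lia)) as (m & hm & h). exists m. split; [easy|]. intros m' hm'.
  destruct (h m' hm') as [eq|(j & _ & hj & lj)].
  - left. apply functional_extensionality. intro i. destruct (le_lt_dec i J); [apply eq; lia|].
    now rewrite (proj1 g m hm i), (proj1 g m' hm' i).
  - right. now exists j.
Qed.

(* Action on exponents of composition with a series of leading monomial [M]. *)
Definition tau (M m : mon) : mon :=
  fun k => match k with 0%nat => M 0%nat * m 0%nat | S _ => m k + M k * m 0%nat end.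

Lemma tau_depth J M m : depth_le J M -> depth_le J m -> depth_le J (tau M m).
Proof. intros h h' [|k] l; unfold tau; [lia|]. rewrite h, h' by easy. ring. Qed.

Lemma tau_lt M a b : 0 < M 0%nat -> mon_lt a b -> mon_lt (tau M a) (tau M b).
Proof.
  intros p (k & h & l). exists k. split.
  - intros i hi. destruct i as [|i]; unfold tau; rewrite !h by lia; easy.
  - destruct k as [|k]; unfold tau; [now apply Rmult_lt_compat_l|]. rewrite (h 0%nat) by lia. lra.
Qed.

Lemma tau_inj M a b : M 0%nat <> 0 -> tau M a = tau M b -> a = b.
Proof.
  intros p h. assert (e : a 0%nat = b 0%nat).
  { apply (f_equal (fun m => m 0%nat)) in h. unfold tau in h. apply Rmult_eq_reg_l with (M 0%nat); auto. }
  apply functional_extensionality. intros [|k]; [easy|].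
  apply (f_equal (fun m => m (S k))) in h. unfold tau in h. rewrite e in h. lra.
Qed.

Lemma good_tau J M A : 0 < M 0%nat -> depth_le J M -> good J A -> good J (fun m => exists a, A a /\ m = tau M a).
Proof.
  intros p hM g. split.
  - intros m (a & ha & ->). apply tau_depth; [easy|now apply g].
  - intros k q B l. destruct k as [|k].
    + apply (finite_sub _ _ (finite_image (fun r => M 0%nat * r) _ (proj2 g 0%nat q (B / M 0%nat) l))).
      intros r [hr (m & (a & ha & ->) & _ & <-)]. exists (a 0%nat). simpl in *. split; [|easy]. split.
      * apply Rmult_le_reg_l with (M 0%nat); [easy|]. field_simplify; lra.
      * exists a. repeat split; auto. intros; lia.
    (* The prefix [q] of an image has entry [M 0 * a 0] at 0, so it determines [a 0] and then the
       whole prefix [q'] of the source. *)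
    + set (x := q 0%nat / M 0%nat).
      set (q' := fun i => match i with 0%nat => x | S _ => q i - M i * x end).
      apply (finite_sub _ _ (finite_image (fun r => r + M (S k) * x) _ (proj2 g (S k) q' (B - M (S k) * x) l))).
      intros r [hr (m & (a & ha & ->) & hq & <-)]. simpl in *.
      assert (a0 : a 0%nat = x) by (unfold x; rewrite <- (hq 0%nat) by lia; simpl; field; lra).
      exists (a (S k)). rewrite a0 in *. split; [|easy]. split; [lra|]. exists a. repeat split; auto.
      intros [|i] hi; simpl; [easy|]. rewrite <- hq by lia. simpl. rewrite a0. ring.
Qed.

(** If [y] is led by [x^a l^b ...], then [x] is led by [y^(1/a) l(y)^(-b/a) ...] up to a constant;
    these are the exponents of that monomial. *)
Definition tinv (M : mon) : mon :=
  fun k => match k with 0%nat => / M 0%nat | S _ => - (M k / M 0%nat) end.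

Lemma tau_tinv M m : M 0%nat <> 0 -> tau M (tau (tinv M) m) = m.
Proof. intros p. apply functional_extensionality. intros [|k]; unfold tau, tinv; field; easy. Qed.

Lemma tinv_depth J M : depth_le J M -> depth_le J (tinv M).
Proof. intros h [|k] l; unfold tinv; [lia|]. rewrite h by easy. unfold Rdiv. ring. Qed.

Lemma tinv_tau M m : M 0%nat <> 0 -> tau (tinv M) (tau M m) = m.
Proof. intros p. apply functional_extensionality. intros [|k]; unfold tau, tinv; field; easy. Qed.

(** * Strongly linear operators *)

Lemma mono_eq c M : mono c M M = c.
Proof. unfold mono. now destruct (excluded_middle_informative _). Qed.
Lemma mono_neq c M m : m <> M -> mono c M m = 0.
Proof. unfold mono. now destruct (excluded_middle_informative _). Qed.
Lemma mono_supp c M m : mono c M m <> 0 -> m = M.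
Proof. intros h. apply NNPP. intro n. now rewrite mono_neq in h. Qed.

(* Strongly linear extension of [i |-> K i] to the formal combination with coefficients [a];
   multiplication, composition and derivation are all of this form with [I = mon]. *)
Definition op {I : Type} (K : I -> ser) (a : I -> R) : ser := fun m => fsumR (fun i => a i * K i m).

Definition sfam {I : Type} (J : nat) (K : I -> ser) (P : I -> Prop) : Prop :=
  good J (fun m => exists i, P i /\ K i m <> 0) /\ forall m, finite (fun i => P i /\ K i m <> 0).

(** The condition under which [op K] is defined on all of depth [J], preserves it, and composes with
    other such operators. *)
Definition tame (J : nat) (K : mon -> ser) : Prop := forall A, good J A -> sfam J K A.

Lemma prod_neq0 x y : x * y <> 0 -> x <> 0 /\ y <> 0.
Proof. intros h. split; intros ->; apply h; ring. Qed.

Lemma op_supp {I : Type} (K : I -> ser) a m : op K a m <> 0 -> exists i, a i <> 0 /\ K i m <> 0.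
Proof. intros h. apply fsumR_neq0 in h as [i h]. exists i. now apply prod_neq0. Qed.

Lemma op_in {I : Type} J (K : I -> ser) a : sfam J K (fun i => a i <> 0) -> in_Linf J (op K a).
Proof. intros [g _]. apply (good_sub J _ _ g). intros m h. now apply op_supp in h. Qed.

Lemma sfam_sub {I : Type} J (K : I -> ser) (P Q : I -> Prop) : sfam J K Q -> (forall i, P i -> Q i) -> sfam J K P.
Proof.
  intros [g f] s. split.
  - apply (good_sub J _ _ g). intros m (i & p & h). eauto.
  - intro m. apply (finite_sub _ _ (f m)). intros i [p h]. auto.
Qed.

Lemma op_ext {I : Type} (K K' : I -> ser) a : (forall i, a i <> 0 -> K i = K' i) -> op K a = op K' a.
Proof.
  intros h. apply functional_extensionality. intro m. apply fsumR_ext. intro i.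
  destruct (Req_dec_T (a i) 0) as [->|n]; [ring|now rewrite h].
Qed.

(** Strong linearity. For a fixed target monomial, tameness of [K] leaves finitely many intermediate
    monomials, and summability of [K'] leaves finitely many indices for each; this is the joint
    finiteness that [fsumR_swap] asks for. *)
Lemma op_op {I : Type} J (K : mon -> ser) (K' : I -> ser) a :
  sfam J K' (fun i => a i <> 0) -> tame J K -> op K (op K' a) = op (fun i => op K (K' i)) a.
Proof.
  intros [g f] t. apply functional_extensionality. intro m. unfold op.
  rewrite (fsumR_ext _ (fun m' => fsumR (fun i => a i * K' i m' * K m' m))) by (intro; now rewrite fsumR_scal_r).
  rewrite fsumR_swap.
  - apply fsumR_ext. intro i. rewrite <- fsumR_scal. apply fsumR_ext. intro; ring.
  - destruct (t _ g) as [_ f'].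
    eapply finite_sub; [apply (finite_pair _ (fun m' i => a i <> 0 /\ K' i m' <> 0) (f' m)); intros m' _; apply f|].
    intros [m' i] h; simpl in *. apply prod_neq0 in h as [h h2]. apply prod_neq0 in h as [h0 h1]. eauto 6.
Qed.

Lemma sfam_op {I : Type} J (K : mon -> ser) (K' : I -> ser) P :
  sfam J K' P -> tame J K -> sfam J (fun i => op K (K' i)) P.
Proof.
  intros [g f] t. destruct (t _ g) as [g' f']. split.
  - apply (good_sub J _ _ g'). intros m (i & p & h). apply op_supp in h as (m' & h1 & h2). eauto 6.
  - intro m. eapply finite_sub; [apply (finite_ex _ (fun m' i => P i /\ K' i m' <> 0) (f' m)); intros m' _; apply f|].
    intros i (p & h). apply op_supp in h as (m' & h1 & h2). exists m'. eauto 8.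
Qed.

Lemma tame_op J K K' : tame J K -> tame J K' -> tame J (fun m => op K (K' m)).
Proof. intros t t' A g. apply sfam_op; auto. Qed.

Lemma op_add {I : Type} J (K : I -> ser) a b : sfam J K (fun i => a i <> 0) -> sfam J K (fun i => b i <> 0) ->
  op K (fun i => a i + b i) = sadd (op K a) (op K b).
Proof.
  intros [_ f] [_ f']. apply functional_extensionality. intro m. unfold op, sadd.
  rewrite <- fsumR_add.
  - apply fsumR_ext. intro; ring.
  - apply (finite_sub _ _ (f m)). intros i h. now apply prod_neq0 in h.
  - apply (finite_sub _ _ (f' m)). intros i h. now apply prod_neq0 in h.
Qed.

Lemma op_kadd {I : Type} J (K K' : I -> ser) a : sfam J K (fun i => a i <> 0) -> sfam J K' (fun i => a i <> 0) ->
  op (fun i => sadd (K i) (K' i)) a = sadd (op K a) (op K' a).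
Proof.
  intros [_ f] [_ f']. apply functional_extensionality. intro m. unfold op, sadd.
  rewrite <- fsumR_add.
  - apply fsumR_ext. intro; ring.
  - apply (finite_sub _ _ (f m)). intros i h. now apply prod_neq0 in h.
  - apply (finite_sub _ _ (f' m)). intros i h. now apply prod_neq0 in h.
Qed.

Lemma op_scale {I : Type} (K : I -> ser) c a : op K (fun i => c * a i) = sscale c (op K a).
Proof.
  apply functional_extensionality. intro m. unfold op, sscale. rewrite <- fsumR_scal.
  apply fsumR_ext. intro; ring.
Qed.

Lemma op_kscale {I : Type} (K : I -> ser) c a : op (fun i => sscale c (K i)) a = sscale c (op K a).
Proof.
  apply functional_extensionality. intro m. unfold op, sscale. rewrite <- fsumR_scal.
  apply fsumR_ext. intro; ring.
Qed.

Lemma op_mono K c M : op K (mono c M) = sscale c (K M).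
Proof.
  apply functional_extensionality. intro m. unfold op. rewrite (fsumR_single M).
  - now rewrite mono_eq.
  - intros i h. rewrite mono_neq by easy. ring.
Qed.

Lemma op_delta F : op (mono 1) F = F.
Proof.
  apply functional_extensionality. intro m. unfold op. rewrite (fsumR_single m).
  - rewrite mono_eq. ring.
  - intros i h. rewrite mono_neq by congruence. ring.
Qed.

Lemma tame_delta J : tame J (mono 1).
Proof.
  intros A g. split.
  - apply (good_sub J _ _ g). intros m (i & h & e). apply mono_supp in e. now subst.
  - intro m. exists (m :: nil). intros i (h & e). apply mono_supp in e. left. congruence.
Qed.

Lemma tame_in J K F : tame J K -> in_Linf J F -> in_Linf J (op K F).
Proof. intros t g. apply op_in, t, g. Qed.

Lemma sfam_tame J K a : tame J K -> in_Linf J a -> sfam J K (fun i => a i <> 0).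
Proof. intros t h. now apply t. Qed.

Lemma tame_mono_in J K M : depth_le J M -> tame J K -> in_Linf J (K M).
Proof.
  intros h t. apply (good_sub J _ _ (proj1 (t _ (good_single J M h)))). intros m e. eauto.
Qed.

(** * Ring operations *)

(** The monomial comes last so that [smul F G] is [op (sh G) F], which makes multiplication an
    instance of the operator calculus. *)
Definition sh (F : ser) (a : mon) : ser := smul (mono 1 a) F.

Lemma smul_conv F G m : smul F G m = fsumR (fun a => F a * G (monD m (monS (-1) a))).
Proof.
  unfold smul, ssum.
  rewrite <- (fsumR_reindex (fun a : mon => (a, monD m (monS (-1) a)))).
  - apply fsumR_ext. intro a. simpl.
    replace (monD a (monD m (monS (-1) a))) with m by mon_ext. apply mono_eq.
  - intros k k' e. congruence.
  - intros [a b] h. apply mono_supp in h. simpl in h. exists a. f_equal. rewrite h. mon_ext.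
Qed.

Lemma smul_comm F G : smul F G = smul G F.
Proof.
  apply functional_extensionality. intro m. rewrite !smul_conv.
  rewrite <- (fsumR_reindex (fun a => monD m (monS (-1) a))).
  - apply fsumR_ext. intro a. rewrite Rmult_comm. f_equal. f_equal. mon_ext.
  - intros k k' e. mon_ext. apply (f_equal (fun m => m i)) in e. unfold monD, monS in e. lra.
  - intros a _. exists (monD m (monS (-1) a)). mon_ext.
Qed.

Lemma smul_monol c M G m : smul (mono c M) G m = c * G (monD m (monS (-1) M)).
Proof.
  rewrite smul_conv, (fsumR_single M); [now rewrite mono_eq|].
  intros i h. rewrite mono_neq by easy. ring.
Qed.

Lemma smul_op F G : smul F G = op (sh G) F.
Proof.
  apply functional_extensionality. intro m. rewrite smul_conv. apply fsumR_ext. intro a.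
  unfold sh. rewrite smul_monol. ring.
Qed.

Lemma smul_sh F G a : smul (sh F a) G = sh (smul F G) a.
Proof.
  apply functional_extensionality. intro m. unfold sh. rewrite smul_monol, !smul_conv, Rmult_1_l.
  rewrite <- (fsumR_reindex (fun b => monD b a)).
  - apply fsumR_ext. intro b. rewrite smul_monol, Rmult_1_l. f_equal; f_equal; mon_ext.
  - intros k k' e. rewrite !(monDC _ a) in e. now apply monD_inj in e.
  - intros b _. exists (monD b (monS (-1) a)). mon_ext.
Qed.

Lemma smul_supp F G m : smul F G m <> 0 -> sumset (supp F) (supp G) m.
Proof.
  rewrite smul_conv. intros h. apply fsumR_neq0 in h as [a h]. apply prod_neq0 in h as [h1 h2].
  exists a, (monD m (monS (-1) a)). repeat split; auto. mon_ext.
Qed.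

Lemma tame_sh J G : in_Linf J G -> tame J (sh G).
Proof.
  intros g A gA.
  assert (H : forall a m, sh G a m <> 0 -> G (monD m (monS (-1) a)) <> 0).
  { intros a m. unfold sh. rewrite smul_monol. intros h. now apply prod_neq0 in h. }
  split.
  - apply (good_sub J _ _ (good_sumset J A (supp G) gA g)). intros m (a & ha & h). apply H in h.
    exists a, (monD m (monS (-1) a)). repeat split; auto. mon_ext.
  - intro m. apply (finite_sub _ _ (finite_image fst _ (sumset_finite J A (supp G) m gA g))).
    intros a (ha & h). apply H in h. exists (a, monD m (monS (-1) a)). simpl. repeat split; auto. mon_ext.
Qed.

Lemma in_mul J F G : in_Linf J F -> in_Linf J G -> in_Linf J (smul F G).
Proof. intros f g. apply (good_sub J _ _ (good_sumset J _ _ f g)). apply smul_supp. Qed.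

Lemma in_add J F G : in_Linf J F -> in_Linf J G -> in_Linf J (sadd F G).
Proof.
  intros f g. apply (good_sub J _ _ (good_or J _ _ f g)). intros m h. unfold sadd in h.
  destruct (Req_dec_T (F m) 0); auto. right. lra.
Qed.

Lemma in_scale J c F : in_Linf J F -> in_Linf J (sscale c F).
Proof. intros f. apply (good_sub J _ _ f). intros m h. now apply prod_neq0 in h. Qed.

Lemma in_opp J F : in_Linf J F -> in_Linf J (sopp F).
Proof. apply in_scale. Qed.
Lemma in_sub J F G : in_Linf J F -> in_Linf J G -> in_Linf J (ssub F G).
Proof. intros f g. apply in_add; [easy|now apply in_opp]. Qed.

Lemma in_mono J c M : depth_le J M -> in_Linf J (mono c M).
Proof. intros h. apply (good_sub J _ _ (good_single J M h)). intros m. apply mono_supp. Qed.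
Lemma in_one J : in_Linf J one.
Proof. apply in_mono. auto with dep. Qed.
Lemma in_X J : in_Linf J X.
Proof. apply in_mono, depth_leE. lia. Qed.
Lemma in_zero J : in_Linf J szero.
Proof. apply (good_sub J _ _ (good_single J mon0 (depth_le0 J))). intros m h. now elim h. Qed.
Lemma in_pow J F n : in_Linf J F -> in_Linf J (spow F n).
Proof. intros f. induction n; simpl; [apply in_one|now apply in_mul]. Qed.
Lemma in_weaken J J' F : (J <= J')%nat -> in_Linf J F -> in_Linf J' F.
Proof. apply good_weaken. Qed.
#[global] Hint Resolve in_mul in_add in_scale in_opp in_sub in_mono in_one in_X in_zero in_pow sfam_tame : linf.
#[global] Hint Extern 1 (depth_le _ _) => solve [auto with dep] : linf.

Lemma smul_assoc J F G H : in_Linf J F -> in_Linf J G -> in_Linf J H -> smul F (smul G H) = smul (smul F G) H.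
Proof.
  intros f g h. rewrite (smul_op (smul F G)), (smul_op F G), (op_op J).
  - rewrite smul_op. apply op_ext. intros a _. now rewrite <- smul_op, smul_sh.
  - now apply tame_sh.
  - now apply tame_sh.
Qed.

Lemma smul_addl J F G H : in_Linf J F -> in_Linf J G -> in_Linf J H -> smul (sadd F G) H = sadd (smul F H) (smul G H).
Proof. intros f g h. rewrite !smul_op. apply (op_add J); now apply tame_sh. Qed.

Lemma smul_one F : smul one F = F.
Proof.
  apply functional_extensionality. intro m. unfold one. rewrite smul_monol, Rmult_1_l. f_equal. mon_ext.
Qed.

Lemma smul_scale c F G : smul (sscale c F) G = sscale c (smul F G).
Proof. rewrite !smul_op. apply op_scale. Qed.

Lemma sscale_mono c d M : sscale c (mono d M) = mono (c * d) M.
Proof.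
  apply functional_extensionality. intro m. unfold sscale, mono. destruct (excluded_middle_informative _); ring.
Qed.

Lemma smul_mono c d M N : smul (mono c M) (mono d N) = mono (c * d) (monD M N).
Proof.
  apply functional_extensionality. intro m. rewrite smul_monol. unfold mono.
  destruct (excluded_middle_informative (_ = N)) as [e|n], (excluded_middle_informative (m = _)) as [e'|n']; try ring.
  - elim n'. rewrite <- e. mon_ext.
  - elim n. rewrite e'. mon_ext.
Qed.

Lemma sscale_mul c F : sscale c F = smul (mono c mon0) F.
Proof. apply functional_extensionality. intro m. rewrite smul_monol. unfold sscale. f_equal. f_equal. mon_ext. Qed.

(** Associativity and distributivity hold for series with controlled supports, not for arbitrary
    functions on monomials. The bundled type is a ring on which the [ring] tactic can run. *)
Definition tser := {F : ser | in_frakL F}.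

Lemma tser_eq (F G : tser) : proj1_sig F = proj1_sig G -> F = G.
Proof. destruct F as [F f], G as [G g]; simpl. intros ->. f_equal. apply proof_irrelevance. Qed.

Lemma frak_max2 F G : in_frakL F -> in_frakL G -> exists J, in_Linf J F /\ in_Linf J G.
Proof.
  intros [j f] [j' g]. exists (Nat.max j j'). split; [apply (in_weaken j)|apply (in_weaken j')]; auto; lia.
Qed.
Lemma frak_add F G : in_frakL F -> in_frakL G -> in_frakL (sadd F G).
Proof. intros f g. destruct (frak_max2 F G f g) as [J [? ?]]. exists J; auto with linf. Qed.
Lemma frak_mul F G : in_frakL F -> in_frakL G -> in_frakL (smul F G).
Proof. intros f g. destruct (frak_max2 F G f g) as [J [? ?]]. exists J; auto with linf. Qed.
Lemma frak_scale c F : in_frakL F -> in_frakL (sscale c F).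
Proof. intros [J f]. exists J; auto with linf. Qed.

Definition tadd (F G : tser) : tser := exist _ (sadd (proj1_sig F) (proj1_sig G)) (frak_add _ _ (proj2_sig F) (proj2_sig G)).
Definition tmul (F G : tser) : tser := exist _ (smul (proj1_sig F) (proj1_sig G)) (frak_mul _ _ (proj2_sig F) (proj2_sig G)).
Definition topp (F : tser) : tser := exist _ (sopp (proj1_sig F)) (frak_scale _ _ (proj2_sig F)).
Definition tsub (F G : tser) : tser := tadd F (topp G).
Definition tone : tser := exist _ one (ex_intro _ 0%nat (in_one 0)).
Definition tzero : tser := exist _ szero (ex_intro _ 0%nat (in_zero 0)).

Lemma frak_max3 F G H : in_frakL F -> in_frakL G -> in_frakL H -> exists J, in_Linf J F /\ in_Linf J G /\ in_Linf J H.
Proof.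
  intros f g [j h]. destruct (frak_max2 F G f g) as [J [? ?]]. exists (Nat.max j J).
  split; [|split]; [apply (in_weaken J)|apply (in_weaken J)|apply (in_weaken j)]; auto; lia.
Qed.

Lemma sadd_comm F G : sadd F G = sadd G F.
Proof. apply functional_extensionality. intro. unfold sadd. ring. Qed.

Lemma tser_ring : ring_theory tzero tone tadd tmul tsub topp eq.
Proof.
  constructor; intros; apply tser_eq; simpl;
    try (apply functional_extensionality; intro; unfold sadd, szero, sopp, sscale; simpl; ring).
  - apply smul_one.
  - apply smul_comm.
  - destruct (frak_max3 _ _ _ (proj2_sig x) (proj2_sig y) (proj2_sig z)) as (J & ? & ? & ?). now apply (smul_assoc J).
  - destruct (frak_max3 _ _ _ (proj2_sig x) (proj2_sig y) (proj2_sig z)) as (J & ? & ? & ?). now apply (smul_addl J).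
Qed.

Add Ring tser_ring : tser_ring.

Definition tmk J F (H : in_Linf J F) : tser := exist in_frakL F (ex_intro _ J H).

Ltac find_in F :=
  match goal with
  | H : in_Linf ?J F |- _ => constr:(tmk J F H)
  end.
Ltac reify F :=
  lazymatch F with
  | smul ?A ?B => let a := reify A in let b := reify B in constr:(tmul a b)
  | sadd ?A ?B => let a := reify A in let b := reify B in constr:(tadd a b)
  | ssub ?A ?B => let a := reify A in let b := reify B in constr:(tsub a b)
  | sopp ?A => let a := reify A in constr:(topp a)
  | one => constr:(tone)
  | szero => constr:(tzero)
  | _ => find_in F
  end.
(* Ring identities between series whose atoms have an [in_Linf] hypothesis in the context. *)
Ltac sring :=
  match goal with |- ?A = ?B =>
    let a := reify A in let b := reify B in
    let E := fresh in assert (E : @eq tser a b) by ring; exact (f_equal (@proj1_sig ser in_frakL) E)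
  end.

(** * Substitution of an infinitesimal series in a power series *)

Definition nneg (F : ser) : Prop := forall m, F m <> 0 -> mon_le mon0 m.
Definition small (J : nat) (d : ser) : Prop := in_Linf J d /\ forall m, d m <> 0 -> mon_lt mon0 m.

Lemma small_in J d : small J d -> in_Linf J d.
Proof. now intros [h _]. Qed.
#[global] Hint Resolve small_in : linf.

Lemma small_nonneg J d : small J d -> nneg d.
Proof. intros [_ h] m hm. right. auto. Qed.

Lemma small_zero J : small J szero.
Proof. split; [auto with linf|]. intros m h. now elim h. Qed.

Lemma small_add J d e : small J d -> small J e -> small J (sadd d e).
Proof.
  intros [h p] [h' p']. split; [auto with linf|]. intros m hm. unfold sadd in hm.
  destruct (Req_dec_T (d m) 0); [apply p'; lra|auto].
Qed.

Lemma small_scale J c d : small J d -> small J (sscale c d).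
Proof. intros [h p]. split; [auto with linf|]. intros m hm. apply p. now apply prod_neq0 in hm. Qed.

Lemma small_mul J d F : small J d -> in_Linf J F -> nneg F -> small J (smul d F).
Proof.
  intros [h p] f q. split; [auto with linf|]. intros m hm. apply smul_supp in hm as (a & b & ha & hb & ->).
  rewrite <- (monD0 mon0). eapply mon_lt_le_trans; [apply mon_lt_add, p, ha|].
  apply mon_le_add2; [now left|auto].
Qed.

Lemma spow_supp d n m : spow d n m <> 0 -> npow (supp d) n m.
Proof.
  revert m. induction n as [|n IH]; intros m h; [now apply mono_supp in h|].
  apply smul_supp in h as (a & b & ha & hb & ->). exists a, b. auto.
Qed.

Lemma sfam_spow J d : small J d -> sfam J (spow d) (fun _ => True).
Proof.
  intros [h p]. destruct (star_good J (supp d) h p) as [g f]. split.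
  - apply (good_sub J _ _ g). intros m (n & _ & hn). exists n. now apply spow_supp.
  - intro m. apply (finite_sub _ _ (f m)). intros n [_ hn]. now apply spow_supp.
Qed.

Lemma sfam_spow_on J d P : small J d -> sfam J (spow d) P.
Proof. intros h. apply (sfam_sub J _ _ _ (sfam_spow J d h)). auto. Qed.
#[global] Hint Resolve sfam_spow_on tame_sh : linf.

Definition ps (c : nat -> R) (d : ser) : ser := op (spow d) c.

Lemma ps_in J c d : small J d -> in_Linf J (ps c d).
Proof. intros h. apply op_in. auto with linf. Qed.
#[global] Hint Resolve ps_in : linf.

Lemma ps_supp c d m : ps c d m <> 0 -> star (supp d) m.
Proof. intros h. apply op_supp in h as (n & _ & h). exists n. now apply spow_supp. Qed.

Lemma ps_nonneg J c d : small J d -> nneg (ps c d).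
Proof.
  intros [_ p] m h. apply ps_supp in h as [n h]. apply (npow_nonneg (supp d) n m); [|easy].
  intros a ha. right. auto.
Qed.

Lemma ps_ext c c' d : (forall n, c n = c' n) -> ps c d = ps c' d.
Proof. intros h. f_equal. now apply functional_extensionality. Qed.

Lemma ps_add J c c' d : small J d -> ps (fun n => c n + c' n) d = sadd (ps c d) (ps c' d).
Proof. intros h. apply (op_add J); auto with linf. Qed.

Lemma ps_scale k c d : ps (fun n => k * c n) d = sscale k (ps c d).
Proof. apply op_scale. Qed.

Lemma ps_const k d : ps (fun n => match n with 0%nat => k | S _ => 0 end) d = mono k mon0.
Proof.
  apply functional_extensionality. intro m. unfold ps, op. rewrite (fsumR_single 0%nat).
  - simpl. unfold one, mono. destruct (excluded_middle_informative _); ring.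
  - intros [|i] h; [easy|ring].
Qed.

Lemma ps_shift J c d : small J d -> smul d (ps c d) = ps (fun n => match n with 0%nat => 0 | S n => c n end) d.
Proof.
  intros h. rewrite smul_comm, smul_op. unfold ps at 1. rewrite (op_op J) by auto with linf.
  apply functional_extensionality. intro m. unfold ps, op at 1.
  set (b := fun k : nat => match k with 0%nat => 0 | S n => c n end * spow d k m).
  transitivity (fsumR (fun n => b (S n))).
  - apply fsumR_ext. intro n. unfold b. f_equal. rewrite <- smul_op, smul_comm. reflexivity.
  - apply (fsumR_reindex S b); [lia|]. intros [|k] hk; [unfold b in hk; lra|eauto].
Qed.

Lemma ps_decomp J c d : small J d -> ps c d = sadd (mono (c 0%nat) mon0) (smul d (ps (fun n => c (S n)) d)).
Proof.
  intros h. rewrite (ps_shift J), <- (ps_const _ d), <- (ps_add J) by easy. apply ps_ext. intros [|n]; ring.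
Qed.

Lemma ps_small J c d : small J d -> c 0%nat = 0 -> small J (ps c d).
Proof.
  intros h e. rewrite (ps_decomp J) by easy. rewrite e. apply small_add.
  - split; [auto with linf|]. intros m hm. exfalso. apply hm. unfold mono. now destruct (excluded_middle_informative _).
  - apply small_mul; [easy|auto with linf|]. now apply (ps_nonneg J).
Qed.

Lemma ps_one_small J c d : small J d -> c 0%nat = 1 -> small J (ssub (ps c d) one).
Proof.
  intros h e.
  replace (ssub (ps c d) one) with (ps (fun n => c n + -1 * match n with 0%nat => 1 | S _ => 0 end) d).
  - apply ps_small; [easy|lra].
  - rewrite (ps_add J) by easy. now rewrite ps_scale, ps_const.
Qed.

(** The three series stand for [(1 + d)^a], [log(1 + d)] and [1/(1 + d)]. *)
Definition pw (d : ser) (a : R) : ser := ps (gbinom a) d.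
Definition lgc (n : nat) : R := match n with 0%nat => 0 | S n' => (-1) ^ n' / INR (S n') end.
Definition lg (d : ser) : ser := ps lgc d.
Definition geo (d : ser) : ser := ps (fun n => (-1) ^ n) d.

Lemma gbinom_0 a : gbinom a 0 = 1.
Proof. unfold gbinom. simpl. field. Qed.

Lemma gprod_S a n : gprod (a + 1) (S n) = (a + 1) * gprod a n.
Proof.
  induction n as [|n IH]; [simpl; ring|].
  change (gprod (a + 1) (S (S n))) with (gprod (a + 1) (S n) * (a + 1 - INR (S n))).
  rewrite IH, S_INR. simpl gprod. ring.
Qed.

Lemma gbinom_pascal a n : gbinom (a + 1) (S n) = gbinom a (S n) + gbinom a n.
Proof.
  unfold gbinom. rewrite gprod_S. simpl gprod. rewrite fact_simpl, mult_INR, S_INR.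
  field. split; [apply INR_fact_neq_0|]. rewrite <- S_INR. now apply not_0_INR.
Qed.

Lemma pw_in J d a : small J d -> in_Linf J (pw d a).
Proof. apply ps_in. Qed.
Lemma lg_in J d : small J d -> in_Linf J (lg d).
Proof. apply ps_in. Qed.
#[global] Hint Resolve pw_in lg_in : linf.

Lemma pw_small J d a : small J d -> small J (ssub (pw d a) one).
Proof. intros h. apply ps_one_small; [easy|apply gbinom_0]. Qed.
Lemma lg_small J d : small J d -> small J (lg d).
Proof. intros h. now apply ps_small. Qed.

Lemma gprod_0 n : gprod 0 (S n) = 0.
Proof. induction n; simpl in *; [ring|]. rewrite IHn. ring. Qed.

Lemma pw_0 d : pw d 0 = one.
Proof.
  unfold pw, one. rewrite <- (ps_const 1 d). apply ps_ext. intros [|n]; [apply gbinom_0|].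
  unfold gbinom. rewrite gprod_0. unfold Rdiv. ring.
Qed.

Lemma pw_S J d a : small J d -> pw d (a + 1) = smul (sadd one d) (pw d a).
Proof.
  intros h. assert (P := pw_in J d a h). assert (D := small_in J d h).
  transitivity (sadd (pw d a) (smul d (pw d a))).
  - unfold pw. rewrite (ps_shift J), <- (ps_add J) by easy. apply ps_ext. intros [|n].
    + rewrite !gbinom_0. ring.
    + apply gbinom_pascal.
  - sring.
Qed.

Lemma pw_1 J d : small J d -> pw d 1 = sadd one d.
Proof.
  intros h. assert (D := small_in J d h).
  rewrite <- (Rplus_0_l 1), (pw_S J), pw_0 by easy. sring.
Qed.

Lemma geo_in J d : small J d -> in_Linf J (geo d).
Proof. apply ps_in. Qed.
#[global] Hint Resolve geo_in : linf.

Lemma geo_inv J d : small J d -> smul (sadd one d) (geo d) = one.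
Proof.
  intros h. assert (P := geo_in J d h). assert (D := small_in J d h).
  transitivity (sadd (geo d) (smul d (geo d))); [sring|].
  unfold geo. rewrite (ps_shift J), <- (ps_add J) by easy. unfold one. rewrite <- (ps_const 1 d).
  apply ps_ext. intros [|n]; simpl; ring.
Qed.

(** * Polynomial dependence on the exponent *)

Fixpoint peval (l : list R) (a : R) : R := match l with nil => 0 | c :: l => c + a * peval l a end.
Definition ispoly (p : R -> R) : Prop := exists l, forall a, p a = peval l a.

Lemma ispoly_const c : ispoly (fun _ => c).
Proof. exists (c :: nil). intro; simpl; ring. Qed.
Lemma ispoly_id : ispoly (fun a => a).
Proof. exists (0 :: 1 :: nil). intro; simpl; ring. Qed.
Lemma peval_add l l' : exists l2, forall a, peval l a + peval l' a = peval l2 a.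
Proof.
  revert l'. induction l as [|c l IH]; intros [|c' l'].
  - exists nil. intro; simpl; ring.
  - exists (c' :: l'). intro; simpl; ring.
  - exists (c :: l). intro; simpl; ring.
  - destruct (IH l') as [l2 h]. exists (c + c' :: l2). intro a. simpl. rewrite <- h. ring.
Qed.
Lemma ispoly_add p q : ispoly p -> ispoly q -> ispoly (fun a => p a + q a).
Proof.
  intros [l h] [l' h']. destruct (peval_add l l') as [l2 e]. exists l2. intro a. now rewrite h, h'.
Qed.
Lemma ispoly_scal c p : ispoly p -> ispoly (fun a => c * p a).
Proof.
  intros [l h]. exists (map (Rmult c) l). intro a. rewrite h. clear h.
  induction l as [|x l IH]; simpl; [ring|rewrite <- IH; ring].
Qed.
Lemma ispoly_mul p q : ispoly p -> ispoly q -> ispoly (fun a => p a * q a).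
Proof.
  intros [l h] hq. revert p h. induction l as [|c l IH]; intros p h.
  - exists nil. intro a. rewrite h. simpl. ring.
  - destruct (ispoly_add _ _ (ispoly_scal c q hq) (ex_intro _ (0 :: proj1_sig (constructive_indefinite_description _ (IH _ (fun a => eq_refl)))) (fun a => eq_refl))) as [l2 h2].
    exists l2. intro a. rewrite <- h2, h. destruct (constructive_indefinite_description _ _) as [l3 h3]. simpl.
    rewrite <- h3. ring.
Qed.
Lemma ispoly_ext p q : (forall a, p a = q a) -> ispoly p -> ispoly q.
Proof. intros e [l h]. exists l. intro a. now rewrite <- e. Qed.

Lemma peval_div l r : exists l', length l' = pred (length l) /\ forall a, peval l a = peval l r + (a - r) * peval l' a.
Proof.
  induction l as [|c l (l' & e & h)].
  - exists nil. split; [easy|]. intro; simpl; ring.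
  - destruct l as [|c' l].
    + exists nil. split; [easy|]. intro; simpl; ring.
    + exists (peval (c' :: l) r :: l'). split; [simpl in *; lia|]. intro a.
      change (peval (c :: c' :: l) a) with (c + a * peval (c' :: l) a).
      change (peval (c :: c' :: l) r) with (c + r * peval (c' :: l) r). rewrite (h a). simpl. ring.
Qed.

(** Dividing by [a - k0] shortens the list, and the quotient is known to vanish only from [S k0] on;
    hence the bound [k0] varies in the induction. *)
Lemma peval_zero l : forall k0, (forall k, (k0 <= k)%nat -> peval l (INR k) = 0) -> forall a, peval l a = 0.
Proof.
  remember (length l) as n. revert l Heqn. induction n as [|n IH]; intros l e k0 h a.
  - now destruct l.
  - destruct (peval_div l (INR k0)) as (l' & el & hl). rewrite hl, h by lia.
    rewrite (IH l' ltac:(lia) (S k0)); [ring|]. intros k hk.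
    pose proof (h k ltac:(lia)) as h1. rewrite hl, (h k0) in h1 by lia.
    assert (INR k - INR k0 <> 0) by (apply lt_INR in hk; lra).
    apply Rmult_eq_reg_l with (INR k - INR k0); lra.
Qed.

Lemma ispoly_eq p q : ispoly p -> ispoly q -> (forall n : nat, p (INR n) = q (INR n)) -> forall a, p a = q a.
Proof.
  intros hp hq e. destruct (ispoly_add _ _ hp (ispoly_scal (-1) _ hq)) as [l h]. intro a.
  cut (p a + -1 * q a = 0); [lra|]. rewrite h. apply (peval_zero l 0). intros k _. rewrite <- h, e. ring.
Qed.

Lemma ispoly_sum {I : Type} (p : I -> R -> R) l : (forall i, ispoly (p i)) -> ispoly (fun a => sumR (map (fun i => p i a) l)).
Proof.
  intros h. induction l as [|x l IH]; simpl; [apply ispoly_const|now apply ispoly_add].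
Qed.

Lemma ispoly_fsum {I : Type} (p : I -> R -> R) (P : I -> Prop) :
  finite P -> (forall a i, p i a <> 0 -> P i) -> (forall i, ispoly (p i)) -> ispoly (fun a => fsumR (fun i => p i a)).
Proof.
  intros f s h. destruct (finite_nodup _ f) as [l [nd hl]].
  apply (ispoly_ext (fun a => sumR (map (fun i => p i a) l))); [|now apply ispoly_sum].
  intro a. symmetry. apply fsumR_list; [easy|]. intros i hi. apply hl. eauto.
Qed.

(** The support bound [A] is common to all exponents: each coefficient of a product is then a sum of
    polynomials over one finite set, hence a polynomial. *)
Definition polyfam (J : nat) (W : R -> ser) : Prop :=
  exists A, good J A /\ (forall a m, W a m <> 0 -> A m) /\ forall m, ispoly (fun a => W a m).

Lemma polyfam_eq J W V : polyfam J W -> polyfam J V -> (forall n : nat, W (INR n) = V (INR n)) -> forall a, W a = V a.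
Proof.
  intros (A & _ & _ & p) (B & _ & _ & q) e a. apply functional_extensionality. intro m.
  apply (ispoly_eq (fun a => W a m) (fun a => V a m)); auto. intro n. now rewrite e.
Qed.

Lemma polyfam_mul J W V : polyfam J W -> polyfam J V -> polyfam J (fun a => smul (W a) (V a)).
Proof.
  intros (A & gA & sA & p) (B & gB & sB & q). exists (sumset A B). split; [now apply good_sumset|split].
  - intros a m h. apply smul_supp in h as (x & y & hx & hy & ->). exists x, y. repeat split; eauto.
  - intro m. apply (ispoly_ext (fun a => fsumR (fun b => W a b * V a (monD m (monS (-1) b))))); [intro; now rewrite smul_conv|].
    eapply (ispoly_fsum (fun b a => W a b * V a (monD m (monS (-1) b))));
      [apply (finite_image fst _ (sumset_finite J A B m gA gB))| |].
    + intros a b h. apply prod_neq0 in h as [h1 h2]. exists (b, monD m (monS (-1) b)). simpl. repeat split; eauto. mon_ext.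
    + intro b. now apply ispoly_mul.
Qed.

Lemma polyfam_const J F : in_Linf J F -> polyfam J (fun _ => F).
Proof. intros h. exists (supp F). split; [easy|split; [auto|]]. intro; apply ispoly_const. Qed.

Lemma polyfam_ps J d c : small J d -> (forall n, ispoly (fun a => c a n)) -> polyfam J (fun a => ps (c a) d).
Proof.
  intros h p. destruct (sfam_spow J d h) as [g f].
  eexists. split; [exact g|split].
  - intros a m hm. apply op_supp in hm as (n & _ & hn). eauto.
  - intro m. apply (ispoly_fsum (fun n a => c a n * spow d n m) _ (f m)).
    + intros a n hn. now apply prod_neq0 in hn.
    + intro n. apply ispoly_mul; [easy|apply ispoly_const].
Qed.

Lemma ispoly_gbinom x y n : ispoly (fun a => gbinom (x + y * a) n).
Proof.
  unfold gbinom, Rdiv. apply ispoly_mul; [|apply ispoly_const].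
  induction n as [|n IH]; simpl; [apply ispoly_const|]. apply ispoly_mul; [easy|].
  apply (ispoly_ext (fun a => (x - INR n) + y * a)); [intro; ring|].
  apply ispoly_add; [apply ispoly_const|apply ispoly_scal, ispoly_id].
Qed.

Lemma polyfam_pw J d x y : small J d -> polyfam J (fun a => pw d (x + y * a)).
Proof. intros h. apply polyfam_ps; [easy|]. intro; apply ispoly_gbinom. Qed.

Lemma polyfam_pw1 J d : small J d -> polyfam J (fun a => pw d a).
Proof.
  intros h. assert (E : (fun a => pw d a) = fun a => pw d (0 + 1 * a))
    by (apply functional_extensionality; intro; f_equal; ring).
  rewrite E. now apply polyfam_pw.
Qed.

(** Both sides have coefficients polynomial in [b], and for natural [b] they agree by induction
    through [pw_S]. The next two laws are proved in the same way. *)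
Lemma pw_add J d a b : small J d -> pw d (a + b) = smul (pw d a) (pw d b).
Proof.
  intros h. revert b. apply (polyfam_eq J (fun b => pw d (a + b)) (fun b => smul (pw d a) (pw d b))).
  - assert (E : (fun b => pw d (a + b)) = fun b => pw d (a + 1 * b))
      by (apply functional_extensionality; intro; f_equal; ring).
    rewrite E. now apply polyfam_pw.
  - apply polyfam_mul; [apply polyfam_const; auto with linf|now apply polyfam_pw1].
  - assert (A := pw_in J d a h). assert (D := small_in J d h). induction n as [|n IH].
    + simpl. rewrite pw_0, Rplus_0_r. sring.
    + assert (B := pw_in J d (INR n) h). rewrite S_INR, <- Rplus_assoc, !(pw_S J), IH by easy. sring.
Qed.

Lemma pw_mul_base J u v a : small J u -> small J v ->
  smul (pw u a) (pw v a) = pw (ssub (smul (sadd one u) (sadd one v)) one) a.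
Proof.
  intros hu hv. set (w := ssub _ one). assert (U := small_in J u hu). assert (V := small_in J v hv).
  assert (E : w = sadd (sadd u v) (smul u v)) by (unfold w; sring).
  assert (hw : small J w).
  { rewrite E. repeat apply small_add; auto. apply small_mul; auto. now apply (small_nonneg J). }
  assert (W := small_in J w hw).
  revert a. apply (polyfam_eq J (fun a => smul (pw u a) (pw v a))).
  - apply polyfam_mul; now apply polyfam_pw1.
  - now apply polyfam_pw1.
  - induction n as [|n IH].
    + simpl. rewrite !pw_0. apply smul_one.
    + assert (A := pw_in J u (INR n) hu). assert (B := pw_in J v (INR n) hv).
      rewrite S_INR, !(pw_S J), <- IH, E by easy. sring.
Qed.

Lemma pw_pw J u a b : small J u -> pw (ssub (pw u a) one) b = pw u (a * b).
Proof.
  intros hu. set (w := ssub _ one). assert (U := small_in J u hu). assert (hw : small J w) by now apply pw_small.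
  assert (W := small_in J w hw). assert (A := pw_in J u a hu).
  revert b. apply (polyfam_eq J (fun b => pw w b) (fun b => pw u (a * b))).
  - now apply polyfam_pw1.
  - assert (E : (fun b => pw u (a * b)) = fun b => pw u (0 + a * b))
      by (apply functional_extensionality; intro; f_equal; ring).
    rewrite E. now apply polyfam_pw.
  - induction n as [|n IH].
    + simpl. now rewrite Rmult_0_r, !pw_0.
    + assert (B := pw_in J u (a * INR n) hu). rewrite S_INR, Rmult_plus_distr_l, Rmult_1_r, (pw_S J), IH by easy.
      rewrite (pw_add J) by easy. unfold w. sring.
Qed.

(** * The logarithm as derivative of the power *)

Lemma gprod_m1 n : gprod (-1) n = (-1) ^ n * INR (fact n).
Proof.
  induction n as [|n IH]; [simpl; ring|]. simpl gprod. rewrite IH, fact_simpl, mult_INR, S_INR. simpl pow. ring.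
Qed.

(** The value of the derivative is left open: in [gbinom_derive] it gets multiplied by the exponent,
    which is 0 there. *)
Lemma gprod_derivable x n : exists l, derivable_pt_lim (fun a => gprod (a - 1) n) x l.
Proof.
  induction n as [|n [l IH]]; simpl.
  - exists 0. apply derivable_pt_lim_const.
  - eexists. apply (derivable_pt_lim_mult (fun a => gprod (a - 1) n) (fun a => a - 1 - INR n)); [exact IH|].
    apply (derivable_pt_lim_minus (fun a => a - 1) (fun _ => INR n)); [|apply derivable_pt_lim_const].
    apply (derivable_pt_lim_minus (fun a => a) (fun _ => 1)); [apply derivable_pt_lim_id|apply derivable_pt_lim_const].
Qed.

Lemma dlim_ext f g x l : (forall y, f y = g y) -> derivable_pt_lim f x l -> derivable_pt_lim g x l.
Proof. intros e. now replace g with f by now apply functional_extensionality. Qed.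

Lemma gbinom_derive n : derivable_pt_lim (fun a => gbinom a n) 0 (lgc n).
Proof.
  destruct n as [|n].
  - apply (dlim_ext (fun _ => 1)); [intro; now rewrite gbinom_0|apply derivable_pt_lim_const].
  - destruct (gprod_derivable 0 n) as [l h].
    apply (dlim_ext (fun a => a * gprod (a - 1) n * / INR (fact (S n)))).
    + intro a. unfold gbinom, Rdiv. f_equal. replace a with (a - 1 + 1) at 3 by ring. rewrite gprod_S. ring.
    + replace (lgc (S n)) with ((1 * gprod (0 - 1) n + 0 * l) * / INR (fact (S n)) + (0 * gprod (0 - 1) n) * 0).
      * apply (derivable_pt_lim_mult (fun a => a * gprod (a - 1) n) (fun _ => / INR (fact (S n)))); [|apply derivable_pt_lim_const].
        apply (derivable_pt_lim_mult (fun a => a) (fun a => gprod (a - 1) n)); [apply derivable_pt_lim_id|easy].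
      * replace (0 - 1) with (-1) by ring. rewrite gprod_m1. unfold lgc. rewrite fact_simpl, mult_INR.
        field. split; (apply INR_fact_neq_0 || now apply not_0_INR).
Qed.

Lemma dlim_sum {I : Type} (p : I -> R -> R) (p' : I -> R) l x : (forall i, derivable_pt_lim (p i) x (p' i)) ->
  derivable_pt_lim (fun a => sumR (map (fun i => p i a) l)) x (sumR (map p' l)).
Proof.
  intros h. induction l as [|y l IH]; simpl; [apply derivable_pt_lim_const|].
  now apply (derivable_pt_lim_plus (p y) (fun a => sumR (map (fun i => p i a) l))).
Qed.

Lemma dlim_fsum {I : Type} (p : I -> R -> R) (p' : I -> R) (P : I -> Prop) x :
  finite P -> (forall a i, p i a <> 0 -> P i) -> (forall i, derivable_pt_lim (p i) x (p' i)) ->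
  derivable_pt_lim (fun a => fsumR (fun i => p i a)) x (fsumR p').
Proof.
  intros f s h. destruct (finite_nodup _ f) as [l [nd hl]].
  rewrite (fsumR_list p' l nd).
  - apply (dlim_ext (fun a => sumR (map (fun i => p i a) l))); [|now apply dlim_sum].
    intro a. symmetry. apply fsumR_list; [easy|]. intros i hi. apply hl. eauto.
  - intros i hi. apply hl. apply NNPP. intro n. apply hi.
    apply (uniqueness_limite (p i) x); [easy|].
    apply (dlim_ext (fun _ => 0)); [|apply derivable_pt_lim_const].
    intro a. symmetry. apply NNPP. intro; eauto.
Qed.

(* The logarithm is the derivative of the power at exponent 0. *)
Lemma pw_derive J d m : small J d -> derivable_pt_lim (fun a => pw d a m) 0 (lg d m).
Proof.
  intros h. destruct (sfam_spow J d h) as [_ f].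
  apply (dlim_fsum (fun n a => gbinom a n * spow d n m) (fun n => lgc n * spow d n m) _ 0 (f m)).
  - intros a n hn. now apply prod_neq0 in hn.
  - intro n. replace (lgc n * spow d n m) with (lgc n * spow d n m + gbinom 0 n * 0) by ring.
    apply (derivable_pt_lim_mult (fun a => gbinom a n) (fun _ => spow d n m)); [apply gbinom_derive|apply derivable_pt_lim_const].
Qed.

(** Both sides are the derivative at [a = 0] of [(1 + u)^a (1 + v)^a], once through [pw_mul_base]
    and once by the product rule, coefficient by coefficient. *)
Lemma lg_mul J u v : small J u -> small J v ->
  lg (ssub (smul (sadd one u) (sadd one v)) one) = sadd (lg u) (lg v).
Proof.
  intros hu hv. assert (U := small_in J u hu). assert (V := small_in J v hv).
  assert (LU := lg_in J u hu). assert (LV := lg_in J v hv).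
  assert (E : ssub (smul (sadd one u) (sadd one v)) one = sadd (sadd u v) (smul u v)) by sring.
  assert (hw : small J (ssub (smul (sadd one u) (sadd one v)) one)).
  { rewrite E. repeat apply small_add; auto. apply small_mul; auto. now apply (small_nonneg J). }
  apply functional_extensionality. intro m.
  apply (uniqueness_limite (fun a => smul (pw u a) (pw v a) m) 0).
  - apply (dlim_ext (fun a => pw (ssub (smul (sadd one u) (sadd one v)) one) a m)); [|now apply (pw_derive J)].
    intro a. now rewrite (pw_mul_base J).
  - replace (sadd (lg u) (lg v)) with (sadd (smul (lg u) (pw v 0)) (smul (pw u 0) (lg v))) by (rewrite !pw_0; sring).
    destruct (polyfam_pw1 J u hu) as (A & gA & sA & _). destruct (polyfam_pw1 J v hv) as (B & gB & sB & _).
    apply (dlim_ext (fun a => fsumR (fun b => pw u a b * pw v a (monD m (monS (-1) b))))); [intro; now rewrite smul_conv|].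
    assert (F := finite_image fst _ (sumset_finite J A B m gA gB)).
    unfold sadd. rewrite !smul_conv, <- fsumR_add.
    + eapply (dlim_fsum (fun b a => pw u a b * pw v a (monD m (monS (-1) b))) (fun b => _ + _)); [exact F| |].
      * intros a b h. apply prod_neq0 in h as [h1 h2]. exists (b, monD m (monS (-1) b)). simpl. repeat split; eauto. mon_ext.
      * intro b. apply (derivable_pt_lim_mult (fun a => pw u a b) (fun a => pw v a (monD m (monS (-1) b)))); now apply (pw_derive J).
    + apply (finite_sub _ _ (finite_image fst _ (sumset_finite J _ _ m LU (pw_in J v 0 hv)))).
      intros b h. apply prod_neq0 in h as [h1 h2]. exists (b, monD m (monS (-1) b)). simpl. repeat split; eauto. mon_ext.
    + apply (finite_sub _ _ (finite_image fst _ (sumset_finite J _ _ m (pw_in J u 0 hu) LV))).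
      intros b h. apply prod_neq0 in h as [h1 h2]. exists (b, monD m (monS (-1) b)). simpl. repeat split; eauto. mon_ext.
Qed.

(** Differentiate [((1 + u)^a)^b = (1 + u)^(a b)] at [b = 0]; the chain rule gives the factor
    [a]. *)
Lemma lg_pw J u a : small J u -> lg (ssub (pw u a) one) = sscale a (lg u).
Proof.
  intros hu. apply functional_extensionality. intro m.
  apply (uniqueness_limite (fun b => pw u (a * b) m) 0).
  - apply (dlim_ext (fun b => pw (ssub (pw u a) one) b m)); [intro; now rewrite (pw_pw J)|].
    apply (pw_derive J). now apply pw_small.
  - unfold sscale. rewrite Rmult_comm.
    apply (derivable_pt_lim_comp (fun b => a * b) (fun c => pw u c m)).
    + replace (derivable_pt_lim (fun b : R => a * b) 0 a) with (derivable_pt_lim (fun b : R => a * b) 0 (a * 1)) by (f_equal; ring). apply (derivable_pt_lim_scal (fun b => b)). apply derivable_pt_lim_id.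
    + rewrite Rmult_0_r. now apply (pw_derive J).
Qed.

(** * Normal forms *)

(** Gives explicitly what [leadcm] and [sdelta] obtain by choice; uniqueness of leading terms
    identifies the two, as [lead_leadcm] and [nf_delta] show. *)
Definition nf (J : nat) (G : ser) (c : R) (M : mon) (d : ser) : Prop :=
  depth_le J M /\ c <> 0 /\ small J d /\ G = smul (mono c M) (sadd one d).

Lemma nf_in J G c M d : nf J G c M d -> in_Linf J G.
Proof. intros (h1 & h2 & h3 & ->). auto with linf. Qed.

Lemma small_0 J d : small J d -> d mon0 = 0.
Proof. intros [_ h]. apply NNPP. intro n. now apply h, mon_lt_irrefl in n. Qed.

Lemma small_weaken J J' d : (J <= J')%nat -> small J d -> small J' d.
Proof. intros l [h p]. split; [now apply (in_weaken J)|easy]. Qed.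

Lemma nf_weaken J J' G c M d : (J <= J')%nat -> nf J G c M d -> nf J' G c M d.
Proof.
  intros l (h1 & h2 & h3 & ->). split; [now apply (depth_le_mono J)|split; [easy|split; [|easy]]].
  now apply (small_weaken J).
Qed.

Lemma nf_lead J G c M d : nf J G c M d -> lead G c M.
Proof.
  intros (h1 & h2 & h3 & ->). split; [|split; [easy|]].
  - rewrite smul_monol. replace (monD M (monS (-1) M)) with mon0 by mon_ext. unfold sadd.
    rewrite (small_0 J d) by easy. unfold one. rewrite mono_eq. ring.
  - intros m hm n. rewrite smul_monol in hm. apply prod_neq0 in hm as [_ hm]. unfold sadd, one in hm.
    rewrite mono_neq in hm.
    + assert (L : mon_lt mon0 (monD m (monS (-1) M))) by (apply h3; lra).
      apply (mon_lt_add _ _ M) in L. rewrite mon0D in L. 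
      replace (monD (monD m (monS (-1) M)) M) with m in L by mon_ext. easy.
    + intro e. apply n. rewrite <- (monDB M m), e. apply monD0.
Qed.

Lemma lead_unique F c M c' M' : lead F c M -> lead F c' M' -> c = c' /\ M = M'.
Proof.
  intros (e & n & h) (e' & n' & h'). assert (M = M') as <-.
  { apply NNPP. intro ne. apply (mon_lt_irrefl M), (mon_lt_trans _ M'); [apply h|apply h']; congruence. }
  split; congruence.
Qed.

Lemma lead_leadcm F c M : lead F c M -> leadcm F = (c, M).
Proof.
  intros h. unfold leadcm. destruct (excluded_middle_informative _) as [E|n].
  - destruct (constructive_indefinite_description _ E) as [[c' M'] h']; simpl in *.
    destruct (lead_unique _ _ _ _ _ h h'). congruence.
  - elim n. now exists (c, M).
Qed.

Lemma smul_monoA c M d N F : smul (mono c M) (smul (mono d N) F) = smul (mono (c * d) (monD M N)) F.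
Proof.
  apply functional_extensionality. intro m. rewrite !smul_monol, Rmult_assoc. do 3 f_equal. mon_ext.
Qed.

Lemma nf_delta J G c M d : nf J G c M d -> sdelta G = d.
Proof.
  intros h. unfold sdelta. rewrite (lead_leadcm G c M) by now apply (nf_lead J _ _ _ d). simpl.
  destruct h as (h1 & h2 & h3 & ->). rewrite smul_monoA. assert (D := small_in J d h3).
  replace (monD (monS (-1) M) M) with mon0 by mon_ext. replace (/ c * c) with 1 by (field; easy).
  fold one. sring.
Qed.

Lemma lead_nf J G c M : in_Linf J G -> lead G c M -> exists d, nf J G c M d.
Proof.
  intros g h. destruct h as (e & n & h).
  assert (hM : depth_le J M) by (apply g; congruence).
  set (N := smul (mono (/ c) (monS (-1) M)) G).
  assert (hN : in_Linf J N) by (unfold N; auto with linf).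
  exists (ssub N one). split; [easy|split; [easy|split]].
  - split; [auto with linf|]. intros m hm.
    assert (E : ssub N one m = / c * G (monD m M) + -1 * one m).
    { unfold ssub, sadd, sopp, sscale, N. rewrite smul_monol. do 3 f_equal. mon_ext. }
    rewrite E in hm. destruct (classic (m = mon0)) as [->|nm].
    + exfalso. apply hm. rewrite mon0D, e. unfold one. rewrite mono_eq. field. easy.
    + unfold one in hm. rewrite (mono_neq _ _ _ nm) in hm.
      assert (L : mon_lt M (monD m M)).
      { apply h; [intro z; apply hm; rewrite z; ring|]. intro z. apply nm.
        apply (monD_inj M). now rewrite (monDC M m), monD0. }
      apply (mon_lt_add _ _ (monS (-1) M)) in L.
      replace (monD M (monS (-1) M)) with mon0 in L by mon_ext.
      replace (monD (monD m M) (monS (-1) M)) with m in L by mon_ext. easy.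
  - replace (sadd one (ssub N one)) with N by sring.
    unfold N. rewrite smul_monoA. replace (monD M (monS (-1) M)) with mon0 by mon_ext.
    replace (c * / c) with 1 by (field; easy). fold one. now rewrite smul_one.
Qed.

Lemma nf_mul J G c M d G' c' M' d' : nf J G c M d -> nf J G' c' M' d' ->
  nf J (smul G G') (c * c') (monD M M') (ssub (smul (sadd one d) (sadd one d')) one).
Proof.
  intros (h1 & h2 & h3 & ->) (h1' & h2' & h3' & ->).
  assert (D := small_in J d h3). assert (D' := small_in J d' h3').
  assert (A := in_mono J c M h1). assert (A' := in_mono J c' M' h1').
  split; [auto with dep|split; [now apply Rmult_integral_contrapositive_currified|split]].
  - replace (ssub _ _) with (sadd (sadd d d') (smul d d')) by sring.
    repeat apply small_add; auto. apply small_mul; auto. now apply (small_nonneg J).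
  - rewrite <- smul_mono. sring.
Qed.

Lemma rpow_nf J G c M d a : nf J G c M d ->
  rpow G a = smul (mono (Rpower c a) (monS a M)) (pw d a).
Proof.
  intros h. unfold rpow. rewrite (lead_leadcm G c M) by now apply (nf_lead J _ _ _ d).
  now rewrite (nf_delta J G c M d).
Qed.

Lemma nf_rpow J G c M d a : nf J G c M d ->
  nf J (rpow G a) (Rpower c a) (monS a M) (ssub (pw d a) one).
Proof.
  intros h. pose proof h as (h1 & h2 & h3 & _). assert (P := pw_in J d a h3).
  split; [auto with dep|split; [|split]].
  - apply Rgt_not_eq, exp_pos.
  - now apply pw_small.
  - rewrite (rpow_nf J G c M d) by easy. f_equal. sring.
Qed.

Lemma sinv_nf J G c M d : nf J G c M d -> sinv G = smul (mono (/ c) (monS (-1) M)) (geo d).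
Proof.
  intros h. unfold sinv. rewrite (lead_leadcm G c M) by now apply (nf_lead J _ _ _ d).
  now rewrite (nf_delta J G c M d).
Qed.

Lemma nf_sinv J G c M d : nf J G c M d -> nf J (sinv G) (/ c) (monS (-1) M) (ssub (geo d) one).
Proof.
  intros h. pose proof h as (h1 & h2 & h3 & _). assert (P := geo_in J d h3).
  split; [auto with dep|split; [|split]].
  - now apply Rinv_neq_0_compat.
  - now apply ps_one_small.
  - rewrite (sinv_nf J G c M d) by easy. f_equal. sring.
Qed.

Lemma sinv_mul J G c M d : nf J G c M d -> smul G (sinv G) = one.
Proof.
  intros h. rewrite (sinv_nf J G c M d) by easy. destruct h as (h1 & h2 & h3 & ->).
  assert (P := geo_in J d h3). assert (D := small_in J d h3).
  assert (A := in_mono J c M h1). assert (A' := in_mono J (/ c) (monS (-1) M) ltac:(auto with dep)).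
  transitivity (smul (smul (mono c M) (mono (/ c) (monS (-1) M))) (smul (sadd one d) (geo d))); [sring|].
  rewrite (geo_inv J), smul_mono by easy. replace (monD M (monS (-1) M)) with mon0 by mon_ext.
  replace (c * / c) with 1 by (field; easy). apply smul_one.
Qed.

Lemma slog_nf J G c M d : nf J G c M d -> slog G = sadd (sadd (mono (ln c) mon0) (logmon M)) (lg d).
Proof.
  intros h. unfold slog. rewrite (lead_leadcm G c M) by now apply (nf_lead J _ _ _ d).
  rewrite (nf_delta J G c M d) by easy. simpl. f_equal.
  apply functional_extensionality. intro m. unfold ssum, lg, ps, op. apply fsumR_ext.
  intros [|n]; [unfold szero, lgc; ring|reflexivity].
Qed.

Lemma rpow_0 G : rpow G 0 = one.
Proof.
  unfold rpow. change (smul (mono (Rpower (fst (leadcm G)) 0) (monS 0 (snd (leadcm G)))) (pw (sdelta G) 0) = one).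
  rewrite pw_0. unfold one. rewrite smul_mono. f_equal; [|mon_ext].
  unfold Rpower. rewrite Rmult_0_l, exp_0. ring.
Qed.

Lemma rpow_1 J G c M d : nf J G c M d -> 0 < c -> rpow G 1 = G.
Proof.
  intros h p. rewrite (rpow_nf J G c M d) by easy. destruct h as (h1 & h2 & h3 & ->).
  rewrite (pw_1 J), Rpower_1 by easy. f_equal. f_equal. mon_ext.
Qed.

Lemma rpow_add J G c M d a b : nf J G c M d -> rpow G (a + b) = smul (rpow G a) (rpow G b).
Proof.
  intros h. rewrite !(rpow_nf J G c M d) by easy. destruct h as (h1 & h2 & h3 & _).
  assert (A := pw_in J d a h3). assert (B := pw_in J d b h3).
  assert (A' := in_mono J (Rpower c a) (monS a M) ltac:(auto with dep)).
  assert (B' := in_mono J (Rpower c b) (monS b M) ltac:(auto with dep)).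
  rewrite (pw_add J), Rpower_plus by easy.
  replace (monS (a + b) M) with (monD (monS a M) (monS b M)) by mon_ext.
  rewrite <- smul_mono. sring.
Qed.

Lemma rpow_mul J G c M d G' c' M' d' a : nf J G c M d -> nf J G' c' M' d' -> 0 < c -> 0 < c' ->
  rpow (smul G G') a = smul (rpow G a) (rpow G' a).
Proof.
  intros h h' p p'. rewrite (rpow_nf J _ _ _ _ a (nf_mul _ _ _ _ _ _ _ _ _ h h')).
  rewrite (rpow_nf J G c M d), (rpow_nf J G' c' M' d') by easy.
  destruct h as (h1 & h2 & h3 & _), h' as (h1' & h2' & h3' & _).
  rewrite <- (pw_mul_base J), <- Rpower_mult_distr by easy.
  assert (A := pw_in J d a h3). assert (B := pw_in J d' a h3').
  assert (A' := in_mono J (Rpower c a) (monS a M) ltac:(auto with dep)).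
  assert (B' := in_mono J (Rpower c' a) (monS a M') ltac:(auto with dep)).
  replace (monS a (monD M M')) with (monD (monS a M) (monS a M')) by mon_ext.
  rewrite <- smul_mono. sring.
Qed.

Lemma rpow_rpow J G c M d a b : nf J G c M d -> rpow (rpow G a) b = rpow G (a * b).
Proof.
  intros h. rewrite (rpow_nf J _ _ _ _ b (nf_rpow _ _ _ _ _ a h)), (rpow_nf J G c M d) by easy.
  rewrite (pw_pw J), Rpower_mult by apply h. f_equal. f_equal. mon_ext.
Qed.

(** * Logarithms *)

Lemma monE_inj k k' r : r <> 0 -> monE k r = monE k' r -> k = k'.
Proof.
  intros n e. apply (f_equal (fun m => m k)) in e. unfold monE in e. rewrite Nat.eqb_refl in e.
  destruct (Nat.eqb_spec k k'); [easy|congruence].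
Qed.

Lemma logmon_finite M m : finite (fun k => mono (- M k) (monE (S k) (-1)) m <> 0).
Proof.
  apply (finite_preimage (fun k => monE (S k) (-1)) _ (fun m' => m' = m)).
  - exists (m :: nil). intros i ->; now left.
  - intros i j _ _ e. apply monE_inj in e; [lia|lra].
  - intros i h. now apply mono_supp in h.
Qed.

Lemma logmon_supp M m : logmon M m <> 0 -> exists k, M k <> 0 /\ m = monE (S k) (-1).
Proof.
  intros h. apply fsumR_neq0 in h as [k h]. exists k. split; [|now apply mono_supp in h].
  intro e. apply h. rewrite e. unfold mono. destruct (excluded_middle_informative _); ring.
Qed.

Lemma logmon_at M k : logmon M (monE (S k) (-1)) = - M k.
Proof.
  unfold logmon, ssum. rewrite (fsumR_single k); [apply mono_eq|].
  intros i n. apply mono_neq. intro e. apply n. apply monE_inj in e; [lia|lra].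
Qed.

Lemma logmon_scale a M : logmon (monS a M) = sscale a (logmon M).
Proof.
  apply functional_extensionality. intro m. unfold logmon, ssum, sscale. rewrite <- fsumR_scal.
  apply fsumR_ext. intro k. unfold monS, mono. destruct (excluded_middle_informative _); ring.
Qed.

Lemma logmon_add M N : logmon (monD M N) = sadd (logmon M) (logmon N).
Proof.
  apply functional_extensionality. intro m. unfold logmon, ssum, sadd. rewrite <- fsumR_add by apply logmon_finite.
  apply fsumR_ext. intro k. unfold monD, mono. destruct (excluded_middle_informative _); ring.
Qed.

Lemma in_logmon J M : depth_le J M -> in_Linf (S J) (logmon M).
Proof.
  intros h. apply good_finite.
  - apply (finite_sub _ _ (finite_image (fun k => monE (S k) (-1)) _ (finite_lt (S J)))).
    intros m hm. apply logmon_supp in hm as (k & n & ->). exists k. split; [|easy].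
    apply NNPP. intro l. apply n, h. lia.
  - intros m hm. apply logmon_supp in hm as (k & n & ->). apply depth_leE.
    apply NNPP. intro l. apply n, h. lia.
Qed.
#[global] Hint Resolve in_logmon : linf.

Lemma logmonE k : logmon (monE k 1) = mono (-1) (monE (S k) (-1)).
Proof.
  apply functional_extensionality. intro m. destruct (classic (m = monE (S k) (-1))) as [->|n].
  - rewrite logmon_at, mono_eq. unfold monE. rewrite Nat.eqb_refl. ring.
  - rewrite mono_neq by easy. apply NNPP. intro h. apply logmon_supp in h as (i & hi & e).
    apply n. rewrite e. unfold monE in hi. destruct (Nat.eqb_spec i k); [now subst|easy].
Qed.

Lemma mono_add c d M : mono (c + d) M = sadd (mono c M) (mono d M).
Proof.
  apply functional_extensionality. intro m. unfold sadd, mono. destruct (excluded_middle_informative _); ring.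
Qed.

(** Since [log l_J = -1/l_{J+1}], a logarithm costs one level in the leading monomial only; the
    correction [d] may already have depth [S J]. *)
Lemma slog_in J G c M d : nf (S J) G c M d -> depth_le J M -> in_Linf (S J) (slog G).
Proof.
  intros h hM. rewrite (slog_nf _ _ _ _ _ h). destruct h as (h1 & h2 & h3 & _). auto with linf.
Qed.

Lemma slog_mul J G c M d G' c' M' d' : nf J G c M d -> nf J G' c' M' d' -> 0 < c -> 0 < c' ->
  slog (smul G G') = sadd (slog G) (slog G').
Proof.
  intros h h' p p'. rewrite (slog_nf J _ _ _ _ (nf_mul _ _ _ _ _ _ _ _ _ h h')).
  rewrite (slog_nf J G c M d), (slog_nf J G' c' M' d') by easy.
  destruct h as (h1 & h2 & h3 & _), h' as (h1' & h2' & h3' & _).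
  rewrite (lg_mul J), logmon_add, ln_mult, mono_add by easy.
  apply functional_extensionality. intro m. unfold sadd. ring.
Qed.

Lemma slog_rpow J G c M d a : nf J G c M d -> slog (rpow G a) = sscale a (slog G).
Proof.
  intros h. rewrite (slog_nf J _ _ _ _ (nf_rpow _ _ _ _ _ a h)), (slog_nf J G c M d) by easy.
  destruct h as (h1 & h2 & h3 & _).
  rewrite (lg_pw J), logmon_scale by easy. unfold Rpower. rewrite ln_exp.
  rewrite <- (sscale_mono a (ln c)). apply functional_extensionality. intro m. unfold sadd, sscale. ring.
Qed.

Lemma monE_neg_lt k m : (forall i, (i < S k)%nat -> m i = 0) -> -1 < m (S k) -> mon_lt (monE (S k) (-1)) m.
Proof.
  intros h l. exists (S k). unfold monE. rewrite Nat.eqb_refl. split; [|easy].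
  intros i hi. rewrite h by easy. destruct (Nat.eqb_spec i (S k)); [lia|easy].
Qed.

Lemma monE_neg_lt0 k : mon_lt (monE (S k) (-1)) mon0.
Proof. apply monE_neg_lt; unfold mon0; [easy|lra]. Qed.

(** The first nonzero exponent of [M], at [l_k], contributes [- M k / l_{k+1}]. This monomial is
    infinite, so it precedes the constant and [lg d], and it precedes every later [1/l_{i+1}]. *)
Lemma slog_lead J G c M d k : nf (S J) G c M d -> depth_le J M -> (forall i, (i < k)%nat -> M i = 0) -> M k <> 0 ->
  lead (slog G) (- M k) (monE (S k) (-1)).
Proof.
  intros h hM z n. rewrite (slog_nf _ _ _ _ _ h). destruct h as (h1 & h2 & h3 & _).
  destruct (lg_small _ _ h3) as [_ L]. unfold lead, sadd.
  assert (E0 : lg d (monE (S k) (-1)) = 0).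
  { apply NNPP. intro hh. apply (mon_lt_irrefl mon0), (mon_lt_trans _ (monE (S k) (-1))); [auto|apply monE_neg_lt0]. }
  split; [|split; [lra|]].
  - rewrite E0, logmon_at, mono_neq; [ring|]. intro e. apply (mon_lt_irrefl mon0). rewrite <- e at 1. apply monE_neg_lt0.
  - intros m hm nm. destruct (Req_dec_T (lg d m) 0) as [e|e].
    + destruct (Req_dec_T (logmon M m) 0) as [e'|e'].
      * assert (m = mon0) as -> by (apply (mono_supp (ln c)); lra). apply monE_neg_lt0.
      * apply logmon_supp in e' as (i & hi & ->).
        assert (k < i)%nat by (destruct (lt_eq_lt_dec i k) as [[?| ->]|?]; [now rewrite z in hi|easy|easy]).
        apply monE_neg_lt.
        -- intros j hj. unfold monE. destruct (Nat.eqb_spec j (S i)); [lia|easy].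
        -- unfold monE. destruct (Nat.eqb_spec (S k) (S i)); [lia|lra].
    + eapply mon_lt_trans; [apply monE_neg_lt0|auto].
Qed.

Lemma nf_scale J G c M d a : a <> 0 -> nf J G c M d -> nf J (sscale a G) (a * c) M d.
Proof.
  intros n (h1 & h2 & h3 & ->). split; [easy|split; [|split; [easy|]]].
  - now apply Rmult_integral_contrapositive_currified.
  - now rewrite <- smul_scale, sscale_mono.
Qed.

Lemma ell_nf J G c M d k : nf (S J) G c M d -> depth_le J M -> (forall i, (i < k)%nat -> M i = 0) -> 0 < M k ->
  exists e, nf (S J) (ell_comp G) (/ M k) (monE (S k) 1) e.
Proof.
  intros h hM z n.
  destruct (lead_nf (S J) (slog G) _ _ (slog_in _ _ _ _ _ h hM) (slog_lead J G c M d k h hM z ltac:(lra))) as [e he].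
  exists (ssub (geo e) one). apply nf_sinv in he. apply (nf_scale _ _ _ _ _ (-1)) in he; [|lra].
  replace (/ M k) with (-1 * / - M k) by (field; lra).
  replace (monE (S k) 1) with (monS (-1) (monE (S k) (-1))); [easy|].
  apply functional_extensionality. intro i. unfold monS, monE. destruct (Nat.eqb i (S k)); ring.
Qed.

(** The form in which [ell_comp] enters the identities for composition and derivation: an equation
    between products survives both operations. *)
Lemma ell_slog J G c M d k : nf (S J) G c M d -> depth_le J M -> (forall i, (i < k)%nat -> M i = 0) -> 0 < M k ->
  smul (slog G) (ell_comp G) = sopp one.
Proof.
  intros h hM z n.
  destruct (lead_nf (S J) (slog G) _ _ (slog_in _ _ _ _ _ h hM) (slog_lead J G c M d k h hM z ltac:(lra))) as [e he].
  unfold ell_comp, sopp. rewrite smul_comm, smul_scale, smul_comm. f_equal. now apply (sinv_mul _ _ _ _ _ he).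
Qed.

(** * Composition *)

(* The depth of the leading monomial is one less than that of the series, so that
   [log H], hence every [l_k o H] with [k <= S J], still has depth at most [S J]. *)
Definition cls (J : nat) (H : ser) (c : R) (M : mon) : Prop :=
  0 < c /\ 0 < M 0%nat /\ depth_le J M /\ exists d, nf (S J) H c M d.

Lemma cls_weaken J J' H c M : (J <= J')%nat -> cls J H c M -> cls J' H c M.
Proof.
  intros l (h1 & h2 & h3 & d & h4). split; [easy|split; [easy|split; [now apply (depth_le_mono J)|]]].
  exists d. apply (nf_weaken (S J)); [lia|easy].
Qed.

(* Leading coefficient and leading monomial of [l_k o H], for [H] with leading term [c M]. *)
Definition lc (c : R) (M : mon) (k : nat) : R := match k with 0%nat => c | 1%nat => / M 0%nat | _ => 1 end.
Definition lm (M : mon) (k : nat) : mon := match k with 0%nat => M | S _ => monE k 1 end.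

Lemma lc_pos J H c M k : cls J H c M -> 0 < lc c M k.
Proof.
  intros (h1 & h2 & _). destruct k as [|[|k]]; simpl; [easy|now apply Rinv_0_lt_compat|lra].
Qed.

Lemma lm_first J H c M k : cls J H c M -> (forall i, (i < k)%nat -> lm M k i = 0) /\ 0 < lm M k k.
Proof.
  intros (h1 & h2 & _). destruct k as [|k]; simpl; [split; [intros; lia|easy]|].
  unfold monE. rewrite Nat.eqb_refl. split; [|lra]. intros i hi. destruct (Nat.eqb_spec i (S k)); [lia|easy].
Qed.

Lemma lm_depth J H c M k : cls J H c M -> (k <= J)%nat -> depth_le J (lm M k).
Proof. intros (_ & _ & h & _) l. destruct k; simpl; [easy|now apply depth_leE]. Qed.

Lemma Lk_nf J H c M k : cls J H c M -> (k <= S J)%nat -> exists d, nf (S J) (Lk H k) (lc c M k) (lm M k) d.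
Proof.
  intros h. induction k as [|k IH]; intros l; [apply h|].
  destruct (IH ltac:(lia)) as [d hd]. destruct (lm_first J H c M k h) as [z p].
  destruct (ell_nf J _ _ _ d k hd (lm_depth J H c M k h ltac:(lia)) z p) as [e he].
  exists e. replace (lc c M (S k)) with (/ lm M k k); [exact he|].
  destruct k as [|k]; simpl; [easy|]. unfold monE. rewrite Nat.eqb_refl. field.
Qed.

(* [comp_mon] with an explicit list of indices: [mdepth m] is an arbitrary depth bound of [m]. *)
Definition cml (H : ser) (l : list nat) (m : mon) : ser :=
  fold_right (fun k acc => smul (rpow (Lk H k) (m k)) acc) one l.

Lemma cml_zero H l m : (forall k, In k l -> m k = 0) -> cml H l m = one.
Proof.
  induction l as [|k l IH]; intros h; simpl; [easy|].
  rewrite h, rpow_0, smul_one by now left. apply IH. intros; apply h; now right.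
Qed.

Lemma cml_app H l l' m : (forall k, In k l' -> m k = 0) -> cml H (l ++ l') m = cml H l m.
Proof.
  intros h. unfold cml at 1. rewrite fold_right_app. fold (cml H l' m). now rewrite cml_zero.
Qed.

Lemma cml_seq H n n' m : (n <= n')%nat -> (forall k, (n <= k)%nat -> m k = 0) -> cml H (seq 0 n') m = cml H (seq 0 n) m.
Proof.
  intros l h. replace n' with (n + (n' - n))%nat by lia. rewrite seq_app. apply cml_app.
  intros k hk. apply in_seq in hk. apply h. lia.
Qed.

Lemma mdepth_le J m : depth_le J m -> depth_le (mdepth m) m.
Proof.
  intros h. unfold mdepth. destruct (excluded_middle_informative _) as [E|n]; [|elim n; eauto].
  now destruct (constructive_indefinite_description _ E).
Qed.

(** Factors beyond the depth of [m] are zeroth powers, equal to 1, so every depth bound gives the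
    same product. *)
Lemma comp_mon_cml J H m : depth_le J m -> comp_mon H m = cml H (seq 0 (S J)) m.
Proof.
  intros h. pose proof (mdepth_le J m h) as h'. change (comp_mon H m) with (cml H (seq 0 (S (mdepth m))) m).
  rewrite <- (cml_seq H (S (mdepth m)) (S (Nat.max J (mdepth m)))), <- (cml_seq H (S J) (S (Nat.max J (mdepth m)))); try lia; auto.
Qed.

(* Leading monomial of [cml H l m]. *)
Definition lmsum (M : mon) (l : list nat) (m : mon) : mon := fold_right (fun k acc => monD (monS (m k) (lm M k)) acc) mon0 l.

Lemma lmsum_seq M m a n i : lmsum M (seq (S a) n) m i = if ((a <? i) && (i <? S a + n))%nat%bool then m i else 0.
Proof.
  revert a. induction n as [|n IH]; intro a; simpl.
  - destruct (Nat.ltb_spec a i), (Nat.ltb_spec i (S (a + 0))); simpl; unfold mon0; try lia; easy.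
  - unfold monD at 1. unfold monS, monE. rewrite IH.
    destruct (Nat.ltb_spec (S a) i), (Nat.ltb_spec a i), (Nat.ltb_spec i (S (S a) + n)), (Nat.ltb_spec i (S (a + S n))), (Nat.eqb_spec i (S a)); simpl; try lia; subst; try ring.
Qed.

Lemma lmsum_tau J M m : depth_le J M -> depth_le J m -> lmsum M (seq 0 (S J)) m = tau M m.
Proof.
  intros h h'. apply functional_extensionality. intro i.
  change (monD (monS (m 0%nat) M) (lmsum M (seq 1 J) m) i = tau M m i). unfold monD. rewrite lmsum_seq.
  unfold tau, monS. destruct i as [|i]; [simpl; ring|].
  change (0 <? S i)%nat with true. rewrite Bool.andb_true_l.
  destruct (Nat.ltb_spec (S i) (1 + J)); [ring|]. rewrite (h (S i)), (h' (S i)) by lia. ring.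
Qed.

Lemma cml_nf J H c M l m : cls J H c M -> (forall k, In k l -> (k <= S J)%nat) -> depth_le (S J) m ->
  exists u d, 0 < u /\ nf (S J) (cml H l m) u (lmsum M l m) d.
Proof.
  intros h hl hm. induction l as [|k l IH]; simpl.
  - exists 1, szero. split; [lra|]. split; [auto with dep|split; [lra|split; [apply small_zero|]]].
    fold one. rewrite smul_one. apply functional_extensionality. intro. unfold sadd, szero. ring.
  - destruct IH as (u & d & p & hd); [intros; apply hl; now right|].
    destruct (Lk_nf J H c M k h) as [e he]; [apply hl; now left|].
    eexists _, _. split; [|apply nf_mul; [apply nf_rpow, he|exact hd]].
    apply Rmult_lt_0_compat; [apply exp_pos|easy].
Qed.

Lemma cml_add J H c M l m n : cls J H c M -> (forall k, In k l -> (k <= S J)%nat) -> depth_le (S J) m -> depth_le (S J) n ->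
  cml H l (monD m n) = smul (cml H l m) (cml H l n).
Proof.
  intros h hl hm hn. induction l as [|k l IH]; simpl.
  - now rewrite smul_one.
  - rewrite IH by (intros; apply hl; now right).
    destruct (cml_nf J H c M l m h) as (? & ? & _ & A%nf_in); [intros; apply hl; now right|easy|].
    destruct (cml_nf J H c M l n h) as (? & ? & _ & B%nf_in); [intros; apply hl; now right|easy|].
    destruct (Lk_nf J H c M k h) as [e he]; [apply hl; now left|].
    assert (A' := nf_in _ _ _ _ _ (nf_rpow _ _ _ _ _ (m k) he)).
    assert (B' := nf_in _ _ _ _ _ (nf_rpow _ _ _ _ _ (n k) he)).
    unfold monD at 1. rewrite (rpow_add _ _ _ _ _ _ _ he). sring.
Qed.

(** One set [S0] serves all [m]: a real exponent changes the coefficients of [(1 + e)^a], while its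
    support stays in [star (supp e)]. This uniformity is what makes composition tame. *)
Lemma cml_supp J H c M l : cls J H c M -> (forall k, In k l -> (k <= S J)%nat) ->
  exists S0, good (S J) S0 /\ (forall s, S0 s -> mon_le mon0 s) /\
    forall m m', cml H l m m' <> 0 -> exists s, S0 s /\ m' = monD (lmsum M l m) s.
Proof.
  intros h hl. induction l as [|k l IH].
  - exists (fun s => s = mon0). split; [apply good_single; auto with dep|split].
    + intros s ->. now left.
    + intros m m' hm. simpl in hm. apply mono_supp in hm. exists mon0. split; [easy|]. rewrite hm. symmetry. apply monD0.
  - destruct IH as (S0 & g & p & hs); [intros; apply hl; now right|].
    destruct (Lk_nf J H c M k h) as [e he]; [apply hl; now left|].
    pose proof he as (h1 & h2 & h3 & h4). pose proof (star_good (S J) (supp e) (proj1 h3) (proj2 h3)) as [gs _].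
    exists (sumset (star (supp e)) S0). split; [now apply good_sumset|split].
    + intros s (a & b & [n ha] & hb & ->). rewrite <- (monD0 mon0). apply mon_le_add2; [|auto].
      apply (npow_nonneg (supp e) n); [|easy]. intros x hx. right. now apply h3.
    + intros m m' hm. simpl in hm. apply smul_supp in hm as (a & b & ha & hb & ->).
      destruct (hs m b hb) as (s & h0 & ->). unfold supp in ha.
      rewrite (rpow_nf _ _ _ _ _ _ he) in ha.
      apply smul_supp in ha as (x & y & hx & hy & ->). apply mono_supp in hx as ->. apply ps_supp in hy.
      exists (monD y s). split; [exists y, s; auto|]. simpl. mon_ext.
Qed.

Lemma seq_le J k : In k (seq 0 (S (S J))) -> (k <= S J)%nat.
Proof. intros h. apply in_seq in h. lia. Qed.

Lemma depth_S J m : depth_le J m -> depth_le (S J) m.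
Proof. apply depth_le_mono. lia. Qed.

Lemma comp_mon_nf J H c M m : cls J H c M -> depth_le (S J) m ->
  exists u d, 0 < u /\ nf (S J) (comp_mon H m) u (tau M m) d.
Proof.
  intros h hm. destruct (cml_nf J H c M (seq 0 (S (S J))) m h (seq_le J) hm) as (u & d & p & hd).
  exists u, d. split; [easy|]. rewrite (comp_mon_cml (S J)) by easy. rewrite lmsum_tau in hd; try easy. apply depth_S, h.
Qed.

Lemma comp_mon_add J H c M m n : cls J H c M -> depth_le (S J) m -> depth_le (S J) n ->
  comp_mon H (monD m n) = smul (comp_mon H m) (comp_mon H n).
Proof.
  intros h hm hn. rewrite !(comp_mon_cml (S J)) by auto with dep. apply (cml_add J H c M); auto. apply seq_le.
Qed.

Lemma comp_mon_supp J H c M : cls J H c M ->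
  exists S0, good (S J) S0 /\ (forall s, S0 s -> mon_le mon0 s) /\
    forall m, depth_le (S J) m -> forall m', comp_mon H m m' <> 0 -> exists s, S0 s /\ m' = monD (tau M m) s.
Proof.
  intros h. destruct (cml_supp J H c M (seq 0 (S (S J))) h (seq_le J)) as (S0 & g & p & hs).
  exists S0. split; [easy|split; [easy|]]. intros m hm m'. rewrite (comp_mon_cml (S J)) by easy.
  rewrite <- (lmsum_tau (S J)); auto. apply depth_S, h.
Qed.

(** [tau M] is injective and preserves good sets, so both summability conditions reduce to those of
    a sumset. *)
Lemma tame_tau J M S0 (K : mon -> ser) : 0 < M 0%nat -> depth_le J M -> good J S0 ->
  (forall m, depth_le J m -> forall m', K m m' <> 0 -> exists s, S0 s /\ m' = monD (tau M m) s) -> tame J K.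
Proof.
  intros p hM gS h A gA. pose proof (good_tau J M A p hM gA) as gT. split.
  - apply (good_sub J _ _ (good_sumset J _ _ gT gS)). intros m' (m & hm & n).
    destruct (h m (proj1 gA m hm) m' n) as (s & hs & ->). exists (tau M m), s. eauto.
  - intro m'. apply (finite_sub _ _ (finite_image (fun q => tau (tinv M) (fst q)) _ (sumset_finite J _ _ m' gT gS))).
    intros m (hm & n). destruct (h m (proj1 gA m hm) m' n) as (s & hs & ->).
    exists (tau M m, s). simpl. rewrite tinv_tau by lra. eauto 6.
Qed.

Lemma comp_mon_tame J H c M : cls J H c M -> tame (S J) (comp_mon H).
Proof.
  intros h. destruct (comp_mon_supp J H c M h) as (S0 & g & _ & hs).
  apply (tame_tau (S J) M S0); auto; [apply h|apply depth_S, h].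
Qed.

Lemma comp_mon_0 H : comp_mon H mon0 = one.
Proof. rewrite (comp_mon_cml 0) by auto with dep. now apply cml_zero. Qed.

Lemma comp_mon_E J H c M k r : cls J H c M -> (k <= S J)%nat -> comp_mon H (monE k r) = rpow (Lk H k) r.
Proof.
  intros h l. rewrite (comp_mon_cml k) by now apply depth_leE. rewrite seq_S.
  unfold cml. rewrite fold_right_app. simpl. unfold monE at 2. rewrite Nat.eqb_refl.
  rewrite (smul_comm _ one), smul_one.
  assert (G : forall l a, (forall i, In i l -> (i < k)%nat) ->
    fold_right (fun k0 acc => smul (rpow (Lk H k0) (monE k r k0)) acc) a l = a).
  { induction l0 as [|i l0 IH]; intros a hl; simpl; [easy|].
    rewrite IH by (intros; apply hl; now right). unfold monE.
    assert (i < k)%nat by (apply hl; now left).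
    destruct (Nat.eqb_spec i k); [lia|]. now rewrite rpow_0, smul_one. }
  apply G. intros i hi. apply in_seq in hi. lia.
Qed.

Lemma comp_mon_E1 J H c M k : cls J H c M -> (k <= S J)%nat -> comp_mon H (monE k 1) = Lk H k.
Proof.
  intros h l. rewrite (comp_mon_E J H c M) by easy. destruct (Lk_nf J H c M k h l) as [d hd].
  apply (rpow_1 _ _ _ _ _ hd). now apply (lc_pos J H).
Qed.

Lemma comp_ok_cls J F H c M : cls J H c M -> in_Linf (S J) F -> comp_ok F H.
Proof.
  intros h f. pose proof h as (h1 & h2 & h3 & d & h4). split; [|split].
  - exists (S J). now apply nf_in in h4.
  - exists c, M. split; [now apply (nf_lead _ _ _ _ _ h4)|split; [easy|]]. exists 0%nat. split; [intros; lia|easy].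
  - destruct (comp_mon_tame J H c M h (supp F) f) as [g fin]. split.
    + intro m. destruct (finite_nodup (fun i => comp_family F H i m <> 0)) as [l [nd hl]].
      * apply (finite_sub _ _ (fin m)). intros i hi. now apply prod_neq0 in hi.
      * exists l. split; auto.
    + exists (S J). apply (good_sub (S J) _ _ g). intros m hm.
      destruct (excluded_middle_informative _) as [(i & hi)|]; [|easy]. exists i. now apply prod_neq0 in hi.
Qed.

Lemma scomp_in J F H c M : cls J H c M -> in_Linf (S J) F -> in_Linf (S J) (scomp F H).
Proof. intros h f. apply (tame_in (S J) (comp_mon H) F); [now apply (comp_mon_tame J H c M)|easy]. Qed.

(** * Composition is a ring morphism compatible with powers and logarithms *)

(** [op_op] applied in each argument in turn reduces the claim to a pair of monomials. *)
Lemma op_mul J K A B : tame J K ->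
  (forall a b, depth_le J a -> depth_le J b -> K (monD a b) = smul (K a) (K b)) ->
  in_Linf J A -> in_Linf J B -> op K (smul A B) = smul (op K A) (op K B).
Proof.
  intros t h hA hB. assert (hKB := tame_in J K B t hB).
  rewrite (smul_op A B), (op_op J) by auto with linf.
  rewrite (smul_op (op K A)), (op_op J); [|now apply t|now apply tame_sh].
  apply op_ext. intros a na. assert (da : depth_le J a) by now apply hA.
  assert (hKa := tame_mono_in J K a da t).
  unfold sh at 1. rewrite smul_comm, smul_op, (op_op J); [|apply sfam_tame; auto with linf|easy].
  rewrite <- (smul_op (K a)), smul_comm, smul_op, (op_op J); [|now apply t|now apply tame_sh].
  apply op_ext. intros b nb. assert (db : depth_le J b) by now apply hB.
  unfold sh at 1. rewrite smul_mono, Rmult_1_l, op_mono, <- smul_op, h by easy.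
  apply functional_extensionality. intro m. unfold sscale. ring.
Qed.

Lemma op_pow J K A n : tame J K -> K mon0 = one ->
  (forall a b, depth_le J a -> depth_le J b -> K (monD a b) = smul (K a) (K b)) ->
  in_Linf J A -> op K (spow A n) = spow (op K A) n.
Proof.
  intros t e h hA. induction n as [|n IH]; simpl.
  - unfold one at 1. rewrite op_mono, e. apply functional_extensionality. intro. unfold sscale. ring.
  - rewrite (op_mul J), IH by auto with linf. easy.
Qed.

Lemma scomp_op F H : scomp F H = op (comp_mon H) F.
Proof. reflexivity. Qed.

Lemma scomp_mul J H c M A B : cls J H c M -> in_Linf (S J) A -> in_Linf (S J) B ->
  scomp (smul A B) H = smul (scomp A H) (scomp B H).
Proof.
  intros h hA hB. rewrite !scomp_op. apply (op_mul (S J)); auto; [now apply (comp_mon_tame J H c M)|].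
  intros a b ha hb. now apply (comp_mon_add J H c M).
Qed.

Lemma scomp_add J H c M A B : cls J H c M -> in_Linf (S J) A -> in_Linf (S J) B ->
  scomp (sadd A B) H = sadd (scomp A H) (scomp B H).
Proof.
  intros h hA hB. rewrite !scomp_op. apply (op_add (S J)); now apply (comp_mon_tame J H c M).
Qed.

Lemma scomp_scale a A H : scomp (sscale a A) H = sscale a (scomp A H).
Proof. apply op_scale. Qed.

Lemma scomp_mono a m H : scomp (mono a m) H = sscale a (comp_mon H m).
Proof. apply op_mono. Qed.

Lemma sscale_1 F : sscale 1 F = F.
Proof. apply functional_extensionality. intro. unfold sscale. ring. Qed.

Lemma scomp_one H : scomp one H = one.
Proof. unfold one at 1. now rewrite scomp_mono, comp_mon_0, sscale_1. Qed.

Lemma scomp_const a H : scomp (mono a mon0) H = mono a mon0.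
Proof. rewrite scomp_mono, comp_mon_0. unfold one. now rewrite sscale_mono, Rmult_1_r. Qed.

Lemma scomp_small J H c M d : cls J H c M -> small (S J) d -> small (S J) (scomp d H).
Proof.
  intros h [hd p]. split; [now apply (scomp_in J d H c M)|]. intros m hm. rewrite scomp_op in hm.
  apply op_supp in hm as (a & ha & hm). destruct (comp_mon_supp J H c M h) as (S0 & _ & q & hs).
  destruct (hs a (proj1 hd a ha) m hm) as (s & h0 & ->). rewrite <- (monD0 mon0).
  eapply mon_lt_le_trans; [apply mon_lt_add|apply mon_le_add2; [now left|apply q, h0]].
  replace mon0 with (tau M mon0); [apply tau_lt; [apply h|now apply p]|].
  apply functional_extensionality. intros [|k]; unfold tau, mon0; ring.
Qed.

Lemma scomp_ps J H c M d a : cls J H c M -> small (S J) d -> scomp (ps a d) H = ps a (scomp d H).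
Proof.
  intros h hd. assert (t := comp_mon_tame J H c M h). rewrite scomp_op. unfold ps. rewrite (op_op (S J)) by auto with linf.
  apply op_ext. intros n _. apply (op_pow (S J)); auto with linf; [apply comp_mon_0|].
  intros x y hx hy. now apply (comp_mon_add J H c M).
Qed.

Lemma ps_szero c : ps c szero = mono (c 0%nat) mon0.
Proof.
  rewrite (ps_decomp 0) by apply small_zero. assert (A := in_zero 0). assert (B := ps_in 0 (fun n => c (S n)) szero (small_zero 0)).
  assert (D := in_mono 0 (c 0%nat) mon0 (depth_le0 0)). sring.
Qed.

Lemma mono_nf J c M : c <> 0 -> depth_le J M -> nf J (mono c M) c M szero.
Proof.
  intros n h. split; [easy|split; [easy|split; [apply small_zero|]]].
  assert (A := in_mono J c M h). sring.
Qed.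

Lemma Rpower_1l a : Rpower 1 a = 1.
Proof. unfold Rpower. now rewrite ln_1, Rmult_0_r, exp_0. Qed.

Lemma logmon_0 : logmon mon0 = szero.
Proof.
  apply functional_extensionality. intro m. apply NNPP. intro h. apply logmon_supp in h as (k & hk & _). now elim hk.
Qed.

Lemma one_add_nf J d : small J d -> nf J (sadd one d) 1 mon0 d.
Proof.
  intros h. split; [auto with dep|split; [lra|split; [easy|]]]. fold one. now rewrite smul_one.
Qed.

Lemma mono_0 M : mono 0 M = szero.
Proof. apply functional_extensionality. intro m. unfold mono, szero. now destruct (excluded_middle_informative _). Qed.

Lemma sadd_0l F : sadd szero F = F.
Proof. apply functional_extensionality. intro. unfold sadd, szero. ring. Qed.
Lemma sadd_0r F : sadd F szero = F.
Proof. apply functional_extensionality. intro. unfold sadd, szero. ring. Qed.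

Lemma slog_one_add J d : small J d -> slog (sadd one d) = lg d.
Proof.
  intros h. rewrite (slog_nf _ _ _ _ _ (one_add_nf J d h)), ln_1, mono_0, logmon_0. now rewrite !sadd_0l.
Qed.

Lemma rpow_one_add J d a : small J d -> rpow (sadd one d) a = pw d a.
Proof.
  intros h. rewrite (rpow_nf _ _ _ _ _ _ (one_add_nf J d h)), Rpower_1l.
  replace (monS a mon0) with mon0 by mon_ext. apply smul_one.
Qed.

Lemma rpow_one a : rpow one a = one.
Proof. unfold one. rewrite (rpow_nf _ _ _ _ _ _ (mono_nf 0 1 mon0 R1_neq_R0 (depth_le0 0))), Rpower_1l.
  replace (monS a mon0) with mon0 by mon_ext. unfold pw. rewrite ps_szero, gbinom_0. apply smul_one.
Qed.

Lemma slog_mono J c M : c <> 0 -> depth_le J M -> slog (mono c M) = sadd (mono (ln c) mon0) (logmon M).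
Proof.
  intros n h. rewrite (slog_nf _ _ _ _ _ (mono_nf J c M n h)). unfold lg. rewrite ps_szero, mono_0. apply sadd_0r.
Qed.

Lemma cml_rpow J H c M l m a : cls J H c M -> (forall k, In k l -> (k <= S J)%nat) -> depth_le (S J) m ->
  rpow (cml H l m) a = cml H l (monS a m).
Proof.
  intros h hl hm. induction l as [|k l IH]; simpl; [apply rpow_one|].
  destruct (cml_nf J H c M l m h) as (u & d & p & hd); [intros; apply hl; now right|easy|].
  destruct (Lk_nf J H c M k h) as [e he]; [apply hl; now left|].
  rewrite (rpow_mul _ _ _ _ _ _ _ _ _ a (nf_rpow _ _ _ _ _ (m k) he) hd (exp_pos _) p).
  rewrite (rpow_rpow _ _ _ _ _ _ _ he), IH by (intros; apply hl; now right). unfold monS at 2. now rewrite Rmult_comm.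
Qed.

Lemma slog_one : slog one = szero.
Proof. unfold one. rewrite (slog_mono 0) by (auto with dep; lra). now rewrite ln_1, mono_0, logmon_0, sadd_0l. Qed.

Lemma slog_cml J H c M k l m : cls J H c M -> (forall k', In k' (k :: l) -> (k' <= S J)%nat) -> depth_le (S J) m ->
  slog (cml H (k :: l) m) = sadd (sscale (m k) (slog (Lk H k))) (slog (cml H l m)).
Proof.
  intros h hl hm. simpl.
  destruct (cml_nf J H c M l m h) as (u & d & p & hd); [intros; apply hl; now right|easy|].
  destruct (Lk_nf J H c M k h) as [e he]; [apply hl; now left|].
  rewrite (slog_mul _ _ _ _ _ _ _ _ _ (nf_rpow _ _ _ _ _ (m k) he) hd (exp_pos _) p).
  now rewrite (slog_rpow _ _ _ _ _ _ he).
Qed.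

Lemma Lk_slog J H c M k : cls J H c M -> (k <= J)%nat -> smul (slog (Lk H k)) (Lk H (S k)) = sopp one.
Proof.
  intros h l. destruct (Lk_nf J H c M k h) as [e he]; [lia|]. destruct (lm_first J H c M k h) as [z p].
  apply (ell_slog J _ _ _ e k he (lm_depth J H c M k h l) z p).
Qed.

Lemma Lk_slog_in J H c M k : cls J H c M -> (k <= J)%nat -> in_Linf (S J) (slog (Lk H k)).
Proof.
  intros h l. destruct (Lk_nf J H c M k h) as [e he]; [lia|].
  apply (slog_in _ _ _ _ _ he), (lm_depth J H c M k h l).
Qed.

Lemma Lk_in J H c M k : cls J H c M -> (k <= S J)%nat -> in_Linf (S J) (Lk H k).
Proof. intros h l. destruct (Lk_nf J H c M k h l) as [e he]. now apply nf_in in he. Qed.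

(** The relation [1/l_{k+1} = - log l_k] after composition; through it [logmon], a combination of
    the [1/l_{k+1}], composes to a logarithm. *)
Lemma Lk_inv J H c M k : cls J H c M -> (k <= J)%nat -> rpow (Lk H (S k)) (-1) = sopp (slog (Lk H k)).
Proof.
  intros h l. assert (A := Lk_slog_in J H c M k h l). assert (E := Lk_slog J H c M k h l).
  assert (B := Lk_in J H c M (S k) h ltac:(lia)).
  destruct (Lk_nf J H c M (S k) h) as [e he]; [lia|].
  assert (P := nf_in _ _ _ _ _ (nf_rpow _ _ _ _ _ (-1) he)).
  assert (E1 : smul (rpow (Lk H (S k)) (-1)) (Lk H (S k)) = one).
  { rewrite <- (rpow_1 _ _ _ _ _ he (lc_pos J H c M (S k) h)) at 2. rewrite <- (rpow_add _ _ _ _ _ _ _ he).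
    replace (-1 + 1) with 0 by ring. apply rpow_0. }
  transitivity (sopp (smul (rpow (Lk H (S k)) (-1)) (sopp one))); [sring|]. rewrite <- E.
  transitivity (sopp (smul (slog (Lk H k)) (smul (rpow (Lk H (S k)) (-1)) (Lk H (S k))))); [sring|]. rewrite E1. sring.
Qed.

Definition logl (l : list nat) (M : mon) : ser :=
  fold_right (fun k acc => sadd (mono (- M k) (monE (S k) (-1))) acc) szero l.

Lemma logl_logmon J M : depth_le J M -> logmon M = logl (seq 0 (S J)) M.
Proof.
  intros h. apply functional_extensionality. intro m. unfold logmon, ssum.
  rewrite (fsumR_list _ (seq 0 (S J)) (seq_NoDup _ _)).
  - generalize (seq 0 (S J)). induction l as [|k l IH]; simpl; [easy|]. unfold sadd at 1. now rewrite <- IH.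
  - intros k hk. apply in_seq. cut (~ (J < k)%nat); [lia|]. intro l. apply hk. rewrite h by easy.
    replace (-0) with 0 by ring. now rewrite mono_0.
Qed.

Lemma logl_in J l M : (forall k, In k l -> (k <= J)%nat) -> in_Linf (S J) (logl l M).
Proof.
  intros h. induction l as [|k l IH]; simpl; [auto with linf|].
  apply in_add; [apply in_mono, depth_leE; specialize (h k (or_introl eq_refl)); lia|].
  apply IH. intros; apply h; now right.
Qed.

Lemma szero_op {I : Type} (K : I -> ser) : op K (fun _ => 0) = szero.
Proof. apply functional_extensionality. intro m. apply fsumR_zero. intro; ring. Qed.

Lemma scomp_logl J H c M l N : cls J H c M -> (forall k, In k l -> (k <= J)%nat) -> depth_le J N ->
  scomp (logl l N) H = slog (cml H l N).
Proof.
  intros h hl hN. induction l as [|k l IH].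
  - simpl. rewrite slog_one. apply szero_op.
  - assert (hk : (k <= J)%nat) by (apply hl; now left).
    rewrite (slog_cml J H c M) by (auto; try (intros k' h'; apply hl in h'; lia); now apply depth_S).
    rewrite <- IH by (intros; apply hl; now right).
    change (logl (k :: l) N) with (sadd (mono (- N k) (monE (S k) (-1))) (logl l N)).
    rewrite (scomp_add J H c M); [|easy|apply in_mono, depth_leE; lia|apply logl_in; intros; apply hl; now right].
    f_equal. rewrite scomp_mono, (comp_mon_E J H c M), (Lk_inv J H c M) by (auto; lia).
    apply functional_extensionality. intro. unfold sopp, sscale. ring.
Qed.

Lemma scomp_logmon J H c M N : cls J H c M -> depth_le J N -> scomp (logmon N) H = slog (comp_mon H N).
Proof.
  intros h hN. rewrite (logl_logmon J), (comp_mon_cml J) by easy. apply (scomp_logl J H c M); auto.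
  intros k hk. apply in_seq in hk. lia.
Qed.

Lemma scomp_nf_eq J H c M G c0 M0 d0 : cls J H c M -> nf (S J) G c0 M0 d0 ->
  scomp G H = smul (mono c0 mon0) (smul (comp_mon H M0) (sadd one (scomp d0 H))).
Proof.
  intros h (h1 & h2 & h3 & ->). rewrite (scomp_mul J H c M) by auto with linf.
  rewrite (scomp_add J H c M), scomp_one, scomp_mono by auto with linf.
  now rewrite smul_scale, sscale_mul.
Qed.

Lemma scomp_nf J H c M G c0 M0 d0 : cls J H c M -> nf (S J) G c0 M0 d0 -> 0 < c0 ->
  exists c1 d1, 0 < c1 /\ nf (S J) (scomp G H) c1 (tau M M0) d1.
Proof.
  intros h hG p. destruct (comp_mon_nf J H c M M0 h (proj1 hG)) as (u & e & pu & he).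
  rewrite (scomp_nf_eq J H c M G c0 M0 d0 h hG). pose proof hG as (h1 & h2 & h3 & _).
  assert (N := nf_mul _ _ _ _ _ _ _ _ _ he (one_add_nf _ _ (scomp_small J H c M d0 h h3))).
  apply (nf_mul _ _ _ _ _ _ _ _ _ (mono_nf (S J) c0 mon0 h2 (depth_le0 _))) in N.
  rewrite mon0D, monD0 in N. eexists _, _. split; [|exact N]. 
  repeat apply Rmult_lt_0_compat; auto; lra.
Qed.

(** Split [G] into constant, monomial and [1 + d0]. Powers of the monomial part are handled by
    [cml_rpow], those of [1 + d0] by substitution in power series, and [rpow_mul] reassembles them;
    positivity is needed for the last step. [scomp_slog] follows the same splitting. *)
Lemma scomp_rpow J H c M G c0 M0 d0 a : cls J H c M -> nf (S J) G c0 M0 d0 -> 0 < c0 ->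
  scomp (rpow G a) H = rpow (scomp G H) a.
Proof.
  intros h hG p. destruct (comp_mon_nf J H c M M0 h (proj1 hG)) as (u & e & pu & he).
  rewrite (scomp_nf_eq J H c M G c0 M0 d0 h hG). pose proof hG as (h1 & h2 & h3 & _).
  assert (hd := scomp_small J H c M d0 h h3). assert (N2 := one_add_nf _ _ hd).
  assert (N1 := nf_mul _ _ _ _ _ _ _ _ _ he N2).
  assert (N0 := mono_nf (S J) c0 mon0 h2 (depth_le0 _)).
  rewrite (rpow_mul _ _ _ _ _ _ _ _ _ a N0 N1) by (auto; nra).
  rewrite (rpow_mul _ _ _ _ _ _ _ _ _ a he N2) by (auto; lra).
  rewrite (rpow_one_add (S J)) by easy.
  rewrite (rpow_nf _ _ _ _ _ a N0). unfold pw at 1. rewrite ps_szero, gbinom_0.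
  replace (monS a mon0) with mon0 by mon_ext. rewrite smul_mono, Rmult_1_r, monD0.
  rewrite (comp_mon_cml (S J) H M0), (cml_rpow J H c M), <- (comp_mon_cml (S J)) by (auto with dep; apply seq_le).
  rewrite (rpow_nf _ _ _ _ _ a hG), (scomp_mul J H c M) by auto with linf.
  unfold pw. rewrite (scomp_ps J H c M), scomp_mono, sscale_mul by easy.
  assert (A1 := in_mono (S J) (Rpower c0 a) mon0 (depth_le0 _)).
  assert (A2 := tame_mono_in (S J) _ (monS a M0) ltac:(auto with dep) (comp_mon_tame J H c M h)).
  assert (A3 := ps_in (S J) (gbinom a) _ hd). sring.
Qed.

Lemma scomp_slog J H c M G c0 M0 d0 : cls J H c M -> nf (S J) G c0 M0 d0 -> 0 < c0 -> depth_le J M0 ->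
  scomp (slog G) H = slog (scomp G H).
Proof.
  intros h hG p hM. destruct (comp_mon_nf J H c M M0 h (proj1 hG)) as (u & e & pu & he).
  rewrite (scomp_nf_eq J H c M G c0 M0 d0 h hG). pose proof hG as (h1 & h2 & h3 & _).
  assert (hd := scomp_small J H c M d0 h h3). assert (N2 := one_add_nf _ _ hd).
  assert (N1 := nf_mul _ _ _ _ _ _ _ _ _ he N2).
  assert (N0 := mono_nf (S J) c0 mon0 h2 (depth_le0 _)).
  rewrite (slog_mul _ _ _ _ _ _ _ _ _ N0 N1) by (auto; nra).
  rewrite (slog_mul _ _ _ _ _ _ _ _ _ he N2) by (auto; lra).
  rewrite (slog_one_add (S J)) by easy. rewrite (slog_mono 0) by auto with dep. rewrite logmon_0, sadd_0r.
  rewrite (slog_nf _ _ _ _ _ hG), !(scomp_add J H c M) by auto with linf.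
  rewrite scomp_const, (scomp_logmon J H c M) by easy. unfold lg. rewrite (scomp_ps J H c M) by easy.
  apply functional_extensionality. intro. unfold sadd. ring.
Qed.

Lemma tau_first M M0 k : 0 < M 0%nat -> (forall i, (i < k)%nat -> M0 i = 0) -> 0 < M0 k ->
  (forall i, (i < k)%nat -> tau M M0 i = 0) /\ 0 < tau M M0 k.
Proof.
  intros p z q. destruct k as [|k].
  - split; [intros; lia|]. simpl. now apply Rmult_lt_0_compat.
  - split.
    + intros [|i] hi; simpl; rewrite ?(z 0%nat), ?(z (S i)) by lia; ring.
    + simpl. rewrite (z 0%nat) by lia. lra.
Qed.

(** Both sides multiply [slog (scomp G H)] to -1, and an inverse is unique. *)
Lemma scomp_ell J H c M G c0 M0 d0 k : cls J H c M -> nf (S J) G c0 M0 d0 -> 0 < c0 -> depth_le J M0 ->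
  (forall i, (i < k)%nat -> M0 i = 0) -> 0 < M0 k ->
  scomp (ell_comp G) H = ell_comp (scomp G H).
Proof.
  intros h hG p hM z q.
  destruct (scomp_nf J H c M G c0 M0 d0 h hG p) as (c1 & d1 & p1 & N1).
  destruct (tau_first M M0 k ltac:(apply h) z q) as [z1 q1].
  assert (D1 : depth_le J (tau M M0)) by (apply tau_depth; [apply h|easy]).
  destruct (ell_nf J G c0 M0 d0 k hG hM z q) as [e E%nf_in].
  destruct (ell_nf J _ _ _ _ k N1 D1 z1 q1) as [e' E'%nf_in].
  assert (F := ell_slog J G c0 M0 d0 k hG hM z q).
  assert (F' := ell_slog J _ _ _ _ k N1 D1 z1 q1).
  apply (f_equal (fun A => scomp A H)) in F.
  rewrite (scomp_mul J H c M), (scomp_slog J H c M G c0 M0 d0) in F by (auto; now apply (slog_in _ _ _ _ _ hG)).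
  unfold sopp at 1 in F. rewrite scomp_scale, scomp_one in F. fold (sopp one) in F.
  assert (A := slog_in _ _ _ _ _ N1 D1). assert (B := scomp_in J _ H c M h E).
  transitivity (sopp (smul (scomp (ell_comp G) H) (sopp one))); [sring|]. rewrite <- F'.
  transitivity (sopp (smul (smul (slog (scomp G H)) (scomp (ell_comp G) H)) (ell_comp (scomp G H)))); [sring|].
  rewrite F. sring.
Qed.

Lemma scomp_cls J H c M G c0 M0 : cls J H c M -> cls J G c0 M0 -> exists c1, cls J (scomp G H) c1 (tau M M0).
Proof.
  intros h (p & q & D & d0 & hG). destruct (scomp_nf J H c M G c0 M0 d0 h hG p) as (c1 & d1 & p1 & N1).
  exists c1. split; [easy|split; [|split; [|eauto]]].
  - simpl. apply Rmult_lt_0_compat; [apply h|easy].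
  - apply tau_depth; [apply h|easy].
Qed.

Lemma scomp_Lk J H c M G c0 M0 k : cls J H c M -> cls J G c0 M0 -> (k <= S J)%nat -> scomp (Lk G k) H = Lk (scomp G H) k.
Proof.
  intros h hG. induction k as [|k IH]; intros l; [easy|].
  change (Lk G (S k)) with (ell_comp (Lk G k)). change (Lk (scomp G H) (S k)) with (ell_comp (Lk (scomp G H) k)).
  rewrite <- IH by lia. destruct (Lk_nf J G c0 M0 k hG ltac:(lia)) as [d hd].
  destruct (lm_first J G c0 M0 k hG) as [z q].
  apply (scomp_ell J H c M _ _ _ d k h hd (lc_pos J G c0 M0 k hG) (lm_depth J G c0 M0 k hG ltac:(lia)) z q).
Qed.

Lemma scomp_cml J H c M G c0 M0 l m : cls J H c M -> cls J G c0 M0 -> (forall k, In k l -> (k <= S J)%nat) -> depth_le (S J) m ->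
  scomp (cml G l m) H = cml (scomp G H) l m.
Proof.
  intros h hG hl hm. induction l as [|k l IH]; simpl; [apply scomp_one|].
  destruct (Lk_nf J G c0 M0 k hG) as [d hd]; [apply hl; now left|].
  destruct (cml_nf J G c0 M0 l m hG) as (u & e & _ & E%nf_in); [intros; apply hl; now right|easy|].
  rewrite (scomp_mul J H c M), IH; auto; [|intros; apply hl; now right|now apply (nf_in _ _ _ _ _ (nf_rpow _ _ _ _ _ (m k) hd))].
  rewrite (scomp_rpow J H c M _ _ _ _ _ h hd) by now apply (lc_pos J G). 
  rewrite (scomp_Lk J H c M G c0 M0); auto. apply hl; now left.
Qed.

(** Strong linearity reduces the claim to monomials of [F], where it says that composition with [H]
    respects products, powers and each [l_k]. *)
Theorem scomp_assoc J H c M G c0 M0 F : cls J H c M -> cls J G c0 M0 -> in_Linf (S J) F ->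
  scomp (scomp F G) H = scomp F (scomp G H).
Proof.
  intros h hG hF. rewrite (scomp_op F G), scomp_op, (op_op (S J)).
  - rewrite scomp_op. apply op_ext. intros m hm. assert (dm : depth_le (S J) m) by now apply hF.
    rewrite !(comp_mon_cml (S J)) by easy. apply (scomp_cml J H c M G c0 M0); auto. apply seq_le.
  - now apply (comp_mon_tame J G c0 M0).
  - now apply (comp_mon_tame J H c M).
Qed.

Lemma X_cls J : cls J X 1 (monE 0 1).
Proof.
  split; [lra|split; [unfold monE; simpl; lra|split; [apply depth_leE; lia|]]].
  exists szero. apply mono_nf; [lra|apply depth_leE; lia].
Qed.

Lemma sinv_mono J c M : c <> 0 -> depth_le J M -> sinv (mono c M) = mono (/ c) (monS (-1) M).
Proof.
  intros n h. rewrite (sinv_nf _ _ _ _ _ (mono_nf J c M n h)). unfold geo. rewrite ps_szero, smul_mono. simpl.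
  f_equal; [ring|mon_ext].
Qed.

Lemma Lk_X k : Lk X k = mono 1 (monE k 1).
Proof.
  induction k as [|k IH]; [easy|]. change (Lk X (S k)) with (ell_comp (Lk X k)). rewrite IH. unfold ell_comp.
  rewrite (slog_mono k), ln_1, mono_0, sadd_0l, logmonE, (sinv_mono (S k)) by (lra || apply depth_leE; lia).
  unfold sopp. rewrite sscale_mono. f_equal; [field|].
  apply functional_extensionality. intro i. unfold monS, monE. destruct (Nat.eqb i (S k)); ring.
Qed.

Lemma tau_X m : tau (monE 0 1) m = m.
Proof. apply functional_extensionality. intros [|k]; unfold tau, monE; simpl; ring. Qed.

Lemma comp_mon_X J m : depth_le J m -> comp_mon X m = mono 1 m.
Proof.
  intros h. rewrite (comp_mon_cml J) by easy. rewrite <- (tau_X m) at 2. rewrite <- (lmsum_tau J) by (auto; apply depth_leE; lia).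
  generalize (seq 0 (S J)) as l. induction l as [|k l IH]; simpl; [easy|].
  rewrite IH, Lk_X. rewrite (rpow_nf _ _ _ _ _ _ (mono_nf k 1 (monE k 1) R1_neq_R0 (depth_leE k k 1 (le_n k)))).
  unfold pw. rewrite ps_szero, gbinom_0, Rpower_1l, !smul_mono. f_equal; [ring|].
  rewrite monD0. destruct k; easy.
Qed.

Lemma scomp_X_r J F : in_Linf J F -> scomp F X = F.
Proof.
  intros h. rewrite scomp_op, (op_ext _ (mono 1)); [apply op_delta|]. intros m hm. apply (comp_mon_X J), h, hm.
Qed.

Lemma scomp_X_l J H c M : cls J H c M -> scomp X H = H.
Proof.
  intros h. unfold X. rewrite scomp_mono, sscale_1. apply (comp_mon_E1 J H c M); [easy|lia].
Qed.

(** * Compositional inverses *)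

Lemma op_shift (E : nat -> ser) (c : nat -> R) :
  op (fun n => E (S n)) c = op E (fun n => match n with 0%nat => 0 | S n => c n end).
Proof.
  apply functional_extensionality. intro m. unfold op.
  apply (fsumR_reindex S (fun k => match k with 0%nat => 0 | S n => c n end * E k m)); [lia|].
  intros [|k] hk; [lra|eauto].
Qed.

(* Neumann series: an operator which raises every monomial by an element of a fixed set of
   infinitesimal monomials has [1 + E] invertible. *)
Lemma neumann J S0 (E : mon -> ser) F : good J S0 -> (forall s, S0 s -> mon_lt mon0 s) ->
  (forall m, depth_le J m -> forall m', E m m' <> 0 -> exists s, S0 s /\ m' = monD m s) -> in_Linf J F ->
  tame J E /\ exists G, in_Linf J G /\ sadd G (op E G) = F /\ forall M c, lead F c M -> lead G c M.
Proof.
  intros g p h hF.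
  assert (tE : tame J E).
  { apply (tame_tau J (monE 0 1) S0); [unfold monE; simpl; lra|apply depth_leE; lia|easy|].
    intros m hm m'. rewrite tau_X. now apply h. }
  split; [easy|]. destruct (star_good J S0 g p) as [gs fs].
  set (En := fun n => Nat.iter n (op E) F).
  assert (Ein : forall n, in_Linf J (En n)).
  { induction n as [|n IH]; simpl; [easy|]. now apply tame_in. }
  assert (Es : forall n m, En n m <> 0 -> sumset (supp F) (npow S0 n) m).
  { induction n as [|n IH]; intros m hm.
    - exists m, mon0. repeat split; auto. symmetry. apply monD0.
    - apply op_supp in hm as (m1 & h1 & h2). destruct (h m1 (proj1 (Ein n) m1 h1) m h2) as (s & hs & ->).
      destruct (IH m1 h1) as (a & b & ha & hb & ->). exists a, (monD s b). repeat split; [easy| |mon_ext].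
      exists s, b. auto. }
  assert (sf : forall P, sfam J En P).
  { intro P. apply (sfam_sub J _ _ (fun _ => True)); [|auto]. split.
    - apply (good_sub J _ _ (good_sumset J _ _ hF gs)). intros m (n & _ & hn).
      destruct (Es n m hn) as (a & b & ha & hb & ->). exists a, b. repeat split; auto. now exists n.
    - intro m. eapply finite_sub; [apply (finite_ex _ (fun ab n => npow S0 n (snd ab)) (sumset_finite J _ _ m hF gs)); intros ab _; apply fs|].
      intros n [_ hn]. destruct (Es n m hn) as (a & b & ha & hb & ->). exists (a, b). simpl. repeat split; auto. now exists n. }
  set (c := fun n => (-1) ^ n).
  exists (op En c). split; [now apply op_in|split].
  - rewrite (op_op J) by auto. change (fun i => op E (En i)) with (fun n => En (S n)).
    rewrite op_shift, <- (op_add J) by auto.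
    transitivity (op En (fun n => match n with 0%nat => 1 | S _ => 0 end)).
    + f_equal. apply functional_extensionality. intros [|n]; unfold c; simpl; ring.
    + apply functional_extensionality. intro m. unfold op. rewrite (fsumR_single 0%nat).
      * apply Rmult_1_l.
      * intros [|i] hi; [easy|ring].
  - intros M c0 (e & n & hl).
    (* Among the iterates only [F] itself can reach the leading monomial [M]; the others stay
       strictly above it, so the alternating sum keeps the leading term. *)
    assert (pos : forall n a b, F a <> 0 -> npow S0 n b -> mon_le M (monD a b) /\ (monD a b = M -> n = 0%nat)).
    { intros k a b ha hb. assert (la : mon_le M a) by (destruct (classic (a = M)) as [->|]; [now left|right; auto]).
      assert (lb : mon_le mon0 b) by (apply (npow_nonneg S0 k); [|easy]; intros; right; auto).
      split; [rewrite <- (monD0 M); now apply mon_le_add2|]. intros eq. destruct k as [|k]; [easy|exfalso].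
      destruct hb as (s & t & hs & ht & ->).
      assert (lt : mon_le mon0 t) by (apply (npow_nonneg S0 k); [|easy]; intros; right; auto).
      apply (mon_lt_irrefl M). rewrite <- eq at 2. rewrite <- (monD0 M) at 1.
      eapply mon_lt_le_trans; [apply mon_lt_addl, (p s hs)|]. apply mon_le_add2; [easy|].
      rewrite <- (monD0 s) at 1. apply mon_le_add2; [now left|easy]. }
    split; [|split; [easy|]].
    + unfold op. rewrite (fsumR_single 0%nat).
      * unfold c, En. simpl. lra.
      * intros i hi. replace (En i M) with 0; [ring|]. symmetry. apply NNPP. intro hn.
        destruct (Es i M hn) as (a & b & ha & hb & eq). now apply hi, (pos i a b).
    + intros m hm nm. apply op_supp in hm as (k & _ & hk). destruct (Es k m hk) as (a & b & ha & hb & ->).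
      destruct (pos k a b ha hb) as [[->|l] _]; [easy|easy].
Qed.

(* [C_H = (1 + E) U], where [U] sends a monomial to the leading term of its composite with [H]. *)
Lemma left_inverse J H c M : cls J H c M ->
  exists h c', cls J h c' (tau (tinv M) (monE 0 1)) /\ scomp h H = X.
Proof.
  intros h. pose proof h as (cp & Mp & hM & _). set (ti := tau (tinv M)).
  assert (hM' : depth_le (S J) M) by now apply depth_S.
  assert (tip : 0 < tinv M 0%nat) by (simpl; now apply Rinv_0_lt_compat).
  assert (tid : forall m, depth_le (S J) m -> depth_le (S J) (ti m)) by (intros; apply tau_depth; auto; now apply tinv_depth).
  assert (tit : forall m, tau M (ti m) = m) by (intro; apply tau_tinv; lra).
  (* Leading coefficient of the composite, so that [U m = u m * tau M m]. *)
  set (u := fun m => comp_mon H m (tau M m)).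
  assert (up : forall m, depth_le (S J) m -> 0 < u m).
  { intros m hm. destruct (comp_mon_nf J H c M m h hm) as (v & d & pv & hd).
    unfold u. destruct (nf_lead _ _ _ _ _ hd) as [e _]. now rewrite e. }
  destruct (comp_mon_supp J H c M h) as (S0 & gS & nS & hS).
  (* [1 + E] is composition with [H] applied after the inverse of [U]. Solving [(1 + E) G = X] and
     applying the inverse of [U] to [G] gives the left inverse. *)
  set (E := fun m => ssub (sscale (/ u (ti m)) (comp_mon H (ti m))) (mono 1 m)).
  destruct (neumann (S J) (fun s => S0 s /\ mon_lt mon0 s) E X) as (tE & G & hG & eG & lG).
  - apply (good_sub _ _ _ gS). now intros m [? _].
  - now intros s [_ ?].
  - intros m hm m' hE.
    assert (um := up (ti m) (tid m hm)).
    destruct (classic (m' = m)) as [->|nm].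
    + exfalso. apply hE. unfold E, ssub, sadd, sopp, sscale. rewrite mono_eq. unfold u in um |- *. rewrite tit in um |- *. field. lra.
    + unfold E, ssub, sadd, sopp, sscale in hE. rewrite mono_neq in hE by easy.
      destruct (hS (ti m) (tid m hm) m') as (s & hs & e).
      { intro z. apply hE. rewrite z. ring. }
      rewrite tit in e. exists s. split; [|easy]. split; [easy|].
      destruct (nS s hs) as [z|]; [|easy]. elim nm. rewrite e, <- z. apply monD0.
  - auto with linf.
  - assert (lX : lead G 1 (monE 0 1)).
    { apply lG. destruct (X_cls J) as (_ & _ & _ & d & hd). apply (nf_lead _ _ _ _ _ hd). }
    (* The inverse of [U], sending [tau M m] to [m / u m]. *)
    set (N := fun m => mono (/ u (ti m)) (ti m)).
    assert (tN : tame (S J) N).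
    { apply (tame_tau (S J) (tinv M) (fun s => s = mon0)); auto; [now apply tinv_depth|apply good_single; auto with dep|].
      intros m _ m' hm. apply mono_supp in hm as ->. exists mon0. split; [easy|]. symmetry. apply monD0. }
    assert (hN : in_Linf (S J) (op N G)) by now apply tame_in.
    assert (d0 : depth_le (S J) (monE 0 1)) by (apply depth_leE; lia).
    assert (L : lead (op N G) (/ u (ti (monE 0 1))) (ti (monE 0 1))).
    { destruct lX as (e & _ & l). split; [|split].
      - unfold op. rewrite (fsumR_single (monE 0 1)); [rewrite e; unfold N; rewrite mono_eq; ring|].
        intros m nm. unfold N. rewrite mono_neq; [ring|]. intro z. apply nm. symmetry.
        apply (tau_inj (tinv M)); [lra|easy].
      - apply Rinv_neq_0_compat, Rgt_not_eq, up. auto.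
      - intros m hm nm. apply op_supp in hm as (a & ha & hm). apply mono_supp in hm as ->.
        apply tau_lt; [easy|]. apply l; [easy|]. intros ->. now apply nm. }
    exists (op N G), (/ u (ti (monE 0 1))). split.
    + split; [|split; [|split]].
      * apply Rinv_0_lt_compat, up. auto.
      * unfold tau, monE. simpl. rewrite Rmult_1_r. now apply Rinv_0_lt_compat.
      * apply tau_depth; [now apply tinv_depth|apply depth_leE; lia].
      * now apply lead_nf.
    + rewrite scomp_op, (op_op (S J)); [|now apply tN|now apply (comp_mon_tame J H c M)].
      rewrite <- eG. rewrite <- (op_delta G) at 2. rewrite <- (op_kadd (S J)).
      * apply op_ext. intros m _. unfold N. rewrite op_mono. apply functional_extensionality. intro m'.
        unfold E, ssub, sadd, sopp, sscale. ring.
      * apply sfam_tame; [apply tame_delta|easy].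
      * now apply sfam_tame.
Qed.

(** The left inverse [h] of [g] lies in the same class and so has a left inverse [k]; then
    [k = k o (h o g) = (k o h) o g = g], and [h] is also a right inverse. *)
Theorem inverse_exists J g c M : cls J g c M ->
  exists h c', cls J h c' (tau (tinv M) (monE 0 1)) /\ scomp h g = X /\ scomp g h = X.
Proof.
  intros hg. destruct (left_inverse J g c M hg) as (h & c' & hh & e).
  destruct (left_inverse J h c' _ hh) as (k & c2 & hk & e2).
  exists h, c'. split; [easy|split; [easy|]].
  assert (in_Linf (S J) k) as ik by (destruct hk as (_ & _ & _ & d & hd); now apply nf_in in hd).
  replace g with k; [easy|].
  rewrite <- (scomp_X_r (S J) k ik), <- e, <- (scomp_assoc J g c M h c' _ k hg hh ik), e2.
  now apply (scomp_X_l J g c M).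
Qed.

(** [k] is only assumed to have bounded depth, in accordance with [is_finv], which says nothing on
    the leading monomial of the inverse; here [k = k o (g o h) = (k o g) o h = h]. *)
Lemma left_inverse_unique J g c M h c' M' k : cls J g c M -> cls J h c' M' -> scomp g h = X ->
  in_Linf (S J) k -> scomp k g = X -> k = h.
Proof.
  intros hg hh e ik e2.
  rewrite <- (scomp_X_r (S J) k ik), <- e, <- (scomp_assoc J h c' M' g c M k hh hg ik), e2.
  now apply (scomp_X_l J h c' M').
Qed.

(** * The derivation with respect to $1/\ell_2$ *)

(** The monomial [l_2 ... l_k], equal to 1 for [k <= 1]. *)
Definition ee (k : nat) : mon := fun i => if ((2 <=? i) && (i <=? k))%nat%bool then 1 else 0.
(* Makes [x] and [l_1] constants for the derivation. *)
Definition qc (k : nat) : R := if (k <? 2)%nat then 0 else 1.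

(* Logarithmic derivative of the monomial [m]: [l_k' / l_k = - l_2 ... l_k] for [k >= 2]. *)
Definition lam (l : list nat) (m : mon) : ser :=
  fold_right (fun k acc => sadd (mono (- (qc k * m k)) (ee k)) acc) szero l.

Definition Dk (J : nat) (m : mon) : ser := smul (mono 1 m) (lam (seq 0 (S J)) m).

Lemma ee_S k : (1 <= k)%nat -> ee (S k) = monD (ee k) (monE (S k) 1).
Proof.
  intros h. apply functional_extensionality. intro i. unfold ee, monD, monE.
  destruct (Nat.leb_spec 2 i), (Nat.leb_spec i (S k)), (Nat.leb_spec i k), (Nat.eqb_spec i (S k)); simpl; try lia; ring.
Qed.

Lemma ee_1 : ee 1 = mon0.
Proof. apply functional_extensionality. intros [|[|i]]; easy. Qed.

Lemma ee_depth J k : (k <= J)%nat -> depth_le J (ee k).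
Proof.
  intros h i l. unfold ee. destruct (Nat.leb_spec 2 i), (Nat.leb_spec i k); simpl; try lia; easy.
Qed.

Lemma lam_add l a b : lam l (monD a b) = sadd (lam l a) (lam l b).
Proof.
  induction l as [|k l IH]; simpl; [now rewrite sadd_0l|]. rewrite IH.
  replace (- (qc k * monD a b k)) with (- (qc k * a k) + - (qc k * b k)) by (unfold monD; ring).
  rewrite mono_add. apply functional_extensionality. intro. unfold sadd. ring.
Qed.

Lemma lam_scale l a m : lam l (monS a m) = sscale a (lam l m).
Proof.
  induction l as [|k l IH]; simpl; [apply functional_extensionality; intro; unfold sscale, szero; ring|]. rewrite IH.
  replace (- (qc k * monS a m k)) with (a * - (qc k * m k)) by (unfold monS; ring).
  rewrite <- sscale_mono. apply functional_extensionality. intro. unfold sadd, sscale. ring.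
Qed.

Lemma lam_in J l m : (forall k, In k l -> (k <= J)%nat) -> in_Linf J (lam l m).
Proof.
  intros h. induction l as [|k l IH]; simpl; [auto with linf|].
  apply in_add; [apply in_mono, ee_depth, h; now left|apply IH; intros; apply h; now right].
Qed.

Lemma lam_supp l m p : lam l m p <> 0 -> exists k, In k l /\ (2 <= k)%nat /\ m k <> 0 /\ p = ee k.
Proof.
  induction l as [|k l IH]; simpl; [intros h; now elim h|]. unfold sadd at 1. intros h.
  destruct (Req_dec_T (lam l m p) 0) as [e|n].
  - rewrite e, Rplus_0_r in h. assert (p = ee k) by now apply mono_supp in h. subst p. rewrite mono_eq in h.
    exists k. unfold qc in h. destruct (Nat.ltb_spec k 2); [lra|]. repeat split; auto. intro z. rewrite z in h. lra.
  - destruct (IH n) as (k' & h1 & h2). exists k'. auto.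
Qed.

Lemma ee_inj k k' : (2 <= k)%nat -> (2 <= k')%nat -> ee k = ee k' -> k = k'.
Proof.
  intros h h' e. assert (a := f_equal (fun m => m k) e). assert (b := f_equal (fun m => m k') e). unfold ee in a, b.
  destruct (Nat.leb_spec 2 k), (Nat.leb_spec k k), (Nat.leb_spec 2 k'), (Nat.leb_spec k k'), (Nat.leb_spec k' k'), (Nat.leb_spec k' k); simpl in *; try lia; lra.
Qed.

(** The multiplicity allows induction over arbitrary lists; it is 1 for the list [seq] used in
    [Dk]. *)
Lemma lam_at l m k : (2 <= k)%nat -> lam l m (ee k) = - m k * INR (count_occ Nat.eq_dec l k).
Proof.
  intros h. induction l as [|j l IH]; simpl; [unfold szero; ring|]. unfold sadd at 1. rewrite IH.
  destruct (Nat.eq_dec j k) as [->|n].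
  - rewrite mono_eq. change (match count_occ Nat.eq_dec l k with 0%nat => 1 | S _ => INR (count_occ Nat.eq_dec l k) + 1 end) with (INR (S (count_occ Nat.eq_dec l k))).
    rewrite S_INR. unfold qc. destruct (Nat.ltb_spec k 2); [lia|ring].
  - unfold qc. destruct (Nat.ltb_spec j 2).
    + replace (- (0 * m j)) with 0 by ring. rewrite mono_0. unfold szero. ring.
    + rewrite mono_neq; [ring|]. intro e. apply n. symmetry. now apply ee_inj.
Qed.

Lemma lam_seq_in J m : in_Linf J (lam (seq 0 (S J)) m).
Proof. apply lam_in. intros k hk. apply in_seq in hk. lia. Qed.
#[global] Hint Resolve lam_seq_in : linf.

Lemma lam_E J k r : (2 <= k)%nat -> (k <= J)%nat -> lam (seq 0 (S J)) (monE k r) = mono (- r) (ee k).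
Proof.
  intros h l. apply functional_extensionality. intro p. destruct (classic (p = ee k)) as [->|n].
  - rewrite lam_at, mono_eq by easy. assert (count_occ Nat.eq_dec (seq 0 (S J)) k = 1%nat) as ->.
    { apply NoDup_count_occ'; [apply seq_NoDup|]. apply in_seq. lia. }
    unfold monE. rewrite Nat.eqb_refl. simpl. ring.
  - rewrite mono_neq by easy. apply NNPP. intro hn. apply lam_supp in hn as (j & _ & _ & hj & e).
    apply n. unfold monE in hj. destruct (Nat.eqb_spec j k); [now subst|easy].
Qed.

Lemma lam_depth1 l m : depth_le 1 m -> lam l m = szero.
Proof.
  intros h. apply functional_extensionality. intro p. apply NNPP. intro hn. apply lam_supp in hn as (j & _ & hj & n & _).
  apply n, h. lia.
Qed.

Lemma Dk_tame J : tame J (Dk J).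
Proof.
  apply (tame_tau J (monE 0 1) (fun s => exists k, In k (seq 0 (S J)) /\ s = ee k)).
  - unfold monE; simpl; lra.
  - apply depth_leE; lia.
  - apply good_finite; [apply finite_image; now exists (seq 0 (S J))|].
    intros m (k & hk & ->). apply ee_depth. apply in_seq in hk. lia.
  - intros m hm m' h. apply smul_supp in h as (a & b & ha & hb & ->). apply mono_supp in ha as ->.
    apply lam_supp in hb as (k & hk & _ & _ & ->). exists (ee k). rewrite tau_X. eauto.
Qed.

Definition der (J : nat) (F : ser) : ser := op (Dk J) F.

Lemma der_in J F : in_Linf J F -> in_Linf J (der J F).
Proof. intros h. apply tame_in; [apply Dk_tame|easy]. Qed.
#[global] Hint Resolve der_in : linf.

Lemma Dk_in J a : depth_le J a -> in_Linf J (Dk J a).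
Proof. intros h. unfold Dk. auto with linf. Qed.
#[global] Hint Resolve Dk_in : linf.

Lemma Dk_add J a b : depth_le J a -> depth_le J b ->
  Dk J (monD a b) = sadd (smul (Dk J a) (mono 1 b)) (smul (mono 1 a) (Dk J b)).
Proof.
  intros ha hb. unfold Dk. rewrite lam_add. assert (A := in_mono J 1 a ha). assert (B := in_mono J 1 b hb).
  assert (LA := lam_seq_in J a). assert (LB := lam_seq_in J b).
  replace 1 with (1 * 1) at 1 by ring. rewrite <- smul_mono. sring.
Qed.

Lemma der_mul J A B : in_Linf J A -> in_Linf J B ->
  der J (smul A B) = sadd (smul (der J A) B) (smul A (der J B)).
Proof.
  intros hA hB. assert (t := Dk_tame J). assert (hDB := der_in J B hB). assert (hDA := der_in J A hA).
  rewrite (smul_op A (der J B)), (smul_op (der J A)). unfold der at 1 2. rewrite (smul_op A B), !(op_op J) by auto with linf.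
  rewrite <- (op_kadd J); [|apply sfam_tame; [|easy]; apply (tame_op J (sh B)); auto with linf|auto with linf].
  apply op_ext. intros a na. assert (da : depth_le J a) by now apply hA.
  rewrite <- smul_op. unfold sh. rewrite (smul_comm (Dk J a)), (smul_op B (Dk J a)), (smul_comm (mono 1 a)), (smul_op B (mono 1 a)).
  rewrite (smul_comm _ (der J B)), (smul_op (der J B)). unfold der. rewrite !(op_op J) by auto with linf.
  rewrite <- (op_kadd J); [|auto with linf|apply sfam_tame; [|easy]; apply (tame_op J (sh (mono 1 a))); auto with linf].
  apply op_ext. intros b nb. assert (db : depth_le J b) by now apply hB.
  unfold sh at 1. rewrite smul_mono, Rmult_1_l, op_mono, sscale_1, Dk_add, <- smul_op, sadd_comm by easy. easy.
Qed.

Lemma der_add J A B : in_Linf J A -> in_Linf J B -> der J (sadd A B) = sadd (der J A) (der J B).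
Proof. intros hA hB. assert (t := Dk_tame J). apply (op_add J); auto with linf. Qed.

Lemma der_mono J c m : der J (mono c m) = smul (mono c m) (lam (seq 0 (S J)) m).
Proof. unfold der. rewrite op_mono. unfold Dk. now rewrite <- smul_scale, sscale_mono, Rmult_1_r. Qed.

Lemma smul_0l F : smul szero F = szero.
Proof. apply functional_extensionality. intro m. rewrite smul_conv. apply fsumR_zero. intro; unfold szero; ring. Qed.
Lemma smul_0r F : smul F szero = szero.
Proof. rewrite smul_comm. apply smul_0l. Qed.

Lemma der_depth1 J F : (forall m, F m <> 0 -> depth_le 1 m) -> der J F = szero.
Proof.
  intros h. unfold der. rewrite (op_ext _ (fun _ => szero)).
  - apply functional_extensionality. intro m. apply fsumR_zero. intro; unfold szero; ring.
  - intros m hm. unfold Dk. now rewrite (lam_depth1 _ m), smul_0r by auto.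
Qed.

Lemma der_one J : der J one = szero.
Proof. apply der_depth1. intros m hm. apply mono_supp in hm as ->. auto with dep. Qed.

Lemma der_pow J d n : in_Linf J d -> der J (spow d (S n)) = sscale (INR (S n)) (smul (spow d n) (der J d)).
Proof.
  intros h. assert (E := der_in J d h). induction n as [|n IH].
  - simpl. rewrite (smul_comm d), !smul_one. now rewrite sscale_1.
  - assert (P := in_pow J d n h). change (spow d (S (S n))) with (smul d (spow d (S n))).
    rewrite der_mul, IH by auto with linf. change (spow d (S n)) with (smul d (spow d n)).
    rewrite !sscale_mul, (S_INR (S n)), mono_add. set (k := mono (INR (S n)) mon0).
    assert (K : in_Linf J k) by (unfold k; auto with linf). fold one. sring.
Qed.

Lemma der_ps J c d : small J d -> der J (ps c d) = smul (ps (fun n => INR (S n) * c (S n)) d) (der J d).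
Proof.
  intros h. assert (t := Dk_tame J). assert (hd := small_in J d h). assert (E := der_in J d hd).
  rewrite smul_op. unfold ps, der at 1. rewrite !(op_op J) by auto with linf.
  apply functional_extensionality. intro m. unfold op at 1 3.
  rewrite <- (fsumR_reindex S (fun n => c n * op (Dk J) (spow d n) m)); [|lia|].
  - apply fsumR_ext. intro n. fold (der J (spow d (S n))). rewrite der_pow, <- smul_op by easy. unfold sscale. ring.
  - intros [|k] hk; [|eauto]. exfalso. apply hk. simpl. fold (der J one). rewrite der_one. unfold szero. ring.
Qed.

Lemma der_pw J d a : small J d -> der J (pw d a) = smul (sscale a (pw d (a - 1))) (der J d).
Proof.
  intros h. unfold pw. rewrite (der_ps J), <- ps_scale by easy. f_equal. apply ps_ext. intro n.
  unfold gbinom. replace (gprod a (S n)) with (a * gprod (a - 1) n).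
  - rewrite fact_simpl, mult_INR. field. split; [apply INR_fact_neq_0|now apply not_0_INR].
  - replace a with (a - 1 + 1) at 3 by ring. rewrite gprod_S. ring.
Qed.

Lemma der_lg J d : small J d -> der J (lg d) = smul (geo d) (der J d).
Proof.
  intros h. unfold lg. rewrite (der_ps J) by easy. f_equal. apply ps_ext. intro n. unfold lgc. field.
  now apply not_0_INR.
Qed.

(** Moves the logarithmic derivative from [G] to [1 + d], where the rules for power series apply:
    that of [1 + d] is [L] minus that of [M]. *)
Lemma logder_delta J G c M d L : nf J G c M d -> in_Linf J L -> der J G = smul G L ->
  der J d = smul (sadd one d) (ssub L (lam (seq 0 (S J)) M)).
Proof.
  intros (h1 & h2 & h3 & ->) hL e. assert (D := small_in J d h3). assert (D' := der_in J d D).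
  assert (A := in_mono J c M h1). assert (LM := lam_seq_in J M).
  rewrite der_mul, der_mono, der_add, der_one, sadd_0l in e by auto with linf.
  set (B := mono (/ c) (monS (-1) M)). assert (hB : in_Linf J B) by (unfold B; auto with linf).
  assert (AB : smul B (mono c M) = one).
  { unfold B. rewrite smul_mono. replace (monD (monS (-1) M) M) with mon0 by mon_ext. now replace (/ c * c) with 1 by (field; easy). }
  assert (e2 := f_equal (smul B) e).
  assert (F1 : smul B (sadd (smul (smul (mono c M) (lam (seq 0 (S J)) M)) (sadd one d)) (smul (mono c M) (der J d)))
     = smul (smul B (mono c M)) (sadd (smul (lam (seq 0 (S J)) M) (sadd one d)) (der J d))) by sring.
  assert (F2 : smul B (smul (smul (mono c M) (sadd one d)) L) = smul (smul B (mono c M)) (smul (sadd one d) L)) by sring.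
  rewrite F1, F2, AB, !smul_one in e2.
  transitivity (ssub (sadd (smul (lam (seq 0 (S J)) M) (sadd one d)) (der J d)) (smul (lam (seq 0 (S J)) M) (sadd one d))); [sring|].
  rewrite e2. sring.
Qed.

Lemma logder_rpow J G c M d L a : nf J G c M d -> in_Linf J L -> der J G = smul G L ->
  der J (rpow G a) = smul (rpow G a) (sscale a L).
Proof.
  intros hG hL e. assert (E := logder_delta J G c M d L hG hL e).
  rewrite (rpow_nf _ _ _ _ _ _ hG). destruct hG as (h1 & h2 & h3 & _).
  assert (D := small_in J d h3). assert (LM := lam_seq_in J M).
  assert (A := in_mono J (Rpower c a) (monS a M) ltac:(auto with dep)).
  rewrite der_mul, der_mono, (der_pw J), E, lam_scale by auto with linf.
  assert (P := pw_in J d (a - 1) h3). assert (Q := in_mono J a mon0 (depth_le0 J)).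
  replace (pw d a) with (smul (sadd one d) (pw d (a - 1))).
  - rewrite !sscale_mul. sring.
  - rewrite <- (pw_S J) by easy. f_equal. ring.
Qed.

Lemma comp_mon_in J H c M m : cls J H c M -> depth_le (S J) m -> in_Linf (S J) (comp_mon H m).
Proof. intros h hm. apply (tame_mono_in (S J) (comp_mon H) m hm). now apply (comp_mon_tame J H c M). Qed.

Lemma scomp_lam J H c M l m : cls J H c M -> (forall k, In k l -> (k <= S J)%nat) -> forall k,
  (k <= S J)%nat -> scomp (lam (k :: l) m) H = sadd (sscale (m k) (sscale (- qc k) (comp_mon H (ee k)))) (scomp (lam l m) H).
Proof.
  intros h hl k hk. simpl. rewrite (scomp_add J H c M); [|easy|apply in_mono, ee_depth; lia|now apply lam_in].
  f_equal. rewrite scomp_mono. apply functional_extensionality. intro. unfold sscale. ring.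
Qed.

(* [l_k o f] satisfies the same differential equation as [l_k]. *)
Lemma der_Lk J f k : cls J f 1 (monE 0 1) -> in_Linf 1 f -> (k <= S J)%nat ->
  der (S J) (Lk f k) = smul (Lk f k) (sscale (- qc k) (comp_mon f (ee k))).
Proof.
  intros h h1 l.
  (* Depth 1 of [f] enters here: [f] and [l_1 o f] both have depth 1, so the derivation annihilates
     them. *)
  assert (h0 : cls 0 f 1 (monE 0 1)).
  { destruct h as (p & q & D & d & hd). split; [easy|split; [easy|split; [apply depth_leE; lia|]]].
    apply lead_nf; [easy|]. apply (nf_lead _ _ _ _ _ hd). }
  assert (low : forall k, (k <= 1)%nat -> der (S J) (Lk f k) = smul (Lk f k) (sscale (- qc k) (comp_mon f (ee k)))).
  { intros i hi. rewrite der_depth1.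
    - replace (- qc i) with 0 by (unfold qc; destruct (Nat.ltb_spec i 2); [ring|lia]).
      replace (sscale 0 _) with szero; [now rewrite smul_0r|].
      apply functional_extensionality. intro. unfold sscale, szero. ring.
    - apply (Lk_in 0 f 1 (monE 0 1) i h0 hi). }
  induction k as [|k IH]; [apply low; lia|]. destruct k as [|k]; [apply low; lia|].
  specialize (IH ltac:(lia)). set (n := S k) in *. assert (n1 : (1 <= n)%nat) by (unfold n; lia). clearbody n.
  destruct (Lk_nf J f 1 (monE 0 1) n h ltac:(lia)) as [d hd].
  assert (C := comp_mon_in J f 1 (monE 0 1) (ee n) h (ee_depth (S J) n ltac:(lia))).
  assert (C1 := in_scale (S J) (- qc n) _ C).
  assert (E := logder_delta _ _ _ _ _ _ hd C1 IH).
  assert (S1 := Lk_slog_in J f 1 (monE 0 1) n h ltac:(lia)).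
  assert (L1 := Lk_in J f 1 (monE 0 1) (S n) h l).
  assert (hs : small (S J) d) by apply hd. assert (hd1 := small_in _ d hs). assert (G := geo_in _ d hs).
  (* Composed form of the fact that [-1/l_{n+1}] has derivative [- l_2 ... l_n]. Differentiating
     [log(l_n o f) (l_{n+1} o f) = -1] then yields the claim. *)
  assert (Ds : der (S J) (slog (Lk f n)) = sopp (comp_mon f (ee n))).
  { rewrite (slog_nf _ _ _ _ _ hd).
    replace (ln (lc 1 (monE 0 1) n)) with 0.
    2: { destruct n as [|[|n']]; simpl; unfold monE; simpl; rewrite ?Rinv_1, ?ln_1; easy. }
    assert (NN : lm (monE 0 1) n = monE n 1) by (destruct n; [lia|easy]). rewrite NN in *. clear NN.
    rewrite mono_0, sadd_0l, logmonE, der_add by (auto with linf; apply in_mono, depth_leE; lia).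
    rewrite der_mono, lam_E by lia. rewrite (der_lg (S J)), E by easy.
    rewrite smul_mono. replace (monD (monE (S n) (-1)) (ee (S n))) with (ee n).
    2: { rewrite ee_S by easy. apply functional_extensionality. intro i. unfold monD, monE. destruct (Nat.eqb i (S n)); ring. }
    assert (LM := lam_seq_in (S J) (monE n 1)).
    assert (IG := geo_inv (S J) d hs).
    transitivity (sadd (mono (-1 * - -1) (ee n)) (smul (smul (sadd one d) (geo d)) (ssub (sscale (- qc n) (comp_mon f (ee n))) (lam (seq 0 (S (S J))) (monE n 1))))).
    { f_equal. sring. }
    (* For [n = 1] only the explicit [-1/l_2] contributes, since [lg d] has derivative 0. For
       [n >= 2] that contribution cancels against the part of the derivative of [lg d] due to the
       leading monomial [l_n]. *)
    rewrite IG, smul_one. unfold qc. destruct (Nat.ltb_spec n 2) as [lt|ge].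
    - assert (n = 1%nat) as -> by lia. rewrite lam_depth1 by (apply depth_leE; lia). rewrite ee_1, comp_mon_0.
      replace (-1 * - -1) with (-1 * 1) by ring. rewrite <- sscale_mono. fold one.
      apply functional_extensionality. intro. unfold ssub, sadd, sopp, sscale, szero. ring.
    - rewrite lam_E by lia. replace (-1 * - -1) with (-1) by ring.
      apply functional_extensionality. intro. unfold ssub, sadd, sopp, sscale, szero, mono.
      destruct (excluded_middle_informative _); ring. }
  assert (W := Lk_slog J f 1 (monE 0 1) n h ltac:(lia)).
  assert (DL := der_in _ _ L1).
  assert (W2 := f_equal (der (S J)) W). rewrite der_mul, Ds in W2 by easy.
  replace (der (S J) (sopp one)) with szero in W2.
  2: { symmetry. apply der_depth1. intros m hm. apply prod_neq0 in hm as [_ hm]. apply mono_supp in hm as ->. auto with dep. }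
  rewrite ee_S, (comp_mon_add J f 1 (monE 0 1)), (comp_mon_E1 J f 1 (monE 0 1)); auto; try (apply depth_leE; lia); try (apply ee_depth; lia).
  replace (- qc (S n)) with (-1) by (unfold qc; destruct (Nat.ltb_spec (S n) 2); [lia|ring]).
  change (sscale (-1) (smul (comp_mon f (ee n)) (Lk f (S n)))) with (sopp (smul (comp_mon f (ee n)) (Lk f (S n)))).
  transitivity (sopp (smul (sopp one) (der (S J) (Lk f (S n))))); [sring|]. rewrite <- W.
  transitivity (sopp (smul (Lk f (S n)) (ssub (sadd (smul (sopp (comp_mon f (ee n))) (Lk f (S n))) (smul (slog (Lk f n)) (der (S J) (Lk f (S n))))) (smul (sopp (comp_mon f (ee n))) (Lk f (S n)))))); [sring|].
  rewrite W2. sring.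
Qed.

Lemma der_cml J f l m : cls J f 1 (monE 0 1) -> in_Linf 1 f -> (forall k, In k l -> (k <= S J)%nat) -> depth_le (S J) m ->
  der (S J) (cml f l m) = smul (cml f l m) (scomp (lam l m) f).
Proof.
  intros h h1 hl hm. induction l as [|k l IH].
  - simpl. rewrite der_one. rewrite smul_one. symmetry. apply szero_op.
  - assert (hk : (k <= S J)%nat) by (apply hl; now left).
    assert (hl' : forall k', In k' l -> (k' <= S J)%nat) by (intros; apply hl; now right).
    rewrite (scomp_lam J f 1 (monE 0 1)) by easy. simpl.
    destruct (Lk_nf J f 1 (monE 0 1) k h hk) as [d hd].
    assert (A := nf_in _ _ _ _ _ (nf_rpow _ _ _ _ _ (m k) hd)).
    destruct (cml_nf J f 1 (monE 0 1) l m h hl' hm) as (u & e & _ & B%nf_in).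
    assert (C := in_scale (S J) (- qc k) _ (comp_mon_in J f 1 (monE 0 1) (ee k) h (ee_depth _ _ hk))).
    rewrite der_mul, (logder_rpow _ _ _ _ _ _ (m k) hd C (der_Lk J f k h h1 hk)), IH by easy.
    assert (C' := in_scale (S J) (m k) _ C).
    assert (L := scomp_in J _ f 1 (monE 0 1) h (lam_in (S J) l m hl')). sring.
Qed.

(** A chain rule without inner factor. On monomials it says that the logarithmic derivatives
    composed with [f] are those of the composites, which is [der_cml]. *)
Lemma der_scomp J f F : cls J f 1 (monE 0 1) -> in_Linf 1 f -> in_Linf (S J) F ->
  der (S J) (scomp F f) = scomp (der (S J) F) f.
Proof.
  intros h h1 hF. assert (t := Dk_tame (S J)). assert (tf := comp_mon_tame J f 1 (monE 0 1) h).
  rewrite !scomp_op. unfold der. rewrite !(op_op (S J)) by auto with linf.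
  apply op_ext. intros m hm. assert (dm : depth_le (S J) m) by now apply hF.
  fold (der (S J) (comp_mon f m)). rewrite <- scomp_op. unfold Dk.
  rewrite (scomp_mul J f 1 (monE 0 1)), scomp_mono, sscale_1 by auto with linf.
  rewrite (comp_mon_cml (S J)) by easy. apply (der_cml J); auto. apply seq_le.
Qed.

(** * Leading terms of $F \circ f - F$ for parabolic $f$ *)

Definition geq (w : mon) (F : ser) : Prop := forall m, F m <> 0 -> mon_le w m.

Lemma geq_mul w w' F G : geq w F -> geq w' G ->
  geq (monD w w') (smul F G) /\ smul F G (monD w w') = F w * G w'.
Proof.
  intros hF hG. split.
  - intros m hm. apply smul_supp in hm as (a & b & ha & hb & ->). apply mon_le_add2; auto.
  - rewrite smul_conv, (fsumR_single w).
    + f_equal. f_equal. mon_ext.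
    + intros a n. apply NNPP. intro h. apply prod_neq0 in h as [h1 h2].
      apply hG in h2. destruct (hF a h1) as [->|lt]; [easy|]. apply (mon_lt_irrefl (monD w w')).
      eapply mon_lt_le_trans; [apply (mon_lt_add _ _ w' lt)|].
      replace (monD w w') with (monD a (monD (monD w w') (monS (-1) a))) by mon_ext.
      apply mon_le_add2; [now left|easy].
Qed.

Lemma geq_lt_0 w w' F : geq w F -> mon_lt w' w -> F w' = 0.
Proof.
  intros h l. apply NNPP. intro n. apply (mon_lt_irrefl w'). eapply mon_lt_le_trans; eauto.
Qed.

Lemma geq_lt w w' F : geq w F -> mon_lt w' w -> geq w' F.
Proof. intros h l m hm. right. eapply mon_lt_le_trans; eauto. Qed.

Lemma geq_add w F G : geq w F -> geq w G -> geq w (sadd F G).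
Proof.
  intros hF hG m hm. unfold sadd in hm. destruct (Req_dec_T (F m) 0); [apply hG; lra|auto].
Qed.

Lemma mono_geq c M : geq M (mono c M).
Proof. intros m h. apply mono_supp in h. now left. Qed.

Lemma ps_at0 J c d : small J d -> ps c d mon0 = c 0%nat.
Proof.
  intros h. rewrite (ps_decomp J) by easy. unfold sadd. rewrite mono_eq.
  rewrite (small_0 J); [ring|]. apply small_mul; [easy|auto with linf|now apply (ps_nonneg J)].
Qed.

Lemma ps_geq J c d w : small J d -> geq w d -> c 0%nat = 0 -> geq w (ps c d) /\ ps c d w = c 1%nat * d w.
Proof.
  intros h hw e. rewrite (ps_decomp J), e, mono_0, sadd_0l by easy.
  destruct (geq_mul w mon0 d (ps (fun n => c (S n)) d) hw (ps_nonneg J _ _ h)) as [A B].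
  rewrite monD0 in A, B. split; [easy|]. rewrite B, (ps_at0 J) by easy. ring.
Qed.

Lemma ps_sub_one J c d : small J d -> c 0%nat = 1 ->
  ssub (ps c d) one = ps (fun n => match n with 0%nat => 0 | S _ => c n end) d.
Proof.
  intros h e. unfold one, ssub, sopp. rewrite <- (ps_const 1 d), <- ps_scale, <- (ps_add J) by easy.
  apply ps_ext. intros [|n]; [rewrite e|]; ring.
Qed.

(* The monomial [v l_1 ... l_k]. *)
Definition vk (v : mon) (k : nat) : mon := fun i => v i + if ((1 <=? i) && (i <=? k))%nat%bool then 1 else 0.

Lemma vk_0 v : vk v 0 = v.
Proof.
  apply functional_extensionality. intro i. unfold vk.
  destruct (Nat.leb_spec 1 i), (Nat.leb_spec i 0); simpl; try lia; ring.
Qed.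

Lemma vk_S v k : vk v (S k) = monD (vk v k) (monE (S k) 1).
Proof.
  apply functional_extensionality. intro i. unfold vk, monD, monE.
  destruct (Nat.leb_spec 1 i), (Nat.leb_spec i (S k)), (Nat.leb_spec i k), (Nat.eqb_spec i (S k)); simpl; try lia; ring.
Qed.

Lemma vk_lt v k k' : (k < k')%nat -> mon_lt (vk v k) (vk v k').
Proof.
  intros l. exists (S k). unfold vk. split.
  - intros i hi. destruct (Nat.leb_spec 1 i), (Nat.leb_spec i k), (Nat.leb_spec i k'); simpl; try lia; ring.
  - destruct (Nat.leb_spec 1 (S k)), (Nat.leb_spec (S k) k), (Nat.leb_spec (S k) k'); simpl; try lia; lra.
Qed.

Definition fnz (m : mon) (k : nat) : Prop := m k <> 0 /\ forall i, (i < k)%nat -> m i = 0.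

Lemma fnz_exists m : m <> mon0 -> exists k, fnz m k.
Proof. intros n. destruct (mon_neq_index m mon0 n) as (k & h & l). exists k. split; auto. Qed.

(* [m o f - m] has leading monomial [m v l_1 ... l_k], [k] being the first index of [m]; this is increasing in [m]. *)
Lemma vk_mono v m n k k' : fnz m k -> fnz n k' -> mon_lt m n -> mon_lt (monD m (vk v k)) (monD n (vk v k')).
Proof.
  intros [a z] [a' z'] (j & e & l). destruct (lt_eq_lt_dec k k') as [[lt| <-]|lt].
  - assert (j = k) as ->.
    { destruct (lt_eq_lt_dec j k) as [[?|?]|?]; [rewrite z, z' in l by lia; lra|easy|].
      elim a. rewrite e by easy. now apply z'. }
    exists k. unfold monD, vk. split.
    + intros i hi. rewrite e by easy. destruct (Nat.leb_spec i k), (Nat.leb_spec i k'); try lia; easy.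
    + destruct (Nat.leb_spec k k), (Nat.leb_spec k k'); try lia. lra.
  - apply mon_lt_add. now exists j.
  - assert (j = k') as ->.
    { destruct (lt_eq_lt_dec j k') as [[?|?]|?]; [rewrite z, z' in l by lia; lra|easy|].
      elim a'. rewrite <- e by easy. now apply z. }
    exists k'. unfold monD, vk. split.
    + intros i hi. rewrite e by easy. destruct (Nat.leb_spec i k), (Nat.leb_spec i k'); try lia; easy.
    + destruct (Nat.leb_spec k' k'), (Nat.leb_spec k' k); try lia. lra.
Qed.

(* [l_k o f = l_k (1 - c v l_1 ... l_k + ...)] when [f = x (1 - c v + ...)]. *)
Lemma Lk_delta J f d0 v c k : nf (S J) f 1 (monE 0 1) d0 -> geq v d0 -> d0 v = - c -> (k <= S J)%nat ->
  exists d, nf (S J) (Lk f k) 1 (monE k 1) d /\ geq (vk v k) d /\ d (vk v k) = - c.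
Proof.
  intros hf hv hc. induction k as [|k IH]; intros l.
  - exists d0. rewrite vk_0. auto.
  - destruct (IH ltac:(lia)) as (d & hd & gd & ed). pose proof hd as (_ & _ & sd & _).
    set (A := mono 1 (monE (S k) 1)). set (e := sscale (-1) (smul A (lg d))).
    assert (hA : in_Linf (S J) A) by (apply in_mono, depth_leE; lia).
    assert (hl := lg_in _ _ sd).
    assert (se : small (S J) e).
    { unfold e. apply small_scale. rewrite smul_comm. apply small_mul; [now apply lg_small|easy|].
      intros m hm. apply mono_supp in hm as ->. right. exists (S k). unfold monE, mon0. rewrite Nat.eqb_refl. split; [|lra].
      intros i hi. destruct (Nat.eqb_spec i (S k)); [lia|easy]. }
    assert (N : nf (S J) (slog (Lk f k)) (-1) (monE (S k) (-1)) e).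
    { split; [apply depth_leE; lia|split; [lra|split; [easy|]]].
      rewrite (slog_nf _ _ _ _ _ hd), ln_1, mono_0, sadd_0l, logmonE.
      set (B := mono (-1) (monE (S k) (-1))). assert (hB : in_Linf (S J) B) by (apply in_mono, depth_leE; lia).
      assert (BA : smul B A = sopp one).
      { unfold B, A, sopp, one. rewrite smul_mono, sscale_mono. f_equal.
        apply functional_extensionality. intro i. unfold monD, monE, mon0. destruct (Nat.eqb i (S k)); ring. }
      change e with (sopp (smul A (lg d))).
      transitivity (ssub B (smul (sopp one) (lg d))); [sring|]. rewrite <- BA. sring. }
    exists (ssub (geo e) one). split.
    + change (Lk f (S k)) with (sscale (-1) (sinv (slog (Lk f k)))).
      apply nf_sinv in N. apply (nf_scale _ _ _ _ _ (-1)) in N; [|lra].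
      replace 1 with (-1 * / -1) at 1 by field.
      replace (monE (S k) 1) with (monS (-1) (monE (S k) (-1))); [easy|].
      apply functional_extensionality. intro i. unfold monS, monE. destruct (Nat.eqb i (S k)); ring.
    + destruct (ps_geq (S J) lgc d (vk v k) sd gd eq_refl) as [gl el]. fold (lg d) in gl, el.
      destruct (geq_mul _ _ _ _ (mono_geq 1 (monE (S k) 1)) gl) as [g1 e1]. rewrite monDC, <- vk_S in g1, e1.
      unfold geo. rewrite (ps_sub_one (S J)) by easy.
      destruct (ps_geq (S J) (fun n => match n with 0%nat => 0 | S _ => (-1) ^ n end) e (vk v (S k)) se) as [g2 e2]; [|easy|].
      * intros m hm. apply g1. now apply prod_neq0 in hm.
      * split; [easy|]. rewrite e2. unfold e, sscale. unfold A. rewrite e1, el, ed, mono_eq. unfold lgc. simpl. field.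
Qed.

(** At the monomial [v l_1 ... l_k] only the factor of index [k] contributes: earlier factors have
    exponent 0, the corrections of later ones start at a higher monomial, and so do products of
    corrections. *)
Lemma cml_lead J f d0 v c m k l : nf (S J) f 1 (monE 0 1) d0 -> mon_lt mon0 v -> geq v d0 -> d0 v = - c ->
  fnz m k -> (forall i, In i l -> (i <= S J)%nat) ->
  exists d, in_Linf (S J) d /\ cml f l m = smul (mono 1 (lmsum (monE 0 1) l m)) (sadd one d) /\ geq (vk v k) d /\
    d (vk v k) = - c * m k * INR (count_occ Nat.eq_dec l k).
Proof.
  intros hf pv hv hc [a z] hl. set (w := vk v k).
  assert (pw0 : mon_lt mon0 w).
  { unfold w. destruct k as [|k]; [now rewrite vk_0|]. eapply mon_lt_trans; [exact pv|]. rewrite <- (vk_0 v) at 1. apply vk_lt. lia. }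
  induction l as [|i l IH].
  - exists szero. split; [auto with linf|split; [|split]].
    + simpl. rewrite sadd_0r. fold one. now rewrite smul_one.
    + intros p hp. now elim hp.
    + simpl. unfold szero. ring.
  - destruct IH as (d & hd & ed & gd & cd); [intros; apply hl; now right|].
    assert (li : (i <= S J)%nat) by (apply hl; now left).
    assert (G : exists e, in_Linf (S J) e /\ rpow (Lk f i) (m i) = smul (mono 1 (monS (m i) (lm (monE 0 1) i))) (sadd one e)
       /\ geq w e /\ e w = if Nat.eq_dec i k then - c * m k else 0).
    { destruct (Lk_delta J f d0 v c i hf hv hc li) as (di & hdi & gdi & cdi). pose proof hdi as (_ & _ & si & _).
      assert (P := pw_in _ _ (m i) si).
      assert (F : rpow (Lk f i) (m i) = smul (mono 1 (monS (m i) (lm (monE 0 1) i))) (sadd one (ssub (pw di (m i)) one))).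
      { rewrite (rpow_nf _ _ _ _ _ _ hdi), Rpower_1l. replace (lm (monE 0 1) i) with (monE i 1) by (destruct i; easy). f_equal. sring. }
      assert (Q : geq (vk v i) (ssub (pw di (m i)) one) /\ ssub (pw di (m i)) one (vk v i) = - c * m i).
      { unfold pw. rewrite (ps_sub_one (S J)) by (auto; apply gbinom_0).
        destruct (ps_geq (S J) (fun n => match n with 0%nat => 0 | S _ => gbinom (m i) n end) di (vk v i) si gdi eq_refl) as [g e].
        split; [easy|]. rewrite e, cdi. unfold gbinom. simpl. field. }
      destruct Q as [Q1 Q2].
      destruct (lt_eq_lt_dec i k) as [[lt| ->]|gt].
      - exists szero. split; [auto with linf|]. rewrite (z i lt), rpow_0. split; [|split].
        + rewrite sadd_0r. replace (monS 0 _) with mon0 by mon_ext. fold one. now rewrite smul_one.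
        + intros p hp. now elim hp.
        + destruct (Nat.eq_dec i k); [lia|easy].
      - exists (ssub (pw di (m k)) one). split; [auto with linf|split; [easy|split; [easy|]]].
        destruct (Nat.eq_dec k k); easy.
      - exists (ssub (pw di (m i)) one). split; [auto with linf|split; [easy|split]].
        + apply (geq_lt _ _ _ Q1). now apply vk_lt.
        + destruct (Nat.eq_dec i k); [lia|]. apply (geq_lt_0 _ _ _ Q1). now apply vk_lt. }
    destruct G as (e & he & ee0 & ge & ce).
    exists (sadd (sadd e d) (smul e d)). split; [auto with linf|split; [|split]].
    + simpl. rewrite ed, ee0. fold (sh (sadd one e) (monS (m i) (lm (monE 0 1) i))) (sh (sadd one d) (lmsum (monE 0 1) l m)).
      rewrite smul_sh, smul_comm, smul_sh. unfold sh. rewrite smul_monoA, Rmult_1_l. f_equal. sring.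
    + apply geq_add; [now apply geq_add|]. destruct (geq_mul _ _ _ _ ge gd) as [g _].
      apply (geq_lt _ _ _ g). rewrite <- (monD0 w) at 1. now apply mon_lt_addl.
    + unfold sadd. rewrite ce, cd. destruct (geq_mul _ _ _ _ ge gd) as [g _].
      rewrite (geq_lt_0 _ w _ g) by (rewrite <- (monD0 w) at 1; now apply mon_lt_addl).
      simpl. destruct (Nat.eq_dec i k); [|ring].
      change (match count_occ Nat.eq_dec l k with 0%nat => 1 | S _ => INR (count_occ Nat.eq_dec l k) + 1 end) with (INR (S (count_occ Nat.eq_dec l k))).
      rewrite S_INR. ring.
Qed.

Lemma comp_mon_lead J f d0 v c m k : nf (S J) f 1 (monE 0 1) d0 -> mon_lt mon0 v -> geq v d0 -> d0 v = - c -> c <> 0 ->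
  fnz m k -> depth_le (S J) m ->
  geq (monD m (vk v k)) (ssub (comp_mon f m) (mono 1 m)) /\ ssub (comp_mon f m) (mono 1 m) (monD m (vk v k)) <> 0.
Proof.
  intros hf pv hv hc nc hk hm.
  destruct (cml_lead J f d0 v c m k (seq 0 (S (S J))) hf pv hv hc hk (seq_le J)) as (d & hd & e & g & ed).
  rewrite lmsum_tau, tau_X in e by (auto; apply depth_leE; lia).
  assert (E : ssub (comp_mon f m) (mono 1 m) = smul (mono 1 m) d).
  { rewrite (comp_mon_cml (S J)), e by easy. assert (A := in_mono (S J) 1 m hm). sring. }
  rewrite E. destruct (geq_mul _ _ _ _ (mono_geq 1 m) g) as [g1 e1]. split; [easy|].
  rewrite e1, mono_eq, ed, Rmult_1_l. destruct hk as [a _].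
  assert (hkJ : (k <= S J)%nat) by (apply NNPP; intro; apply a, hm; lia).
  assert (count_occ Nat.eq_dec (seq 0 (S (S J))) k = 1%nat) as ->.
  { apply NoDup_count_occ'; [apply seq_NoDup|]. apply in_seq. lia. }
  simpl. intro z. assert (c * m k = 0) by lra. apply Rmult_integral in H. tauto.
Qed.

(** No cancellation occurs at the tested monomial: by [vk_mono] every other nonconstant monomial of
    [F] contributes strictly above it, and the constant drops out because [1 o f = 1]. *)
Lemma scomp_sub_lead J f d0 v c F m : nf (S J) f 1 (monE 0 1) d0 -> mon_lt mon0 v -> geq v d0 -> d0 v = - c -> c <> 0 ->
  in_Linf (S J) F -> F m <> 0 -> m <> mon0 -> (forall n, F n <> 0 -> n <> mon0 -> mon_le m n) ->
  exists k, ssub (scomp F f) F (monD m (vk v k)) <> 0.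
Proof.
  intros hf pv hv hc nc hF Fm m0 mn.
  assert (cf : cls J f 1 (monE 0 1)).
  { split; [lra|split; [unfold monE; simpl; lra|split; [apply depth_leE; lia|eauto]]]. }
  assert (E : ssub (scomp F f) F = op (fun n => ssub (comp_mon f n) (mono 1 n)) F).
  { unfold ssub, sopp. rewrite scomp_op. rewrite <- (op_delta F) at 2. rewrite <- op_kscale, <- (op_kadd (S J)); [easy| |].
    - apply sfam_tame; [now apply (comp_mon_tame J f 1 (monE 0 1))|easy].
    - apply (sfam_sub (S J) _ _ (supp F)); [|easy]. destruct (tame_delta (S J) (supp F) hF) as [g1 g2]. split.
      + apply (good_sub _ _ _ g1). intros p (i & hi & n). exists i. split; [easy|]. now apply prod_neq0 in n.
      + intro p. apply (finite_sub _ _ (g2 p)). intros i [hi n]. split; [easy|]. now apply prod_neq0 in n. }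
  destruct (fnz_exists m m0) as [k hk]. exists k. rewrite E.
  destruct (comp_mon_lead J f d0 v c m k hf pv hv hc nc hk (proj1 hF m Fm)) as [_ nz].
  unfold op. rewrite (fsumR_single m); [now apply Rmult_integral_contrapositive_currified|].
  intros n nm. destruct (Req_dec_T (F n) 0) as [->|Fn]; [ring|].
  destruct (classic (n = mon0)) as [->|n0].
  - rewrite comp_mon_0. unfold ssub, sadd, sopp, sscale, one. ring.
  - destruct (fnz_exists n n0) as [k' hk'].
    destruct (comp_mon_lead J f d0 v c n k' hf pv hv hc nc hk' (proj1 hF n Fn)) as [g _].
    rewrite (geq_lt_0 _ _ _ g); [ring|]. apply vk_mono; auto.
    destruct (mn n Fn n0) as [->|]; [now elim nm|easy].
Qed.

Lemma scomp_fixed_const J f d0 v c F : nf (S J) f 1 (monE 0 1) d0 -> mon_lt mon0 v -> geq v d0 -> d0 v = - c -> c <> 0 ->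
  in_Linf (S J) F -> scomp F f = F -> forall m, F m <> 0 -> m = mon0.
Proof.
  intros hf pv hv hc nc hF e m hm. apply NNPP. intro m0.
  destruct (good_min (S J) (fun n => F n <> 0 /\ n <> mon0)) as (n & [n1 n2] & mn).
  - apply (good_sub _ _ _ hF). now intros ? [? _].
  - eauto.
  - destruct (scomp_sub_lead J f d0 v c F n hf pv hv hc nc hF n1 n2) as [k hk]; [auto|].
    apply hk. rewrite e. unfold ssub, sadd, sopp, sscale. ring.
Qed.

(** * Structure of Fatou coordinates *)

(** Suppose [n] contributes at [m l_2 ... l_k] through its index [j]. If [j < k], then
    [n j = m j = 0] and there is no contribution; if [j > k], then [n = m / (l_{k+1} ... l_j)] lies
    below [m], against minimality. So [j = k] and [n = m]. *)
Lemma der_at J F m k : (2 <= k)%nat -> (k <= J)%nat -> (forall i, (2 <= i < k)%nat -> m i = 0) ->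
  (forall n, F n <> 0 -> ~ depth_le 1 n -> n <> monE 2 (-1) -> mon_le m n) ->
  der J F (monD m (ee k)) = - m k * F m.
Proof.
  intros h2 hJ z mn. unfold der, op.
  assert (V : forall n, Dk J n (monD m (ee k)) = lam (seq 0 (S J)) n (monD (monD m (ee k)) (monS (-1) n))).
  { intro n. unfold Dk. rewrite smul_monol. ring. }
  rewrite (fsumR_single m).
  - rewrite V. replace (monD (monD m (ee k)) (monS (-1) m)) with (ee k) by mon_ext. rewrite lam_at by easy.
    assert (count_occ Nat.eq_dec (seq 0 (S J)) k = 1%nat) as ->.
    { apply NoDup_count_occ'; [apply seq_NoDup|]. apply in_seq. lia. }
    simpl. ring.
  - intros n nm. rewrite V. apply NNPP. intro h. apply prod_neq0 in h as [Fn h].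
    apply lam_supp in h as (j & _ & j2 & nj & e).
    assert (E : forall i, m i + ee k i = n i + ee j i).
    { intro i. apply (f_equal (fun p => p i)) in e. unfold monD, monS in e. lra. }
    destruct (lt_eq_lt_dec j k) as [[lt| ->]|gt].
    + apply nj. specialize (E j). unfold ee in E. rewrite z in E by lia.
      destruct (Nat.leb_spec 2 j), (Nat.leb_spec j k), (Nat.leb_spec j j); simpl in E; try lia. lra.
    + apply nm. apply functional_extensionality. intro i. specialize (E i). lra.
    + assert (L : mon_lt n m).
      { exists (S k). split.
        - intros i hi. specialize (E i). unfold ee in E.
          destruct (Nat.leb_spec 2 i), (Nat.leb_spec i k), (Nat.leb_spec i j); simpl in E; try lia; lra.
        - specialize (E (S k)). unfold ee in E.
          destruct (Nat.leb_spec 2 (S k)), (Nat.leb_spec (S k) k), (Nat.leb_spec (S k) j); simpl in E; try lia; lra. }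
      apply (mon_lt_irrefl n). eapply mon_lt_le_trans; [exact L|]. apply mn; [easy| |].
      * intro D. apply nj, D. lia.
      * intro D. apply nj. rewrite D. unfold monE. destruct (Nat.eqb_spec j 2); [lia|easy].
Qed.

(* A series with constant derivative [kappa] with respect to [1/l_2] is the sum of [kappa / l_2] and a series in [x] and [l_1]. *)
Lemma der_const J F : in_Linf J F -> (forall m, der J F m <> 0 -> m = mon0) -> forall m, F m <> 0 -> depth_le 2 m.
Proof.
  intros hF h m hm. apply NNPP. intro nd.
  set (B := fun n => F n <> 0 /\ ~ depth_le 1 n /\ n <> monE 2 (-1)).
  assert (Bm : B m).
  { split; [easy|split].
    - intro D. apply nd. now apply (depth_le_mono 1); [lia|].
    - intros ->. apply nd, depth_leE. lia. }
  destruct (good_min J B) as (n & (Fn & n1 & n2) & mn).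
  - apply (good_sub _ _ _ hF). now intros ? [? _].
  - eauto.
  - destruct (first_index (fun i => (2 <= i)%nat /\ n i <> 0)) as (k & [k2 nk] & lk).
    { apply NNPP. intro no. apply n1. intros i hi. apply NNPP. intro ni. apply no. exists i. split; [lia|easy]. }
    assert (z : forall i, (2 <= i < k)%nat -> n i = 0).
    { intros i hi. apply NNPP. intro ni. apply (lk i); [lia|]. split; [lia|easy]. }
    assert (kJ : (k <= J)%nat) by (apply NNPP; intro; apply nk, (proj1 hF n Fn); lia).
    assert (e : monD n (ee k) = mon0).
    { apply h. rewrite der_at; auto.
      - apply Rmult_integral_contrapositive_currified; [lra|easy].
      - intros p Fp p1 p2. apply mn. split; auto. }
    assert (E : forall i, n i = - ee k i).
    { intro i. apply (f_equal (fun p => p i)) in e. unfold monD, mon0 in e. lra. }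
    (* Now [n = 1/(l_2 ... l_k)]. As [k] is the first index from 2 on with a nonzero exponent,
       [k = 2] and [n = 1/l_2], which [B] excludes. *)
    assert (k = 2%nat) as ->.
    { destruct (le_lt_dec k 2); [lia|]. specialize (E 2%nat). rewrite z in E by lia. unfold ee in E.
      destruct (Nat.leb_spec 2 2), (Nat.leb_spec 2 k); simpl in E; try lia; lra. }
    apply n2. apply functional_extensionality. intro i. rewrite E. unfold ee, monE.
    destruct (Nat.leb_spec 2 i), (Nat.leb_spec i 2), (Nat.eqb_spec i 2); simpl; try lia; ring.
Qed.

Lemma mon_le_exp0 a b : mon_le a b -> a 0%nat <= b 0%nat.
Proof.
  intros [->|(k & h & l)]; [lra|]. destruct k as [|k]; [lra|]. rewrite h by lia. lra.
Qed.

Lemma ssub_X_supp f m : lead f 1 (monE 0 1) -> ssub X f m <> 0 ->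
  mon_lt (monE 0 1) m /\ ssub X f m = - f m.
Proof.
  intros (e & _ & l) hm. unfold ssub, sadd, sopp, sscale, X in *.
  destruct (classic (m = monE 0 1)) as [->|n].
  - rewrite mono_eq, e in hm. lra.
  - rewrite mono_neq in hm |- * by easy. split; [|ring]. apply l; [|easy]. intro z. apply hm. rewrite z. ring.
Qed.

Lemma parabolic_delta J f d0 c M : nf J f 1 (monE 0 1) d0 -> lead (ssub X f) c M ->
  let v := monD M (monS (-1) (monE 0 1)) in mon_lt mon0 v /\ geq v d0 /\ d0 v = - c.
Proof.
  intros hf (eM & nc & l) v. assert (lf := nf_lead _ _ _ _ _ hf).
  assert (F : forall m, f (monD m (monE 0 1)) = one m + d0 m).
  { intro m. destruct hf as (_ & _ & _ & ->). rewrite smul_monol, Rmult_1_l. unfold sadd. f_equal; f_equal; mon_ext. }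
  destruct (ssub_X_supp f M lf) as [pM fM]; [congruence|].
  assert (vM : monD v (monE 0 1) = M) by (unfold v; mon_ext).
  assert (pv : mon_lt mon0 v).
  { unfold v. apply (mon_lt_add _ _ (monS (-1) (monE 0 1))) in pM.
    replace (monD (monE 0 1) (monS (-1) (monE 0 1))) with mon0 in pM by mon_ext. easy. }
  split; [easy|split].
  - intros m hm. assert (m0 : m <> mon0) by (intros ->; apply hm, (small_0 J), hf).
    assert (Fm := F m). unfold one in Fm. rewrite mono_neq, Rplus_0_l in Fm by easy.
    assert (G : mon_le M (monD m (monE 0 1))).
    { destruct (classic (monD m (monE 0 1) = M)) as [z|z]; [now left|right]. apply l; [|easy].
      unfold ssub, sadd, sopp, sscale, X. rewrite mono_neq, Fm; [lra|]. intro y. apply m0.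
      apply (monD_inj (monE 0 1)). now rewrite monDC, y, monD0. }
    replace m with (monD (monD m (monE 0 1)) (monS (-1) (monE 0 1))) by mon_ext.
    apply mon_le_add2; [easy|now left].
  - assert (Fv := F v). rewrite vM in Fv. unfold one in Fv. rewrite mono_neq in Fv; [lra|].
    intros z. rewrite z in pv. now apply mon_lt_irrefl in pv.
Qed.

Lemma fatou_structure f Psi c M : parabolic f -> lead (ssub X f) c M -> fatou_coord f Psi ->
  in_Linf 2 Psi /\ forall n, Psi n <> 0 -> 1 - M 0%nat <= n 0%nat.
Proof.
  intros [[[f1 _] _] lf] lg ([j hP] & _ & e). set (J := Nat.max j 1).
  assert (hPJ : in_Linf (S J) Psi) by (apply (in_weaken j); [lia|easy]).
  destruct (lead_nf (S J) f 1 (monE 0 1)) as [d0 hf]; [apply (in_weaken 1); [lia|easy]|easy|].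
  destruct (parabolic_delta _ _ _ _ _ hf lg) as (pv & gv & dv). pose proof lg as (gM & nc & _).
  set (v := monD M (monS (-1) (monE 0 1))) in *.
  assert (cf : cls J f 1 (monE 0 1)).
  { split; [lra|split; [unfold monE; simpl; lra|split; [apply depth_leE; lia|eauto]]]. }
  split.
  (* The derivation kills the 1 in [Psi o f = Psi + 1], so the derivative of [Psi] is invariant
     under [f], hence constant. *)
  - apply (good_strengthen (S J)); [lia|easy|]. apply (der_const (S J)); [easy|].
    apply (scomp_fixed_const J f d0 v c); auto with linf.
    rewrite <- (der_scomp J), e, der_add, der_one by auto with linf. apply sadd_0r.
  (* [1 <= M 0] settles the constant term of [Psi], whose exponent 0 must be at least [1 - M 0]. *)
  - intros n hn. assert (M1 : 1 <= M 0%nat).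
    { destruct (ssub_X_supp f M lf) as [pM _]; [congruence|].
      assert (L := mon_le_exp0 _ _ (or_intror pM)). unfold monE in L. simpl in L. lra. }
    destruct (classic (n = mon0)) as [->|n0]; [unfold mon0; lra|].
    destruct (good_min (S J) (fun n => Psi n <> 0 /\ n <> mon0)) as (m & [m1 m2] & mn).
    + apply (good_sub _ _ _ hPJ). now intros ? [? _].
    + eauto.
    + destruct (scomp_sub_lead J f d0 v c Psi m hf pv gv dv nc hPJ m1 m2) as [k hk]; [auto|].
      (* This monomial occurs in [Psi o f - Psi = 1]. Its exponent of [x] is [m 0 + M 0 - 1],
         because [v = M / x]; so [m 0 = 1 - M 0] for the least nonconstant monomial [m]. *)
      assert (Z : monD m (vk v k) = mon0).
      { apply (mono_supp 1). intro z. apply hk. rewrite e. unfold ssub, sadd, sopp, sscale, one. rewrite z. ring. }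
      apply (f_equal (fun p => p 0%nat)) in Z. unfold monD, vk, v, monS, monE, mon0 in Z. simpl in Z.
      assert (L := mon_le_exp0 _ _ (mn n (conj hn n0))). unfold monD in Z. simpl in Z. lra.
Qed.

(** Quantifying over all Fatou coordinates takes care of the additive constant: replacing [Psi] by
    [Psi + K] adds [2 K eps]. The [comp_ok] clauses express well-definedness, since they assert that
    the composed families are summable. *)
Theorem theoremA (f : ser) :
  parabolic f ->
  (exists c M, lead (ssub X f) c M /\ 0 < c) ->
  (exists h, is_finv (ssub X f) h) /\
  (forall h Psi : ser,
     is_finv (ssub X f) h -> fatou_coord f Psi ->
     comp_ok h (mono 2 (monE 0 1)) /\
     comp_ok Psi (scomp h (mono 2 (monE 0 1))) /\
     in_L 2 (sadd (scomp h (mono 2 (monE 0 1)))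
                  (smul (mono 2 (monE 0 1))
                        (scomp Psi (scomp h (mono 2 (monE 0 1))))))).
Proof.
  intros pf (c & M & lg & pc). pose proof pf as [[[f1 f0] _] lf].
  set (g := ssub X f) in *. pose proof lg as (gM & nc & _).
  assert (hg : in_Linf 1 g) by (unfold g; auto with linf).
  destruct (ssub_X_supp f M lf) as [pM fM]; [fold g; congruence|].
  (* [M] is a monomial of [f], with coefficient [-c], and all exponents of [x] in [f] are
     positive. *)
  assert (M0 : 0 < M 0%nat) by (apply f0; fold g in fM; intro z; rewrite z in fM; lra).
  assert (cg : cls 1 g c M).
  { split; [easy|split; [easy|split; [apply hg; congruence|]]].
    apply lead_nf; [apply (in_weaken 1); [lia|easy]|easy]. }
  destruct (inverse_exists 1 g c M cg) as (h0 & c' & ch & e1 & e2). set (N := tau (tinv M) (monE 0 1)) in *.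
  assert (hh : in_Linf 2 h0) by (destruct ch as (_ & _ & _ & d & hd); now apply nf_in in hd).
  assert (hg2 : in_Linf 2 g) by (apply (in_weaken 1); [lia|easy]).
  split.
  - exists h0. split; [now exists 2%nat|split; [exact (comp_ok_cls 1 g h0 c' N ch hg2)|split; [exact (comp_ok_cls 1 h0 g c M cg hh)|]]].
    now split.
  - intros h Psi ([j hj] & _ & _ & _ & eh) hPsi.
    assert (h = h0) as ->.
    { apply (left_inverse_unique (Nat.max 1 j) g c M h0 c' N h); auto.
      - apply (cls_weaken 1); [lia|easy].
      - apply (cls_weaken 1); [lia|easy].
      - apply (in_weaken j); [lia|easy]. }
    assert (ct : cls 1 (mono 2 (monE 0 1)) 2 (monE 0 1)).
    { split; [lra|split; [unfold monE; simpl; lra|split; [apply depth_leE; lia|]]].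
      exists szero. apply mono_nf; [lra|apply depth_leE; lia]. }
    destruct (scomp_cls 1 _ _ _ _ _ _ ct ch) as [c1 cH]. rewrite tau_X in cH.
    set (H := scomp h0 (mono 2 (monE 0 1))) in *.
    destruct (fatou_structure f Psi c M pf lg hPsi) as [hP lP].
    split; [now apply (comp_ok_cls 1 _ _ _ _ ct)|split; [now apply (comp_ok_cls 1 _ _ _ _ cH)|]].
    assert (hS := scomp_in 1 Psi H c1 N cH hP).
    pose proof cH as (_ & N0 & _ & d & hd). assert (hH := nf_in _ _ _ _ _ hd).
    assert (NM : N 0%nat = / M 0%nat) by (unfold N, tau, tinv, monE; simpl; ring).
    split; [apply in_add; [easy|apply in_mul; [apply in_mono, depth_leE; lia|easy]]|].
    intros m hm. destruct (Req_dec_T (H m) 0) as [z|nz].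
    + unfold sadd in hm. rewrite z, Rplus_0_l in hm. apply smul_supp in hm as (a & b & ha & hb & ->).
      apply mono_supp in ha as ->. unfold supp in hb. rewrite scomp_op in hb. apply op_supp in hb as (n & hn & hb).
      destruct (comp_mon_supp 1 H c1 N cH) as (S0 & _ & q & hs).
      destruct (hs n (proj1 hP n hn) b hb) as (s & h1 & ->).
      assert (s0 := mon_le_exp0 _ _ (q s h1)). specialize (lP n hn). unfold monD, tau, monE, mon0 in *. simpl.
      rewrite NM in *. 
      (* Composition with [H] multiplies exponents of [x] by [1/M 0] on leading monomials, so those
         of [Psi o H] are at least [1/M 0 - 1]. The factor [2 eps] adds 1 and leaves at least
         [1/M 0 > 0]. *)
      assert (/ M 0%nat * (1 - M 0%nat) <= / M 0%nat * n 0%nat) by (apply Rmult_le_compat_l; lra).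
      assert (/ M 0%nat * (1 - M 0%nat) = / M 0%nat - 1) by (field; lra). lra.
    + destruct (nf_lead _ _ _ _ _ hd) as (_ & _ & l). destruct (classic (m = N)) as [->|n]; [easy|].
      assert (L := mon_le_exp0 _ _ (or_intror (l m nz n))). lra.
Qed.
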